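(* Let $p,q \in (1,\infty)$ be two distinct numbers and let $(\Omega_1,\mu_1)$ and $(\Omega_2,\mu_2)$ be two arbitrary measure spaces. Let $j: L^q := L^q(\Omega_2,\mu_2) \to L^p := L^p(\Omega_1,\mu_1)$ be an injective lattice homomorphism. Suppose that $T$ is a linear operator on $L^p$ of norm at most $1$, that $T L^p \subseteq j(L^q)$, and that the induced operator $j^{-1}Tj: L^q \to L^q$ also has norm at most $1$. Then $r_{\mathrm{ess}}(T) < 1$.
   Context: All Banach spaces and $L^p$-spaces are over the complex scalar field; measure spaces are not assumed to be $\sigma$-finite. A lattice homomorphism $j: L^q \to L^p$ is a linear map such that $|j(f)| = j(|f|)$ for all $f \in L^q$. Here $j^{-1}$ denotes the inverse of $j$ defined on the range $j(L^q)$. The essential spectral radius $r_{\mathrm{ess}}(T)$ of a bounded linear operator $T$ on a complex Banach space is the smallest number $r \in [0,\infty)$ such that every complex number of modulus $> r$ is either in the resolvent set of $T$ or is a pole of the resolvent of $T$ and an eigenvalue of $T$ of finite algebraic multiplicity. *)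

(* Defs.v *)
From HB Require Import structures.
From mathcomp Require Import all_boot all_order all_algebra.
From mathcomp Require Import all_classical all_reals all_analysis.
From mathcomp Require Import measurable_realfun complex.

Set Implicit Arguments.
Unset Strict Implicit.
Unset Printing Implicit Defensive.

Import Order.TTheory GRing.Theory Num.Theory.
Import numFieldNormedType.Exports.
Import ComplexField.Normc.

Local Open Scope classical_set_scope.
Local Open Scope ring_scope.
Local Open Scope complex_scope.
Local Open Scope quotient_scope.

(* L^p(mu) for complex-valued functions (the library's L^p is real-valued), as a
   normed space over R[i].  Norms in a normedModType over R[i] are themselves
   R[i]-valued, hence the embeddings _%:C of the real norms below. *)

Section complex_modulus.
Context {R : realType}.
Implicit Types z w : R[i].

Lemma normcE z : `|z| = (normc z)%:C.
Proof. by []. Qed.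

Lemma normc_ge0 z : 0 <= normc z.
Proof. by case: z => a b; exact: sqrtr_ge0. Qed.

Lemma normc_real (x : R) : normc x%:C = `|x|.
Proof. by rewrite /= expr0n addr0 sqrtr_sqr. Qed.

Lemma normcD z w : normc (z + w) <= normc z + normc w.
Proof. by rewrite -lecR rmorphD /= -!normcE ler_normD. Qed.

End complex_modulus.

Section cLfun.
Context d (T : measurableType d) (R : realType).
Variables (mu : {measure set T -> \bar R}) (p : R).
Implicit Types f g : T -> R[i].

Definition cmeasurable f :=
  measurable_fun [set: T] (fun x => complex.Re (f x)) /\
  measurable_fun [set: T] (fun x => complex.Im (f x)).

Definition cLnorm f : \bar R := ('N[mu]_p%:E[EFin \o (@normc R \o f)])%E.

Definition cLfun : {pred T -> R[i]} :=
  [pred f | `[< cmeasurable f /\ (cLnorm f < +oo)%E >]].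

Lemma measurable_normc f :
  cmeasurable f -> measurable_fun [set: T] (fun x => normc (f x)).
Proof.
move=> [mr mi].
rewrite (_ : (fun _ => _) = (fun x =>
    (complex.Re (f x) ^+ 2 + complex.Im (f x) ^+ 2) `^ 2^-1)); last first.
  apply/funext => x; case: (f x) => a b /=.
  by rewrite powR12_sqrt// addr_ge0// sqr_ge0.
apply: (@measurableT_comp _ _ _ _ _ _ (fun x : R => x `^ 2^-1)) => //.
by apply: measurable_funD; exact: measurable_funX.
Qed.

Lemma cLnorm_ge0 f : (0 <= cLnorm f)%E.
Proof. exact: Lnorm_ge0. Qed.

Lemma cLnorm_integralE f :
  cLnorm f = ((\int[mu]_x (normc (f x) `^ p)%:E) `^ p^-1)%E.
Proof.
rewrite /cLnorm unlock; congr poweR; apply: eq_integral => x _ /=.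
by rewrite ger0_norm// normc_ge0.
Qed.

Lemma ae_eq_cLnorm f g : cmeasurable f -> cmeasurable g ->
  f = g %[ae mu] -> cLnorm f = cLnorm g.
Proof.
move=> mf mg fg; rewrite !cLnorm_integralE; congr poweR.
apply: ae_eq_integral => //.
- apply/measurable_EFinP; apply: (@measurableT_comp _ _ _ _ _ _ (@powR R ^~ p)) => //.
  exact: measurable_normc.
- apply/measurable_EFinP; apply: (@measurableT_comp _ _ _ _ _ _ (@powR R ^~ p)) => //.
  exact: measurable_normc.
- by apply: filterS fg => x /= + _ => /(_ I) ->.
Qed.

Hypothesis p1 : 1 <= p.

Lemma cLnormD f g : cmeasurable f -> cmeasurable g ->
  (cLnorm (f + g)%R <= cLnorm f + cLnorm g)%E.
Proof.
move=> mf mg; have p0 : 0 < p by rewrite (lt_le_trans ltr01).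
have mfg : cmeasurable (f + g).
  case: mf mg => [mfr mfi] [mgr mgi]; split.
    rewrite (_ : (fun _ => _) = (fun x => complex.Re (f x) + complex.Re (g x))).
      exact: measurable_funD.
    by apply/funext => x; rewrite fctE; case: (f x) => ? ?; case: (g x).
  rewrite (_ : (fun _ => _) = (fun x => complex.Im (f x) + complex.Im (g x))).
    exact: measurable_funD.
  by apply/funext => x; rewrite fctE; case: (f x) => ? ?; case: (g x).
have mf' := measurable_normc mf; have mg' := measurable_normc mg.
have mfg' := measurable_normc mfg.
apply: le_trans (minkowski_EFin mu mf' mg' p1).
rewrite cLnorm_integralE unlock; apply: gt0_ler_poweR.
- by rewrite invr_ge0 ltW.
- by rewrite in_itv/= leey integral_ge0// => x _; rewrite lee_fin powR_ge0.
- by rewrite in_itv/= leey integral_ge0// => x _; exact: poweR_ge0.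
- apply: ge0_le_integral => //.
  + by move=> x _; rewrite lee_fin powR_ge0.
  + apply/measurable_EFinP.
    by apply: (@measurableT_comp _ _ _ _ _ _ (@powR R ^~ p)).
  + apply/measurable_EFinP.
    apply: (@measurableT_comp _ _ _ _ _ _ (@powR R ^~ p)) => //.
    by apply: measurableT_comp => //; exact: measurable_funD.
  + move=> x _ /=; rewrite lee_fin ge0_ler_powR ?nnegrE ?normc_ge0 ?(ltW p0)//.
    by rewrite ger0_norm ?addr_ge0 ?normc_ge0//; exact: normcD.
Qed.

Lemma cmeasurableZD (a : R[i]) f g :
  cmeasurable f -> cmeasurable g -> cmeasurable (a *: f + g).
Proof.
move=> [fr fi] [gr gi]; split.
  rewrite (_ : (fun _ => _) = (fun x => (complex.Re a * complex.Re (f x) -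
      complex.Im a * complex.Im (f x)) + complex.Re (g x))).
    by apply: measurable_funD => //; apply: measurable_funB;
      exact: measurable_funM.
  by apply/funext => x; rewrite fctE; case: a => ? ? /=;
    rewrite /GRing.scale/=; case: (f x) => ? ?; case: (g x).
rewrite (_ : (fun _ => _) = (fun x => (complex.Re a * complex.Im (f x) +
    complex.Im a * complex.Re (f x)) + complex.Im (g x))).
  by apply: measurable_funD => //; apply: measurable_funD;
    exact: measurable_funM.
by apply/funext => x; rewrite fctE; case: a => ? ? /=;
  rewrite /GRing.scale/=; case: (f x) => ? ?; case: (g x).
Qed.

Lemma cmeasurable0 : cmeasurable 0.
Proof. by split; exact: measurable_cst. Qed.

Lemma cmeasurableZ (a : R[i]) f : cmeasurable f -> cmeasurable (a *: f).
Proof.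
by move=> mf; rewrite -[_ *: f]addr0; exact: cmeasurableZD mf cmeasurable0.
Qed.

Lemma cLnormZ (a : R[i]) f : cmeasurable f ->
  cLnorm (a *: f) = ((normc a)%:E * cLnorm f)%E.
Proof.
move=> mf; have p0 : p != 0 by rewrite gt_eqF// (lt_le_trans ltr01).
rewrite !cLnorm_integralE.
under eq_integral do rewrite [normc _]normcM powRM ?normc_ge0// EFinM.
rewrite ge0_integralZl//.
- rewrite poweRM ?integral_ge0 ?lee_fin ?powR_ge0//; last first.
    by move=> x _; rewrite lee_fin powR_ge0.
  by rewrite poweR_EFin -powRrM mulfV// powRr1// normc_ge0.
- apply/measurable_EFinP.
  apply: (@measurableT_comp _ _ _ _ _ _ (@powR R ^~ p)) => //.
  exact: measurable_normc.
- by move=> x _; rewrite lee_fin powR_ge0.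
- by rewrite lee_fin powR_ge0.
Qed.

Lemma cLnorm0 : cLnorm 0 = 0%E.
Proof.
rewrite /cLnorm [X in Lnorm _ _ X](_ : _ = cst 0%E); last first.
  by apply/funext => x; rewrite /= expr0n addr0 sqrtr0.
by rewrite Lnorm0// eqe gt_eqF// (lt_le_trans ltr01).
Qed.

Lemma cLfun_submod_closed : submod_closed cLfun.
Proof.
split.
  by apply/asboolP; split; [exact: cmeasurable0|rewrite cLnorm0 ltry].
move=> a f g /asboolP[mf lf] /asboolP[mg lg]; apply/asboolP.
split; first exact: cmeasurableZD.
apply: le_lt_trans (cLnormD (cmeasurableZ a mf) mg) _.
rewrite cLnormZ// lte_add_pinfty// lte_mul_pinfty// lee_fin.
exact: normc_ge0.
Qed.

End cLfun.

(* The p-integrable functions, before identification modulo mu.  As in the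
   library's LfunType, the proof of 1 <= p is a parameter of the type so that
   the structures depending on it can be inferred. *)
Section cLfunType.
Context d (T : measurableType d) (R : realType).
Variables (mu : {measure set T -> \bar R}) (p : R) (p1 : 1 <= p).

HB.instance Definition _ :=
  GRing.isSubmodClosed.Build _ _ (cLfun mu p) (cLfun_submod_closed mu p1).

Record cLfunType (p_ge1 : 1 <= p) := CLfun {
  cLfun_val :> T -> R[i];
  cLfunP : cLfun_val \in cLfun mu p }.

HB.instance Definition _ := [isSub for @cLfun_val p1].
HB.instance Definition _ := [Choice of cLfunType p1 by <:].
HB.instance Definition _ := [SubChoice_isSubLmodule of cLfunType p1 by <:].

Implicit Types f g : cLfunType p1.

Lemma cLfun_cmeasurable f : cmeasurable f.
Proof. by have /asboolP[] := cLfunP f. Qed.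

Lemma cLfun_finite f : (cLnorm mu p f < +oo)%E.
Proof. by have /asboolP[] := cLfunP f. Qed.

Lemma cLfun_cLnorm_fin_num f : cLnorm mu p f \is a fin_num.
Proof. by rewrite ge0_fin_numE ?cLnorm_ge0// cLfun_finite. Qed.

Definition cLfun_null : {pred cLfunType p1} :=
  [pred f : cLfunType p1 | `[< (f : T -> R[i]) = cst 0 %[ae mu] >] ].

Lemma cLfun_null_zmod_closed : zmod_closed cLfun_null.
Proof.
split; first by apply/asboolP; exact: aeW.
move=> f g /asboolP f0 /asboolP g0; apply/asboolP.
apply: filterS2 f0 g0 => x /= f0 g0 _.
by rewrite [LHS](_ : _ = f x - g x)// f0// g0// subrr.
Qed.

HB.instance Definition _ :=
  GRing.isZmodClosed.Build _ cLfun_null cLfun_null_zmod_closed.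

Lemma cLfun_abs_subproof f : (fun x => `|f x|) \in cLfun mu p.
Proof.
apply/asboolP; split.
  split; last exact: measurable_cst.
  exact: (measurable_normc (cLfun_cmeasurable f)).
rewrite /cLnorm [X in Lnorm _ _ X](_ : _ = EFin \o (@normc R \o f)).
  exact: cLfun_finite.
by apply/funext => x; rewrite /comp normcE normc_real ger0_norm// normc_ge0.
Qed.

Definition cLfun_abs f : cLfunType p1 := CLfun p1 (cLfun_abs_subproof f).

End cLfunType.

Arguments cLfun_null {d T R} mu {p} p1.

Section cLspace.
Context d (T : measurableType d) (R : realType).
Variables (mu : {measure set T -> \bar R}) (p : R) (p1 : 1 <= p).

Definition cLspace : Type :=
  Quotient.quot (GRing.ZmodClosed.clone _ (cLfun_null mu p1) _).
HB.instance Definition _ := Choice.on cLspace.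
HB.instance Definition _ := EqQuotient.on cLspace.
HB.instance Definition _ := GRing.Zmodule.on cLspace.

Implicit Types (f g : cLfunType mu p1) (u v : cLspace) (a b : R[i]).

Lemma cLspace_eqP f g :
  reflect ((f : T -> R[i]) = g %[ae mu]) (\pi_cLspace f == \pi_cLspace g).
Proof.
rewrite eqmodE; apply: (iffP (asboolP _)); apply: filterS => x /= /(_ I) h _.
  by apply/eqP; rewrite -subr_eq0; exact/eqP.
by rewrite [LHS](_ : _ = f x - g x)// h subrr.
Qed.

Definition cLspace_scale a u : cLspace := \pi_cLspace (a *: repr u).

Lemma pi_cLspaceZ a f : \pi_cLspace (a *: f) = cLspace_scale a (\pi_cLspace f).
Proof.
apply/eqP/cLspace_eqP.
have /eqP/cLspace_eqP : \pi_cLspace f = \pi_cLspace (repr (\pi_cLspace f)).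
  by rewrite reprK.
by apply: filterS => x /= /(_ I) fx _; rewrite [LHS](_ : _ = a *: f x)// fx.
Qed.

Lemma pi_cLspaceD f g :
  \pi_cLspace (f + g) = (\pi_cLspace f : cLspace) + \pi_cLspace g.
Proof. exact: Quotient.pi_add. Qed.

Lemma cLspace_scaleA a b u :
  cLspace_scale a (cLspace_scale b u) = cLspace_scale (a * b) u.
Proof. by elim/quotW: u => f; rewrite -(pi_cLspaceZ b) -!pi_cLspaceZ scalerA. Qed.

Lemma cLspace_scale1 : left_id 1 cLspace_scale.
Proof. by elim/quotW => f; rewrite -pi_cLspaceZ scale1r. Qed.

Lemma cLspace_scaleDr : right_distributive cLspace_scale +%R.
Proof.
move=> a; elim/quotW => f; elim/quotW => g.
by rewrite -pi_cLspaceD -!pi_cLspaceZ scalerDr pi_cLspaceD.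
Qed.

Lemma cLspace_scaleDl u : {morph cLspace_scale^~ u : a b / a + b}.
Proof.
elim/quotW: u => f a b.
by rewrite -!pi_cLspaceZ scalerDl pi_cLspaceD.
Qed.

HB.instance Definition _ := GRing.Zmodule_isLmodule.Build R[i] cLspace
  cLspace_scaleA cLspace_scale1 cLspace_scaleDr cLspace_scaleDl.

Definition cLspace_norm u : R[i] := (fine (cLnorm mu p (repr u)))%:C.

Lemma cLspace_norm_pi f :
  cLspace_norm (\pi_cLspace f) = (fine (cLnorm mu p f))%:C.
Proof.
rewrite /cLspace_norm; congr (fine _)%:C.
apply: ae_eq_cLnorm; try exact: cLfun_cmeasurable.
by apply/cLspace_eqP; rewrite reprK.
Qed.

Lemma cLspace_ler_normD u v :
  cLspace_norm (u + v) <= cLspace_norm u + cLspace_norm v.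
Proof.
elim/quotW: u => f; elim/quotW: v => g.
rewrite -pi_cLspaceD !cLspace_norm_pi -rmorphD lecR.
rewrite -fineD ?cLfun_cLnorm_fin_num// fine_le ?fin_numD ?cLfun_cLnorm_fin_num//.
by apply: cLnormD => //; exact: cLfun_cmeasurable.
Qed.

Lemma cLspace_normrZ a u :
  cLspace_norm (a *: u) = `|a| * cLspace_norm u.
Proof.
elim/quotW: u => f; rewrite -[_ *: _]pi_cLspaceZ !cLspace_norm_pi normcE -rmorphM.
congr _%:C; rewrite cLnormZ//; last exact: cLfun_cmeasurable.
by rewrite fineM ?cLfun_cLnorm_fin_num.
Qed.

Lemma cLspace_normr0_eq0 u : cLspace_norm u = 0 -> u = 0.
Proof.
elim/quotW: u => f; rewrite cLspace_norm_pi => -[].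
move=> /eqP; rewrite fine_eq0 ?cLfun_cLnorm_fin_num// => /eqP.
have p0 : (0 < p%:E)%E by rewrite lte_fin (lt_le_trans ltr01).
have mf : measurable_fun [set: T] (EFin \o (@normc R \o f)).
  by apply/measurable_EFinP; exact: (measurable_normc (cLfun_cmeasurable f)).
move=> /(Lnorm_eq0_eq0 mf p0) f0.
have -> : (0 : cLspace) = \pi_cLspace 0.
  by apply: (addrI (\pi_cLspace 0)); rewrite addr0 -pi_cLspaceD addr0.
apply/eqP/cLspace_eqP; apply: filterS f0 => x /= /(_ I) -[] + _.
exact: eq0_normc.
Qed.

HB.instance Definition _ := Lmodule_isNormed.Build R[i] cLspace
  cLspace_ler_normD cLspace_normrZ cLspace_normr0_eq0.

Lemma normr_pi_cLspace f : `|\pi_cLspace f| = (fine (cLnorm mu p f))%:C.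
Proof. exact: cLspace_norm_pi. Qed.

Definition cLspace_abs u : cLspace := \pi_cLspace (cLfun_abs (repr u)).

Lemma pi_cLspace_abs f : \pi_cLspace (cLfun_abs f) = cLspace_abs (\pi_cLspace f).
Proof.
apply/eqP/cLspace_eqP.
have /eqP/cLspace_eqP : \pi_cLspace f = \pi_cLspace (repr (\pi_cLspace f)).
  by rewrite reprK.
by apply: filterS => x /= + _ => /(_ I) ->.
Qed.

End cLspace.
Arguments cLspace {d T R} mu {p} p1.

Definition lattice_homomorphism (R : realType)
    d (T : measurableType d) (mu : {measure set T -> \bar R})
    d' (T' : measurableType d') (nu : {measure set T' -> \bar R})
    (q p : R) (q1 : 1 <= q) (p1 : 1 <= p)
    (j : {linear cLspace mu q1 -> cLspace nu p1}) :=
  forall f, cLspace_abs (j f) = j (cLspace_abs f).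

Section opnorm.
Context {R : realType} {X Y : normedModType R[i]}.
Implicit Type f : X -> Y.

(* +oo when f is unbounded *)
Definition opnorm f : \bar R :=
  ereal_sup [set (complex.Re `|f x|)%:E | x in [set x : X | `|x| <= 1]].

End opnorm.

(* j^-1 T j, where j^-1 is the inverse of j on its range. *)
Definition induced_operator (R : realType) (X Y : normedModType R[i])
    (j : Y -> X) (T : X -> X) : Y -> Y :=
  'pinv_(fun=> 0) [set: Y] j \o T \o j.

Lemma induced_operatorE (R : realType) (X Y : normedModType R[i])
    (j : Y -> X) (T : X -> X) (y : Y) :
  range T `<=` range j -> j (induced_operator j T y) = T (j y).
Proof. by move=> Tj; apply: pinvK; apply/mem_set/Tj; exists (j y). Qed.

Section spectrum.
Context {R : realType} {X : normedModType R[i]}.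
Variable T : {linear X -> X}.
Implicit Types l z : R[i].

Definition is_resolvent l (S : X -> X) :=
  [/\ cancel (fun x => l *: x - T x) S, cancel S (fun x => l *: x - T x) &
      (opnorm S < +oo)%E].

Definition resolvent_set : set R[i] := [set l | exists S, is_resolvent l S].

(* (l - T)^-1 if l is in the resolvent set *)
Definition resolvent l : X -> X := xget (fun=> 0) (is_resolvent l).

(* l is a pole of order n > 0 of the resolvent: on a punctured disc centred at
   l, the resolvent is the sum, in operator norm, of a Laurent series with
   coefficients in the bounded operators,
     \sum_(k >= 0) (z - l) ^ (k - n) *: A k    where A 0 != 0. *)
Definition resolvent_pole l :=
  exists (n : nat) (A : nat -> {linear X -> X}) (e : R),
  [/\ (0 < n)%N, (forall k, opnorm (A k) < +oo)%E, (exists x, A 0%N x <> 0),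
      0 < e &
      forall z, 0 < `|z - l| < e%:C ->
        resolvent_set z /\
        opnorm (fun x => resolvent z x -
          \sum_(k < m) (z - l) ^ (k%:Z - n%:Z) *: A k x) @[m --> \oo] --> 0%E].

Definition is_eigenvalue l := exists2 x, x <> 0 & T x = l *: x.

Definition generalized_eigenspace l : set X :=
  [set x | exists n, iter n (fun y => l *: y - T y) x = 0].

Definition finite_dimensional (V : set X) :=
  exists (n : nat) (e : 'I_n -> X),
    forall x, V x -> exists c : 'I_n -> R[i], x = \sum_(i < n) c i *: e i.

Definition finite_algebraic_multiplicity l :=
  finite_dimensional (generalized_eigenspace l).

Definition ess_spectral_bound : set R := [set r | 0 <= r /\
  forall l, r%:C < `|l| -> resolvent_set l \/
    [/\ resolvent_pole l, is_eigenvalue l & finite_algebraic_multiplicity l]].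

(* The minimum of the essential spectral bounds, see ess_spectral_radius_min;
   +oo if there are none, which does not happen for a bounded operator on a
   Banach space. *)
Definition ess_spectral_radius : \bar R :=
  ereal_inf [set r%:E | r in ess_spectral_bound].

Lemma ess_spectral_radius_min : ess_spectral_bound !=set0 ->
  exists r, [/\ ess_spectral_bound r, ess_spectral_radius = r%:E &
    forall s, ess_spectral_bound s -> r <= s].
Proof.
move=> B0; have lbB : lbound ess_spectral_bound 0 by move=> r [].
have infB : has_inf ess_spectral_bound by split => //; exists 0.
exists (inf ess_spectral_bound); split.
- split; first exact: lb_le_inf.
  move=> l rl; have rlR : inf ess_spectral_bound < normc l by rewrite -ltcR.
  have [s [s0 Bs] sl] := inf_lt B0 rlR.
  by apply: Bs; rewrite normcE ltcR.
- by rewrite /ess_spectral_radius ereal_inf_EFin//; exists 0.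
- by move=> s Bs; apply: ge_inf => //; exists 0.
Qed.

End spectrum.

(* Main.v *)
Require Import Defs.
From HB Require Import structures.
From mathcomp Require Import all_boot all_order all_algebra.
From mathcomp Require Import all_classical all_reals all_analysis.
From mathcomp Require Import measurable_realfun complex.
From mathcomp Require Import lra ring.

(** The operator T factors as j \o S with S : L^p -> L^q linear, and S is
    bounded by the closed graph theorem. Hence j and S compare the two norms:
    for the operator P = l^-1 S j on L^q, with l unimodular, P is a contraction
    for the norm of L^q and also for the seminorm g |-> |j g|_p, and |P g|_q <=
    C |j g|_p <= C^2 |g|_q. Thus P improves integrability, and since p and q
    differ this can be iterated.

    Spectral part. A contraction T of a Banach space has essential spectral
    radius less than 1 as soon as, for every unimodular l, each bounded
    sequence x with l x_n - T x_n --> 0 has a cluster point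
    (ess_spectral_radius_lt1). Indeed the means h_n (l + h_n - T)^-1 with h_n =
    l / (n + 1) then converge to a projection onto the kernel of l - T, the
    operator l - T is bounded below on a complement, and l is either a point of
    the resolvent set or a simple pole with a finite-dimensional eigenspace
    (peripheral_dichotomy). In both cases a punctured disc around l lies in the
    resolvent set, and compactness of the circle gives an annulus. If a
    sequence of almost eigenvectors had no cluster point, its image under S,
    rescaled, would give a sequence g_n in the unit ball of L^q with P g_n -
    g_n --> 0 and |g_m - g_n|_q bounded below by some dl > 0 (separated_fixed).
    Such a sequence has to be excluded.

    Coordinates. A lattice homomorphism maps disjoint functions to disjoint
    functions, so A |-> |j (e 1_A)|_p ^ p is a measure for every e >= 0 in L^q,
    and the Radon-Nikodym theorem provides a weight E >= 0 with |j g|_p ^ p =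
    \int |g|^p E^(q-p) for g supported in {E != 0} (chart_glue). Writing g = v
    E and m = E^q mu2, the two norms of g become the norms of v in L^q(m) and
    in L^p(m): both norms live over one measure. Only finitely many functions
    are considered at a time, so a chart is extended one function at a time and
    always lives on a sigma-finite part of the measure space.

    Concentration. Let k = v E be almost fixed by P, put b = (q - 1) / (p - 1)
    and z = |v|^(b-1) v, so that |z|^(p-2) z = |v|^(q-2) v. By uniform
    smoothness of L^q, testing P against g = z E shows that \int |z|^p is
    bounded and that equality almost holds in Young's inequality between z and
    the coordinate of P g; uniform convexity of L^p then makes j (g - P g)
    small. Therefore P g is again almost fixed, and what is known of the
    integrability of order s of all almost fixed elements gives integrability
    of order b s of v, up to a set of small q-mass (concentrated_step).
    Iterating from s = q, the order tends to +oo if p < q and to 0 if q < p,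
    with explicit bounds.

    Signed sums. Uniform smoothness and the pigeonhole principle select N
    differences y_i of terms of the sequence all of whose signed sums have norm
    at most 2 N / k, with k as large as desired (signed_sums). These sums are
    almost fixed, hence concentrated. If p < q, integrability of a very high
    order means that each signed sum is at most of the order of N / k off a
    negligible part, while coordinate functions have supports of bounded mass;
    as some choice of signs gives at least half of the sum of the |y_i|, the
    mean of the L^1(m)-norms of the y_i is small (not_separated_high). If q <
    p, then |v| <= K |v E|_q almost everywhere, so that the mean of the |y_i|
    is small pointwise; integrability of a very low order, together with the
    fact that for each i half of the signed sums are at least |y_i|, bounds the
    p-th powers (not_separated_low). In both cases the L^p(m)-norms of the y_i
    cannot stay bounded below, a contradiction. *)

Set Implicit Arguments.
Unset Strict Implicit.
Unset Printing Implicit Defensive.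

Import Order.TTheory GRing.Theory Num.Theory.
Import numFieldNormedType.Exports.
Import ComplexField.Normc.

Local Open Scope classical_set_scope.
Local Open Scope ring_scope.
Local Open Scope complex_scope.
Local Open Scope quotient_scope.

(** * Moduli of complex numbers *)

Section modulus_bounds.
Context {R : realType}.
Implicit Types z w : R[i].

Lemma normc_gt0 z : z != 0 -> 0 < normc z.
Proof.
move=> z0; rewrite lt_neqAle normc_ge0 andbT eq_sym.
by apply: contra z0 => /eqP/eq0_normc ->.
Qed.

Lemma Re_le_normc z : `|complex.Re z| <= normc z.
Proof.
case: z => a b /=; rewrite -[leLHS]ger0_norm// -sqrtr_sqr ler_wsqrtr//.
by rewrite real_normK ?num_real// lerDl sqr_ge0.
Qed.

Lemma Im_le_normc z : `|complex.Im z| <= normc z.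
Proof.
case: z => a b /=; rewrite -[leLHS]ger0_norm// -sqrtr_sqr ler_wsqrtr//.
by rewrite real_normK ?num_real// lerDr sqr_ge0.
Qed.

Lemma normc_le_ReIm z : normc z <= `|complex.Re z| + `|complex.Im z|.
Proof.
case: z => a b /=; rewrite -[leRHS]ger0_norm ?addr_ge0// -sqrtr_sqr ler_wsqrtr//.
rewrite sqrrD !real_normK ?num_real//.
have : 0 <= `|a| * `|b| by rewrite mulr_ge0.
lra.
Qed.

Lemma normcB_ge z w : normc z - normc w <= normc (z - w).
Proof. by rewrite lerBlDr (le_trans _ (normcD _ _))// subrK. Qed.

Lemma normcBC z w : normc (z - w) = normc (w - z).
Proof. by rewrite -normcN opprB. Qed.

End modulus_bounds.

(** * Real-valued norms *)

Section norm.
Context {R : realType} {X : normedModType R[i]}.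
Implicit Types (x y z : X) (a : R[i]).

(** Norms over R[i] take values in R[i]; the real part loses nothing, see
    nmE. *)
Definition nm x : R := complex.Re `|x|.

Lemma nmE x : `|x| = (nm x)%:C.
Proof.
have := normr_ge0 x; rewrite /nm; move: `|x| => -[a b].
by rewrite lecE /= => /andP[/eqP -> _].
Qed.

Lemma nm_ge0 x : 0 <= nm x.
Proof. by rewrite -lecR -nmE normr_ge0. Qed.

Lemma nm0 : nm 0 = 0.
Proof. by rewrite /nm normr0. Qed.

Lemma nm_eq0 x : nm x = 0 -> x = 0.
Proof. by move=> x0; apply/normr0_eq0; rewrite nmE x0. Qed.

Lemma nm_gt0 x : x <> 0 -> 0 < nm x.
Proof. by move=> x0; rewrite lt_neqAle nm_ge0 andbT; apply/eqP => /esym/nm_eq0. Qed.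

Lemma nmD x y : nm (x + y) <= nm x + nm y.
Proof. by rewrite -lecR rmorphD /= -!nmE ler_normD. Qed.

Lemma nmZ a x : nm (a *: x) = normc a * nm x.
Proof.
apply: (@complexI R); rewrite -nmE normrZ rmorphM /= -nmE.
by [].
Qed.

Lemma nmZr (a : R) x : nm (a%:C *: x) = `|a| * nm x.
Proof. by rewrite nmZ normc_real. Qed.

Lemma nmN x : nm (- x) = nm x.
Proof. by rewrite /nm normrN. Qed.

Lemma nmBC x y : nm (x - y) = nm (y - x).
Proof. by rewrite -nmN opprB. Qed.

Lemma nmB x y : nm (x - y) <= nm x + nm y.
Proof. by rewrite (le_trans (nmD _ _))// nmN. Qed.

Lemma nmBl x y : nm x - nm y <= nm (x - y).
Proof. by rewrite lerBlDr (le_trans _ (nmD _ _))// subrK. Qed.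

Lemma nm_tri x y z : nm (x - z) <= nm (x - y) + nm (y - z).
Proof. by rewrite (le_trans _ (nmD _ _))// addrA subrK. Qed.

Lemma nm_sum n (F : 'I_n -> X) : nm (\sum_i F i) <= \sum_i nm (F i).
Proof.
elim/big_ind2 : _ => [|x a y b xa yb|//]; first by rewrite nm0.
by rewrite (le_trans (nmD _ _))// lerD.
Qed.

Lemma nm_small x : (forall e : R, 0 < e -> nm x <= e) -> x = 0.
Proof.
move=> h; apply: nm_eq0; apply/eqP; rewrite eq_le nm_ge0 andbT.
by apply/ler_addgt0Pl => e e0; rewrite addr0 h.
Qed.

End norm.

Section opnorm_facts.
Context {R : realType} {X Y : normedModType R[i]}.

Lemma opnorm_le1 (T : {linear X -> Y}) : (opnorm T <= 1)%E ->
  forall x, nm (T x) <= nm x.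
Proof.
move=> T1 x; have [->|/eqP x0] := eqVneq x 0; first by rewrite linear0 !nm0.
have nx0 := nm_gt0 x0.
have : ((nm (T ((nm x)^-1%:C *: x)))%:E <= 1)%E.
  apply: le_trans T1; apply: ereal_sup_ubound => /=.
  exists ((nm x)^-1%:C *: x) => //=.
  by rewrite nmE nmZr ger0_norm ?invr_ge0 ?nm_ge0// mulVf ?gt_eqF.
by rewrite linearZ nmZr lee_fin ger0_norm ?invr_ge0 ?nm_ge0// mulrC ler_pdivrMr// mul1r.
Qed.

Lemma opnorm_le (f : X -> Y) (c : R) :
  (forall x, nm (f x) <= c * nm x) -> 0 <= c -> (opnorm f <= c%:E)%E.
Proof.
move=> fc c0; apply: ge_ereal_sup => _ [x /= x1 <-].
rewrite lee_fin (le_trans (fc x))// ler_piMr//.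
by rewrite -lecR -nmE.
Qed.

End opnorm_facts.

(** * Extraction of sequences and limits along ultrafilters *)

(** Finite sequences are extended one term at a time; each new term may
    depend on all earlier ones, which is what makes the relation hold for
    all pairs. *)
Lemma greedy (T : eqType) (r : T -> T -> Prop) :
  (forall s : seq T, exists y, forall x, x \in s -> r x y) ->
  exists phi : nat -> T, forall i j, (i < j)%N -> r (phi i) (phi j).
Proof.
move=> /choice[f fP].
pose L := fix L k := if k is k'.+1 then f (L k') :: L k' else [::].
have LP i j : (i < j)%N -> f (L i) \in L j.
  elim: j => // j ih; rewrite ltnS leq_eqVlt => /predU1P[->|/ih ij] /=.
    by rewrite mem_head.
  by rewrite inE ij orbT.
by exists (fun k => f (L k)) => i j ij; apply: fP; exact: LP.
Qed.

Section ultra.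
Context {R : realType}.

(** An ultrafilter of this kind serves as a generalized subsequence along
    which all bounded real sequences converge simultaneously. *)
Lemma nat_ultra : exists U : set_system nat, UltraFilter U /\ \oo `<=` U.
Proof. exact: ultraFilterLemma. Qed.

Lemma ultra_lim (U : set_system nat) (u : nat -> R) (B : R) : UltraFilter U ->
  (forall n, `|u n| <= B) ->
  exists l, forall e : R, 0 < e -> U [set n | `|u n - l| < e].
Proof.
move=> UU uB; pose A := [set a | U [set n | a <= u n]].
have A0 : A (- B) by apply: filterS filterT => n _ /=;
  have := uB n; rewrite ler_norml => /andP[].
have AB : ubound A B.
  move=> a /filter_ex[n /= an]; rewrite (le_trans an)//.
  by have := uB n; rewrite ler_norml => /andP[].
have supA : has_sup A by split; [exists (- B)|exists B].
exists (sup A) => e e0.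
have [a Aa ae] := sup_adherent e0 supA.
have : U (~` [set n | sup A + e <= u n]).
  case: (@in_ultra_setVsetC _ _ [set n | sup A + e <= u n] UU) => // Ae.
  have := ub_le_sup (proj2 supA) Ae; lra.
apply: filterS2 Aa => n /= an /negP; rewrite -ltNge => nA.
rewrite ltr_norml; apply/andP; split; lra.
Qed.

End ultra.

(** * Completeness and the Neumann series *)

Section complete.
Context {R : realType} {X : normedModType R[i]}.

Local Notation hf n := ((2^-1 : R) ^+ n).

(** Geometrically fast sequences suffice, since every Cauchy sequence has a
    subsequence of this kind (ncomplete_cauchy). With an explicit rate, no
    filter on X is involved. *)
Definition ncomplete := forall u : nat -> X,
  (forall n, nm (u n.+1 - u n) <= hf n) ->
  exists l, forall n, nm (u n - l) <= 2 * hf n.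

Lemma hf_small (e : R) : 0 < e -> exists n, hf n < e.
Proof.
move=> e0; have /cvgrPdist_lt/(_ _ e0)[N _ /(_ N (leqnn _))] /= :
    (fun n => hf n) @ \oo --> (0 : R) by apply: cvg_expr; rewrite ger0_norm; lra.
by rewrite sub0r normrN ger0_norm ?exprn_ge0// ?invr_ge0//; exists N.
Qed.

Lemma hf_gt0 n : 0 < hf n.
Proof. by rewrite exprn_gt0//; lra. Qed.

Lemma ncomplete_cauchy (u : nat -> X) : ncomplete ->
  (forall e : R, 0 < e -> exists N, forall n m, (N <= n)%N -> (N <= m)%N ->
     nm (u n - u m) <= e) ->
  exists l, forall e : R, 0 < e -> exists N, forall n, (N <= n)%N ->
     nm (u n - l) <= e.
Proof.
move=> cX uC.
have /choice[f fP] : forall k, exists N, forall n m, (N <= n)%N -> (N <= m)%N ->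
     nm (u n - u m) <= hf k by move=> k; exact: uC (hf_gt0 k).
(* A monotone choice of ranks; the sum dominates each f k. *)
pose g k := (\sum_(i < k.+1) f i)%N.
have gf k : (f k <= g k)%N by rewrite /g big_ord_recr /= leq_addl.
have gg k : (g k <= g k.+1)%N by rewrite /g [leqRHS]big_ord_recr /= leq_addr.
have [l lP] : exists l, forall n, nm (u (g n) - l) <= 2 * hf n.
  apply: (cX (u \o g)) => n /=.
  by apply: fP => //; rewrite (leq_trans (gf n)).
exists l => e e0; have e3 : 0 < e / 3 by lra.
have [k ke] := hf_small e3.
exists (g k) => n gn.
rewrite (le_trans (nm_tri _ (u (g k)) _))//.
have := lP k; have := fP k n (g k) (leq_trans (gf k) gn) (gf k).
lra.
Qed.

(** If for some d no d-ball around a term contained almost all terms, in the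
    sense of an ultrafilter, the greedy construction would produce a
    d-separated subsequence. So the ultrafilter is Cauchy, and its limit is
    a cluster point. *)
Lemma cluster_exists (x : nat -> X) : ncomplete ->
  (forall phi : nat -> nat, (forall i j, (i < j)%N -> (phi i < phi j)%N) ->
     forall d : R, 0 < d -> exists i j, (i < j)%N /\
       nm (x (phi i) - x (phi j)) < d) ->
  exists z, forall d : R, 0 < d -> forall n0, exists2 n, (n0 <= n)%N &
    nm (x n - z) < d.
Proof.
move=> cX xsep; have [U [UU ooU]] := nat_ultra.
have H d : 0 < d -> exists n, U [set m | nm (x n - x m) < d].
  move=> d0; apply: contrapT => /forallNP nU.
  have nU' n : U [set m | d <= nm (x n - x m)].
    have [//|] := @in_ultra_setVsetC _ _ [set m | nm (x n - x m) < d] UU.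
      by move/nU.
    by apply: filterS => m /= /negP; rewrite -leNgt.
  have [|phi phiP] := @greedy nat (fun n m => (n < m)%N /\ d <= nm (x n - x m)).
    elim=> [|n s [y _]]; first by exists 0%N.
    suff : U [set m | forall k, k \in n :: s -> (k < m)%N /\ d <= nm (x k - x m)].
      by move=> /filter_ex.
    elim: (n :: s) => {n s y} [|n s ih]; first by apply: filterS filterT.
    have Un : U [set m | (n < m)%N] by apply: ooU; exists n.+1.
    apply: filterS3 ih Un (nU' n) => m /= ih nm1 dn k.
    by rewrite inE => /predU1P[->//|/ih].
  have [|i [j [ij]]] := xsep phi _ d d0; first by move=> i j /phiP[].
  by have [_] := phiP _ _ ij; rewrite leNgt => /negP.
have /choice[f fP] : forall k, exists n, U [set m | nm (x n - x m) < hf k / 2].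
  by move=> k; apply: H; rewrite divr_gt0// hf_gt0.
have [l lP] : exists l, forall n, nm (x (f n) - l) <= 2 * hf n.
  apply: (cX (x \o f)) => n /=.
  have [m [/= h1 h2]] := filter_ex (filterI (fP n) (fP n.+1)).
  rewrite (le_trans (nm_tri _ (x m) _))// (nmBC (x m)).
  move: h1 h2; rewrite exprS; have := hf_gt0 n; lra.
exists l => d d0 n0; have d3 : 0 < d / 3 by lra.
have [k kd] := hf_small d3.
have Un : U [set m | (n0 <= m)%N] by apply: ooU; exists n0.
have [m [/= h1 h2]] := filter_ex (filterI (fP k) Un).
exists m => //; rewrite (le_lt_trans (nm_tri _ (x (f k)) _))// (nmBC (x m)).
have := lP k; have := hf_gt0 k; lra.
Qed.

End complete.
Arguments ncomplete {R} X.

Section neumann.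
Context {R : realType} {X : normedModType R[i]}.

Lemma expr_small (k C e : R) : 0 <= k < 1 -> 0 <= C -> 0 < e ->
  exists N, forall n, (N <= n)%N -> k ^+ n * C <= e.
Proof.
move=> /andP[k0 k1] C0 e0; have C1 : 0 < C + 1 by lra.
have /cvgrPdist_lt/(_ _ (divr_gt0 e0 C1))[N _ NP] :
    (fun n => k ^+ n) @ \oo --> (0 : R) by apply: cvg_expr; rewrite ger0_norm.
exists N => n /NP /=; rewrite sub0r normrN ger0_norm ?exprn_ge0//.
rewrite ltr_pdivlMr// => /ltW; apply: le_trans.
by rewrite ler_wpM2l ?exprn_ge0// lerDl.
Qed.

(** The Neumann series, summed by iterating x |-> y + A x. *)
Lemma contraction_solve (A : X -> X) (k : R) : ncomplete X -> 0 <= k < 1 ->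
  (forall x y, A (x - y) = A x - A y) -> (forall x, nm (A x) <= k * nm x) ->
  forall y, exists x, x - A x = y.
Proof.
move=> cX k01 AB Ak y; have /andP[k0 k1] := k01.
pose u n := iter n (fun x => y + A x) 0.
pose C := nm y / (1 - k).
have C0 : 0 <= C by rewrite divr_ge0 ?nm_ge0//; lra.
have uC n : nm (u n) <= C.
  elim: n => [|n ih]; first by rewrite nm0.
  rewrite (le_trans (nmD _ _))// (le_trans (lerD (lexx _) (Ak _)))//.
  rewrite (_ : C = nm y + k * C); last by rewrite /C; field; lra.
  by rewrite lerD2l ler_wpM2l.
have ud n j : nm (u (n + j)%N - u n) <= k ^+ n * C.
  elim: n => [|n ih]; first by rewrite add0n subr0 expr0 mul1r.
  rewrite addSn /= opprD addrACA subrr add0r -AB exprS -mulrA.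
  by rewrite (le_trans (Ak _))// ler_wpM2l.
have [l lP] : exists l, forall e : R, 0 < e -> exists N, forall n, (N <= n)%N ->
     nm (u n - l) <= e.
  apply: ncomplete_cauchy => // e e0.
  have [|N NP] := @expr_small k C (e / 2) k01 C0; first by lra.
  have NN j : nm (u (N + j)%N - u N) <= e / 2 by rewrite (le_trans (ud _ _))// NP.
  exists N => n m Nn Nm; rewrite (le_trans (nm_tri _ (u N) _))//.
  have := NN (n - N)%N; have := NN (m - N)%N; rewrite !subnKC// (nmBC (u N)); lra.
exists l; apply/eqP; rewrite -subr_eq0; apply/eqP/nm_small => e e0.
have [|N NP] := lP (e / 2); first by lra.
rewrite (_ : _ - _ - _ = (l - u N.+1) + (A (u N) - A l)); last first.
  by rewrite /= opprD !addrA subrK addrAC.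
rewrite (le_trans (nmD _ _))// (nmBC l) -AB.
have := NP N (leqnn _); have := NP N.+1 (leqnSn _); have := Ak (u N - l).
have : k * nm (u N - l) <= nm (u N - l) by rewrite ler_piMl ?nm_ge0// ltW.
lra.
Qed.

End neumann.

(** * Unimodular points of the spectrum of a contraction *)

Section resolvent.
Context {R : realType} {X : normedModType R[i]}.
Variable T : {linear X -> X}.
Implicit Types l : R[i].

Lemma shift_linear l (a : R[i]) (x y : X) :
  l *: (a *: x + y) - T (a *: x + y) = a *: (l *: x - T x) + (l *: y - T y).
Proof.
have -> : T (a *: x + y) = a *: T x + T y by rewrite linearP.
rewrite scalerDr (scalerBr a) opprD addrACA; congr (_ - _ + _).
by rewrite !scalerA mulrC.
Qed.

Lemma shiftB l (x y : X) :
  l *: (x - y) - T (x - y) = (l *: x - T x) - (l *: y - T y).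
Proof. by have := shift_linear l (-1) y x; rewrite !scaleN1r !(addrC (- _)). Qed.

Lemma shift_le l (x : X) : (forall x, nm (T x) <= nm x) ->
  nm (l *: x - T x) <= (normc l + 1) * nm x.
Proof.
by move=> T1; rewrite (le_trans (nmB _ _))// nmZ mulrDl mul1r lerD2l.
Qed.

(** Bounded below and onto: the inverse is then bounded by c^-1. *)
Lemma resolvent_setI l (c : R) : 0 < c ->
  (forall x, c * nm x <= nm (l *: x - T x)) ->
  (forall y, exists x, l *: x - T x = y) -> resolvent_set T l.
Proof.
move=> c0 low /choice[S SP]; exists S; split => //.
- move=> x; apply/eqP; rewrite -subr_eq0; apply/eqP/nm_eq0/eqP.
  rewrite eq_le nm_ge0 andbT -(ler_pM2l c0) mulr0 (le_trans (low _))//.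
  by rewrite shiftB SP subrr nm0.
- have : (opnorm S <= (c^-1)%:E)%E.
    apply: opnorm_le; last by rewrite invr_ge0 ltW.
    by move=> x; rewrite ler_pdivlMl// (le_trans (low _))// SP.
  by move/le_lt_trans; apply; rewrite ltry.
Qed.

Lemma resolventK l : resolvent_set T l ->
  cancel (fun x => l *: x - T x) (resolvent T l) /\
  cancel (resolvent T l) (fun x => l *: x - T x).
Proof. by move=> /(xgetPex (fun=> 0)) []. Qed.

End resolvent.

Section linear_pack.
Context {R : realType} {X Y : normedModType R[i]}.

Lemma linear_pack (f : X -> Y) : (forall a x y, f (a *: x + y) = a *: f x + f y) ->
  exists g : {linear X -> Y}, forall x, g x = f x.
Proof.
move=> flin; pose m := GRing.isLinear.Build _ _ _ _ f flin.
by pose g : {linear X -> Y} := HB.pack f m; exists g.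
Qed.

End linear_pack.

Section peripheral.
Context {R : realType} {X : normedModType R[i]}.
Hypothesis cX : ncomplete X.
Variable T : {linear X -> X}.
Hypothesis T1 : forall x, nm (T x) <= nm x.

(** A compactness condition that holds for quasi-compact T; it makes the
    kernel of l0 - T finite-dimensional (fin_dim) and l0 - T bounded below
    on a complement (Ylow). *)
Definition almost_eigen_clusters (l0 : R[i]) :=
  forall (x : nat -> X) (B : R), (forall n, nm (x n) <= B) ->
  (forall e : R, 0 < e -> exists N, forall n, (N <= n)%N ->
     nm (l0 *: x n - T (x n)) <= e) ->
  exists z, forall d : R, 0 < d -> forall n0, exists2 n, (n0 <= n)%N &
    nm (x n - z) < d.

Lemma shift_low l x : (normc l - 1) * nm x <= nm (l *: x - T x).
Proof.
rewrite (le_trans _ (nmBl _ _))// nmZ mulrBl mul1r lerD2l lerN2 T1//.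
Qed.

Lemma shift_surj l : 1 < normc l -> forall y, exists x, l *: x - T x = y.
Proof.
move=> l1 y; have l0 : l != 0 by apply: contraTneq l1 => ->; rewrite normc0 -leNgt.
have nl0 : 0 < normc l by lra.
have [|||x xP] := @contraction_solve R X (fun x => l^-1 *: T x) (normc l)^-1
  cX _ _ _ (l^-1 *: y).
- by rewrite invr_ge0 ltW//= invf_lt1.
- by move=> x z; rewrite -scalerBr linearB.
- by move=> x; rewrite nmZ normcV// ler_wpM2l// ?invr_ge0 ?(ltW nl0).
- exists x; apply: (scalerI (_ : l^-1 != 0)); first by rewrite invr_eq0.
  by rewrite scalerBr scalerA mulVf// scale1r.
Qed.

Lemma resolvent_out l : 1 < normc l -> resolvent_set T l.
Proof.
move=> l1; apply: (@resolvent_setI _ _ _ _ (normc l - 1)).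
- by rewrite subr_gt0.
- exact: shift_low.
- exact: shift_surj.
Qed.

Variable l0 : R[i].
Hypothesis nl0 : normc l0 = 1.
Hypothesis prec : almost_eigen_clusters l0.

Definition eig_shift (x : X) := l0 *: x - T x.
Local Notation Q := eig_shift.

(** l0 is approached along the ray outside the unit disc, where the
    contraction T has a resolvent of norm at most n.+1, see Flow. *)
Definition radial n : R[i] := (n.+1%:R^-1)%:C * l0.
Local Notation h := radial.

Let nh n : normc (h n) = n.+1%:R^-1.
Proof. by rewrite normcM normc_real nl0 mulr1 ger0_norm. Qed.

Let h0 n : h n != 0.
Proof.
apply/eqP => h0; have := nh n; rewrite h0 normc0 => /esym/eqP.
by rewrite invr_eq0 pnatr_eq0.
Qed.

Let h1 n : normc (l0 + h n) = 1 + n.+1%:R^-1.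
Proof.
rewrite (_ : l0 + h n = (1 + n.+1%:R^-1)%:C * l0); last first.
  by rewrite rmorphD mulrDl mul1r.
by rewrite normcM normc_real nl0 mulr1 ger0_norm.
Qed.

Let hsmall (C e : R) : 0 < e -> exists N, forall n, (N <= n)%N ->
  n.+1%:R^-1 * C <= e.
Proof.
move=> e0; have [|C0] := leP C 0.
  move=> C0; exists 0%N => n _; apply: le_trans (ltW e0).
  by rewrite mulr_ge0_le0.
exists (Num.bound (C / e)) => n Nn.
rewrite ler_pdivrMl// mulrC -ler_pdivrMl// mulrC.
have := archi_boundP (divr_ge0 (ltW C0) (ltW e0)).
move=> /ltW /le_trans; apply; rewrite ler_nat.
exact: leq_trans Nn (leqnSn _).
Qed.

Let Qlin a x y : Q (a *: x + y) = a *: Q x + Q y.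
Proof. exact: shift_linear. Qed.

Let QB x y : Q (x - y) = Q x - Q y.
Proof. exact: shiftB. Qed.

Let Q0 : Q 0 = 0.
Proof. by rewrite -(subrr (0 : X)) QB !subrr. Qed.

Let QZ a x : Q (a *: x) = a *: Q x.
Proof. by rewrite -[a *: x]addr0 Qlin Q0 addr0. Qed.

Let Q2 x : nm (Q x) <= 2 * nm x.
Proof. by rewrite (le_trans (shift_le _ _ T1))// nl0 (_ : 1 + 1 = 2). Qed.

Let exF n : exists S : X -> X, forall y, Q (S y) + h n *: S y = y.
Proof.
have /choice[S SP] : forall y, exists x, Q x + h n *: x = y.
  move=> y; have [|x xP] := @shift_surj (l0 + h n) _ y.
    by rewrite h1 ltrDl.
  by exists x; rewrite -xP /eig_shift scalerDl addrAC.
by exists S.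
Qed.

(** The resolvent of T at l0 + h n. *)
Definition radial_inv n : X -> X := projT1 (cid (exF n)).
Local Notation F := radial_inv.

Let FP n y : Q (F n y) + h n *: F n y = y.
Proof. by rewrite /radial_inv; case: cid. Qed.

Let Flow n x : n.+1%:R^-1 * nm x <= nm (Q x + h n *: x).
Proof.
rewrite (_ : Q x + _ = (l0 + h n) *: x - T x); last first.
  by rewrite /eig_shift scalerDl addrAC.
by rewrite (le_trans _ (shift_low _ _))// h1 addrC addKr.
Qed.

Let Finj n x y : Q x + h n *: x = Q y + h n *: y -> x = y.
Proof.
move=> xy; apply/eqP; rewrite -subr_eq0; apply/eqP/nm_eq0/eqP.
rewrite eq_le nm_ge0 andbT; have : n.+1%:R^-1 * nm (x - y) <= 0.
  by rewrite (le_trans (Flow _ _))// QB scalerBr addrACA -opprD xy subrr nm0.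
by rewrite pmulr_rle0// invr_gt0.
Qed.

Let FK n x : F n (Q x + h n *: x) = x.
Proof. by apply: (@Finj n); rewrite FP. Qed.

Let Flin n a x y : F n (a *: x + y) = a *: F n x + F n y.
Proof.
apply: (@Finj n); rewrite FP Qlin [h n *: _]scalerDr scalerA mulrC -scalerA.
by rewrite addrACA -[a *: Q _ + _]scalerDr !FP.
Qed.

(** Abel means of the powers of l0^-1 T. They are contractions that fix the
    kernel N of Q and almost annihilate the range of Q, as Q (J n x) = h n
    *: (x - J n x). *)
Definition radial_mean n x := h n *: F n x.
Local Notation J := radial_mean.

Let J1 n x : nm (J n x) <= nm x.
Proof. by rewrite nmZ nh (le_trans (Flow _ _))// FP. Qed.

Let Jlin n a x y : J n (a *: x + y) = a *: J n x + J n y.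
Proof. by rewrite /radial_mean Flin scalerDr !scalerA mulrC. Qed.

Let JB n x y : J n (x - y) = J n x - J n y.
Proof. by rewrite addrC -scaleN1r Jlin scaleN1r addrC. Qed.

Let subJ n x : x - J n x = Q (F n x).
Proof. by rewrite -{1}(FP n x) addrK. Qed.

Let QJ n x : Q (J n x) = h n *: (x - J n x).
Proof.
by rewrite subJ /radial_mean -[h n *: _ in LHS]addr0 Qlin Q0 addr0.
Qed.

Let N x := Q x = 0.
(** A closed subspace that contains the range of Q and meets the kernel of Q
    trivially; it is the complement of the eigenspace. *)
Definition radial_null y := forall e : R, 0 < e -> exists n0, forall n, (n0 <= n)%N ->
  nm (J n y) <= e.
Local Notation Y := radial_null.

Let NJ n z : N z -> J n z = z.
Proof.
move=> Nz; have F0 : F n 0 = 0 by rewrite -[RHS](FK n) Q0 scaler0 addr0.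
by rewrite /radial_mean -{2}(FK n z) Nz add0r -(addr0 (h n *: z)) Flin F0 addr0.
Qed.

Let Ylin a x y : Y x -> Y y -> Y (a *: x + y).
Proof.
move=> Yx Yy e e0; have a0 : 0 < normc a + 1 by have := normc_ge0 a; lra.
have [|n1 P1] := Yx (e / 2 / (normc a + 1)); first by rewrite divr_gt0//; lra.
have [|n2 P2] := Yy (e / 2); first by lra.
exists (maxn n1 n2) => n; rewrite geq_max => /andP[/P1 {}P1 /P2 {}P2].
rewrite Jlin (le_trans (nmD _ _))// nmZ.
have : normc a * nm (J n x) <= e / 2; last by lra.
rewrite (le_trans (ler_wpM2l (normc_ge0 a) P1))//.
rewrite mulrA ler_pdivrMr// mulrC ler_wpM2l//; first by lra.
by rewrite lerDl.
Qed.

Let YQ x : Y (Q x).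
Proof.
move=> e e0; have [n0 P] := @hsmall (2 * nm x) e e0.
exists n0 => n /P; apply: le_trans.
have -> : J n (Q x) = h n *: (x - J n x).
  rewrite subJ /J; congr (_ *: _); apply: (@Finj n); rewrite FP.
  by rewrite -{1}(FP n x) -[in LHS](addrC (h n *: _)) Qlin addrC.
rewrite nmZ nh ler_wpM2l// (le_trans (nmB _ _))//.
by have := J1 n x; lra.
Qed.

Let YB x y : Y x -> Y y -> Y (x - y).
Proof. by move=> Yx Yy; rewrite addrC -scaleN1r; exact: Ylin. Qed.

Let Yclosed z : (forall e : R, 0 < e -> exists2 y, Y y & nm (y - z) <= e) -> Y z.
Proof.
move=> zY e e0; have [|y Yy yz] := zY (e / 2); first by lra.
have [|n0 P] := Yy (e / 2); first by lra.
exists n0 => n /P {}P; rewrite -(subKr y z) JB (le_trans (nmB _ _))//.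
by have := J1 n (y - z); lra.
Qed.

Let NY z : N z -> Y z -> z = 0.
Proof.
move=> Nz Yz; apply: nm_small => e /Yz[n0 P].
by rewrite -(NJ n0 Nz) P.
Qed.

(** The means J n x are almost eigenvectors, hence cluster at some z. The
    limit lies in the kernel, and x - z lies in the closed subspace Y
    because each x - J n x is in the range of Q. *)
Let exP x : exists z, N z /\ Y (x - z).
Proof.
have [|e e0|z zP] := @prec (fun n => J n x) (nm x).
- by move=> n; exact: J1.
- have [n0 P] := @hsmall (2 * nm x) e e0.
  exists n0 => n /P; apply: le_trans.
  change (nm (Q (J n x)) <= n.+1%:R^-1 * (2 * nm x)).
  rewrite QJ nmZ nh ler_wpM2l// (le_trans (nmB _ _))//.
  by have := J1 n x; lra.
exists z; split.
  apply: nm_small => e e0; have [|n0 P] := @hsmall (2 * nm x) (e / 2).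
    by lra.
  have [|n /P {}P zn] := zP (e / 4) _ n0; first by lra.
  rewrite -(subKr (J n x) z) QB (le_trans (nmB _ _))//.
  have := Q2 (J n x - z); suff : nm (Q (J n x)) <= e / 2 by lra.
  rewrite QJ nmZ nh (le_trans _ P)// ler_wpM2l// (le_trans (nmB _ _))//.
  by have := J1 n x; lra.
apply: Yclosed => e e0; have [n _ zn] := zP _ e0 0%N.
exists (x - J n x); first by rewrite subJ; exact: YQ.
by rewrite opprB addrC addrA subrK nmBC ltW.
Qed.

(** The projection onto the eigenspace along Y; being a limit of the
    contractions J n, it is a contraction. *)
Definition eig_proj x : X := projT1 (cid (exP x)).
Local Notation P := eig_proj.

Let NP x : N (P x).
Proof. by rewrite /eig_proj; case: cid => ? []. Qed.

Let YP x : Y (x - P x).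
Proof. by rewrite /eig_proj; case: cid => ? []. Qed.

Let Nlin a x y : N x -> N y -> N (a *: x + y).
Proof. by rewrite /N Qlin => -> ->; rewrite scaler0 addr0. Qed.

Let NB x y : N x -> N y -> N (x - y).
Proof. by rewrite /N QB => -> ->; rewrite subr0. Qed.

Let Puniq x z : N z -> Y (x - z) -> P x = z.
Proof.
move=> Nz Yz; apply/eqP; rewrite -subr_eq0; apply/eqP/NY.
  exact: NB.
rewrite (_ : P x - z = (x - z) - (x - P x)); first exact: YB.
by rewrite opprB [RHS]addrC addrA subrK.
Qed.

Let Plin a x y : P (a *: x + y) = a *: P x + P y.
Proof.
apply: Puniq; first exact: Nlin.
by rewrite opprD addrACA -scalerBr; exact: Ylin.
Qed.

Let PN z : N z -> P z = z.
Proof.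
by move=> Nz; apply: Puniq => //; rewrite subrr -Q0; exact: YQ.
Qed.

Let PY y : Y y -> P y = 0.
Proof. by move=> Yy; apply: Puniq; rewrite ?subr0//; exact: Q0. Qed.

Let P1 x : nm (P x) <= nm x.
Proof.
apply/ler_addgt0Pr => e e0; have [n0 /(_ n0 (leqnn _)) n0P] := YP x e0.
rewrite -(NJ n0 (NP x)); rewrite -{1}(subKr x (P x)) JB.
by rewrite (le_trans (nmB _ _))// lerD.
Qed.

(** Otherwise there are unit vectors of Y that are almost eigenvectors; a
    cluster point is a unit vector in N and in Y, which is impossible. *)
Let Ylow : exists2 c : R, 0 < c & forall y, Y y -> c * nm y <= nm (Q y).
Proof.
apply: contrapT => noc.
have /choice[y yP] : forall n, exists y, [/\ Y y, nm y = 1 & nm (Q y) <= n.+1%:R^-1].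
  move=> n; apply: contrapT => noy; apply: noc; exists n.+1%:R^-1 => //.
  move=> y Yy; rewrite leNgt; apply/negP => ylt; apply: noy.
  have y0 : 0 < nm y.
    rewrite lt_neqAle nm_ge0 andbT; apply/eqP => /esym y0.
    by move: ylt; rewrite y0 mulr0 ltNge nm_ge0.
  have nmy : nm ((nm y)^-1%:C *: y) = 1.
    by rewrite nmZr ger0_norm ?invr_ge0 ?nm_ge0// mulVf ?gt_eqF.
  have Y0 : Y 0 by rewrite -Q0; exact: YQ.
  exists ((nm y)^-1%:C *: y); split=> //.
    by rewrite -[_ *: _]addr0; exact: Ylin.
  rewrite -[_ *: _]addr0 Qlin Q0 addr0 nmZr ger0_norm ?invr_ge0 ?nm_ge0//.
  by rewrite ler_pdivrMl// mulrC ltW.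
have [|e e0|z zP] := @prec y 1; first by move=> n; have [_ ->] := yP n.
  have [n0 n0P] := @hsmall 1 e e0.
  exists n0 => n /n0P; rewrite mulr1; apply: le_trans.
  by have [] := yP n.
have z0 : z = 0.
  apply: NY.
    apply: nm_small => e e0; have [|n0 n0P] := @hsmall 1 (e / 2).
      by lra.
    have [|n /n0P {}n0P zn] := zP (e / 4) _ n0; first by lra.
    rewrite -(subKr (y n) z) QB (le_trans (nmB _ _))//.
    have : nm (Q (y n)) <= e / 2.
      by rewrite (le_trans _ n0P)// mulr1; have [_ _] := yP n.
    by have := Q2 (y n - z); lra.
  apply: Yclosed => e e0; have [n _ zn] := zP _ e0 0%N.
  by exists (y n); [have [] := yP n|exact: ltW].
have [n _] := zP 1 ltr01 0%N; rewrite z0 subr0.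
by have [_ -> _] := yP n; rewrite ltxx.
Qed.

(** The solution is the limit of F n w with w = x - P x. These vectors stay
    in Y, where Q is bounded below, and Q (F n w) = w - h n *: F n w, so
    they form a Cauchy sequence. *)
Let exB x : exists u, Y u /\ Q u = x - P x.
Proof.
have [c c0 cP] := Ylow.
set w := x - P x; have Yw : Y w by exact: YP.
pose u n := F n w.
have Yu n : Y (u n).
  set z := P (u n); set v := u n - z.
  have Yv : Y v by exact: YP.
  have Nz : N z by exact: NP.
  suff -> : u n = v by [].
  suff z0 : z = 0 by rewrite /v z0 subr0.
  apply: NY => //.
  rewrite (_ : z = (h n)^-1 *: (w - Q v) - v).
    apply: YB => //; rewrite -[_ *: _]addr0; apply: Ylin; first by apply: YB.
    by rewrite -Q0; exact: YQ.
  have Qv : Q v = Q (u n) by rewrite /v QB Nz subr0.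
  rewrite Qv -{1}(FP n w) addrAC subrr add0r scalerA mulVf ?h0// scale1r.
  by rewrite /v opprB addrC subrK.
have [m0 m0P] := @hsmall 1 (c / 2) ltac:(lra).
have ub n : (m0 <= n)%N -> nm (u n) <= 2 / c * nm w.
  move=> /m0P; rewrite mulr1 => nc.
  have := cP _ (Yu n); rewrite (_ : Q (u n) = w - h n *: u n); last first.
    by rewrite -{1}(FP n w) addrK.
  move=> /le_trans/(_ (nmB _ _)); rewrite nmZ nh => le.
  have c2 : 0 < c / 2 by lra.
  rewrite -(ler_pM2l c2) (_ : c / 2 * (2 / c * _) = nm w); last by field; lra.
  have := le_trans le (lerD (lexx _) (ler_wpM2r (nm_ge0 (u n)) nc)); lra.
have ud n m : (m0 <= n)%N -> (m0 <= m)%N -> c * nm (u n - u m) <=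
    (n.+1%:R^-1 + m.+1%:R^-1) * (2 / c * nm w).
  move=> n0 m1; rewrite (le_trans (cP _ (YB (Yu n) (Yu m))))// QB.
  rewrite (_ : Q (u n) = w - h n *: u n); last by rewrite -{1}(FP n w) addrK.
  rewrite (_ : Q (u m) = w - h m *: u m); last by rewrite -{1}(FP m w) addrK.
  rewrite opprB addrC addrA subrK (le_trans (nmB _ _))// !nmZ !nh addrC mulrDl.
  by apply: lerD; rewrite ler_wpM2l// ub.
have [l lP] : exists l, forall e : R, 0 < e -> exists N, forall n, (N <= n)%N ->
     nm (u n - l) <= e.
  apply: ncomplete_cauchy => // e e0.
  have [|n0 n0P] := @hsmall (2 / c * nm w) (c * e / 2).
    by rewrite divr_gt0// mulr_gt0.
  exists (maxn n0 m0) => n m; rewrite !geq_max => /andP[n1 n2] /andP[m1 m2].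
  rewrite -(ler_pM2l c0) (le_trans (ud _ _ n2 m2))// mulrDl.
  by apply: le_trans (lerD (n0P _ n1) (n0P _ m1)) _; lra.
exists l; split.
  apply: Yclosed => e /lP[n0 n0P]; exists (u n0) => //.
  exact: n0P.
apply/eqP; rewrite -subr_eq0; apply/eqP/nm_small => e e0.
have [|n1 n1P] := lP (e / 4); first by lra.
have [|n2 n2P] := @hsmall (2 / c * nm w) (e / 2); first by lra.
pose n := maxn m0 (maxn n1 n2).
have n1n : (n1 <= n)%N by rewrite /n !leq_max leqnn orbT.
have n2n : (n2 <= n)%N by rewrite /n !leq_max leqnn !orbT.
have n0n : (m0 <= n)%N by rewrite /n !leq_max leqnn.
rewrite (_ : Q l - w = - (Q (u n - l) + h n *: u n)); last first.
  by rewrite QB (addrAC (Q (u n))) [RHS]opprB (FP n w : Q (u n) + h n *: u n = w).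
rewrite nmN (le_trans (nmD _ _))// nmZ nh.
have := Q2 (u n - l); have := n1P _ n1n; have := n2P _ n2n.
have : n.+1%:R^-1 * nm (u n) <= n.+1%:R^-1 * (2 / c * nm w).
  by rewrite ler_wpM2l// ub.
by move=> a1 a2 a3 a4; apply: (le_trans (lerD a4 (le_trans a1 a2))); lra.
Qed.

(** The inverse of Q on Y, extended by 0 to the eigenspace: the constant
    term of the Laurent expansion of the resolvent at l0. *)
Definition eig_inv x : X := projT1 (cid (exB x)).
Local Notation B := eig_inv.

Let YBx x : Y (B x).
Proof. by rewrite /eig_inv; case: cid => ? []. Qed.

Let QBx x : Q (B x) = x - P x.
Proof. by rewrite /eig_inv; case: cid => ? []. Qed.

Let Yinj u v : Y u -> Y v -> Q u = Q v -> u = v.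
Proof.
move=> Yu Yv uv; apply/eqP; rewrite -subr_eq0; apply/eqP/NY; last exact: YB.
by rewrite /N QB uv subrr.
Qed.

Let Blin a x y : B (a *: x + y) = a *: B x + B y.
Proof.
apply: Yinj => //; first exact: Ylin.
by rewrite Qlin !QBx Plin opprD addrACA -scalerBr.
Qed.

Let BB x y : B (x - y) = B x - B y.
Proof. by rewrite addrC -scaleN1r Blin scaleN1r addrC. Qed.

Let Blow : exists2 b : R, 0 < b & forall x, nm (B x) <= b * nm x.
Proof.
have [c c0 cP] := Ylow; exists (2 / c); first by rewrite divr_gt0.
move=> x; rewrite -(ler_pM2l c0) (le_trans (cP _ (YBx x)))// QBx.
rewrite (le_trans (nmB _ _))// (_ : c * (2 / c * nm x) = nm x + nm x).
  by rewrite lerD2l P1.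
by field; lra.
Qed.

(** Along N and Y, the equation (l0 + mu - T) x = w splits as P x = mu^-1 P
    w, and v + mu B v = B w for v = x - P x. *)
Let split_low (mu : R[i]) x :
  let w := Q x + mu *: x in let v := x - P x in
  mu *: P x = P w /\ v = B w - mu *: B v.
Proof.
move=> w v.
have Yv : Y v by exact: YP.
have wE : w = mu *: P x + (mu *: v + Q v).
  rewrite /v QB (NP x) subr0 addrA -scalerDr.
  by rewrite (_ : P x + (x - P x) = x) 1?[LHS]addrC ?subrK.
have Yw : Y (mu *: v + Q v) by apply: Ylin => //; exact: YQ.
have Pw : P w = mu *: P x.
  by rewrite wE Plin (PY Yw) addr0 PN.
split => //; apply: Yinj => //.
  by apply: YB => //; rewrite -[_ *: _]addr0; apply: Ylin => //; rewrite -Q0; exact: YQ.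
rewrite [Q (B w - _)]QB QZ !QBx (PY Yv) subr0 Pw wE.
by rewrite (addrC (mu *: P x)) addrK [RHS]addrC addKr.
Qed.

Let mu_low b (mu : R[i]) : (forall x, nm (B x) <= b * nm x) ->
  0 <= b -> normc mu * b < 1 -> forall x, (1 - normc mu * b) * nm (x - P x) <=
    b * nm (Q x + mu *: x).
Proof.
move=> bP b0 mub x; have [_ vE] := split_low mu x.
set v := x - P x in vE *; set w := Q x + _ in vE *.
have : nm v <= nm (B w) + nm (mu *: B v) by rewrite {1}vE nmB.
rewrite nmZ; have := bP w; have := ler_wpM2l (normc_ge0 mu) (bP v).
lra.
Qed.

Let mu_resolvent b (mu : R[i]) : (forall x, nm (B x) <= b * nm x) ->
  0 < b -> normc mu * b < 1 -> (0 < normc mu \/ (forall x, P x = 0)) ->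
  resolvent_set T (l0 + mu).
Proof.
move=> bP b0 mub P0.
have shE x : (l0 + mu) *: x - T x = Q x + mu *: x.
  by rewrite /eig_shift scalerDl addrAC.
have d0 : 0 < 1 - normc mu * b by lra.
have [a a0 aP] : exists2 a : R, 0 < a & forall x, nm (P x) <= a * nm (Q x + mu *: x).
  case: P0 => [mu0|P0]; last first.
    by exists 1 => // x; rewrite P0 nm0 mul1r nm_ge0.
  exists (normc mu)^-1; first by rewrite invr_gt0.
  move=> x; rewrite ler_pdivlMl// -nmZ; have [-> _] := split_low mu x.
  exact: P1.
pose K := a + b / (1 - normc mu * b).
have K0 : 0 < K by rewrite addr_gt0// divr_gt0.
apply: (@resolvent_setI _ _ _ _ K^-1); first by rewrite invr_gt0.
  move=> x; rewrite shE ler_pdivrMl// mulrDl.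
  rewrite -{1}(subrK (P x) x) addrC (le_trans (nmD _ _))// lerD//.
  by rewrite mulrAC ler_pdivlMr// mulrC mu_low// ltW.
move=> w; have [|||v vP] := @contraction_solve R X (fun v => - (mu *: B v))
    (normc mu * b) cX _ _ _ (B w).
- by rewrite mub mulr_ge0// ?normc_ge0 ?ltW.
- by move=> x y; rewrite BB scalerBr opprB opprK addrC.
- by move=> x; rewrite nmN nmZ -mulrA ler_wpM2l// normc_ge0.
have vE : v = B w - mu *: B v by rewrite -vP opprK addrK.
have Yv : Y v.
  rewrite vE; apply: YB => //; rewrite -[_ *: _]addr0; apply: Ylin => //.
  by rewrite -Q0; exact: YQ.
have Qv : Q v + mu *: v = w - P w.
  rewrite {1}vE QB QZ !QBx (PY Yv) subr0.
  by rewrite subrK.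
case: P0 => [mu0|P0]; last by exists v; rewrite shE Qv P0 subr0.
have mu0' : mu != 0 by apply: contraTneq mu0 => ->; rewrite normc0 ltxx.
exists (mu^-1 *: P w + v); rewrite shE Qlin (NP w) scaler0 add0r scalerDr.
by rewrite scalerA mulfV// scale1r addrCA Qv addrC subrK.
Qed.

(** Expanding v = B w - mu B v gives the regular part as a geometric series
    in - mu B; the singular part is mu^-1 P. *)
Let pole_laurent b (mu : R[i]) x : (forall x, nm (B x) <= b * nm x) -> 0 < b ->
  0 < normc mu -> normc mu * b < 1 -> forall m,
  nm (resolvent T (l0 + mu) x -
    (mu^-1 *: P x + \sum_(k < m) (- mu) ^+ k *: iter k.+1 B x)) <=
  (normc mu * b) ^+ m * (b / (1 - normc mu * b) * nm x).
Proof.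
move=> bP b0 mu0 mub m.
have mu0' : mu != 0 by apply: contraTneq mu0 => ->; rewrite normc0 ltxx.
have rs : resolvent_set T (l0 + mu) by apply: (mu_resolvent bP) => //; left.
set r := resolvent T _ x.
have rP : Q r + mu *: r = x.
  have [_ /(_ x)] := resolventK rs.
  by rewrite -/r /eig_shift scalerDl addrAC.
have [mP vE] := split_low mu r; move: mP vE; rewrite rP; set v := r - P r => mP vE.
have Prm : mu^-1 *: P x = P r by rewrite -mP scalerA mulVf// scale1r.
have vlow : nm v <= b / (1 - normc mu * b) * nm x.
  rewrite mulrAC ler_pdivlMr; last by lra.
  by rewrite mulrC (le_trans (mu_low bP _ mub _)) ?rP// ltW.
rewrite Prm opprD addrA -/v.
have Biter k a y z : iter k B (a *: y + z) = a *: iter k B y + iter k B z.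
  by elim: k => //= k ->; rewrite Blin.
suff -> : v - \sum_(k < m) (- mu) ^+ k *: iter k.+1 B x = (- mu) ^+ m *: iter m B v.
  rewrite nmZ; have -> : normc ((- mu) ^+ m) = normc mu ^+ m.
    elim: m => [|m ih]; first by rewrite !expr0 normc1.
    by rewrite !exprS normcM ih normcN.
  rewrite exprMn -[leRHS]mulrA ler_wpM2l ?exprn_ge0 ?normc_ge0//.
  apply: (@le_trans _ _ (b ^+ m * nm v)); last by rewrite ler_wpM2l// exprn_ge0// ltW.
  elim: m => [|m ih]; first by rewrite mul1r.
  rewrite exprS -mulrA /=; apply: le_trans (bP _) _.
  by rewrite ler_wpM2l// ltW.
elim: m => [|m ih]; first by rewrite big_ord0 subr0 expr0 scale1r.
rewrite big_ord_recr /= opprD addrA ih {1}vE addrC -[- (_ *: _)]addr0.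
have -> : B x - mu *: B v = (- mu) *: B v + B x by rewrite addrC scaleNr.
rewrite Biter scalerDr scalerA -exprSr -!iterSr /= addr0 addrC -addrA.
by rewrite subrr addr0.
Qed.

(** Q maps Y injectively to itself and the range of Q lies in Y, so Jordan
    chains at l0 have length one: the generalized eigenspace is the
    eigenspace, see gen_eig. *)
Let iterQ_N n y : Y y -> iter n Q y = 0 -> y = 0.
Proof.
elim: n y => [//|n ih] y Yy; rewrite iterSr => /(ih _ (YQ y)) Qy.
exact: NY.
Qed.

Let gen_eig x : generalized_eigenspace T l0 x -> N x.
Proof.
move=> [[|n]]; first by move=> /= ->; exact: Q0.
by rewrite iterSr => /(iterQ_N (YQ x)).
Qed.

(** A number with prescribed binary digits. In fin_dim the coordinates of a
    vector are obtained digit by digit. *)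
Lemma bits_sum (a : nat -> bool) : exists c : R, forall m,
  `|c - \sum_(k < m) (2^-1 : R) ^+ k *+ a k| <= 2 * 2^-1 ^+ m.
Proof.
pose s m := \sum_(k < m) (2^-1 : R) ^+ k *+ a k.
have s_mono m j : s m <= s (m + j)%N.
  elim: j => [|j ih]; first by rewrite addn0.
  rewrite addnS /s big_ord_recr /=; apply: (le_trans ih); rewrite lerDl.
  by rewrite mulrn_wge0// exprn_ge0// invr_ge0.
have s_tail m j : s (m + j)%N <= s m + 2 * 2^-1 ^+ m - 2 * 2^-1 ^+ (m + j).
  elim: j => [|j ih]; first by rewrite addn0; lra.
  rewrite addnS /s big_ord_recr /= exprS.
  have : (2^-1 : R) ^+ (m + j) *+ a (m + j)%N <= 2^-1 ^+ (m + j).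
    by case: (a _); rewrite ?mulr1n// mulr0n exprn_ge0// invr_ge0.
  by move: ih; rewrite /s; lra.
have ge0 m : 0 <= (2^-1 : R) ^+ m by rewrite exprn_ge0// invr_ge0.
have supS : has_sup (range s).
  split; first by exists (s 0%N); exists 0%N.
  exists 2 => _ [m _ <-]; have := s_tail 0%N m; rewrite add0n expr0 {2}/s big_ord0.
  have := ge0 m; lra.
exists (sup (range s)) => m; rewrite -/(s m) ger0_norm; last first.
  by rewrite subr_ge0; apply: ub_le_sup; [exact: (proj2 supS)|exists m].
rewrite lerBlDl; apply: ge_sup; first by exists (s 0%N); exists 0%N.
move=> _ [k _ <-]; have [mk|km] := leqP m k.
  by rewrite -(subnKC mk); have := s_tail m (k - m)%N; have := ge0 (m + (k - m))%N; lra.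
by have := s_mono k (m - k)%N; rewrite (subnKC (ltnW km)); have := ge0 m; lra.
Qed.

(** The unit ball K of N is covered by finitely many balls of radius 1/2
    centred at points e i of K. Replacing u by 2 (u - e i), with e i close
    to u, stays in K and can be repeated for ever: u is the sum of the 2^-k
    e (idx k), so it is a combination of the e i. *)
Let fin_dim : finite_dimensional N.
Proof.
pose K y := N y /\ nm y <= 1.
have [s sP] : exists s : seq X, forall y, K y ->
    exists2 x, x \in s & K x /\ nm (x - y) < 1 / 2.
  apply: contrapT => nos.
  have [s|phi phiP] := @greedy X (fun x y => (K x -> 1 / 2 <= nm (x - y)) /\ K y).
    apply: contrapT => noy; apply: nos; exists s => y Ky; apply: contrapT => nox.
    apply: noy; exists y => x xs; split=> // Kx; rewrite leNgt; apply/negP => xy.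
    by apply: nox; exists x.
  have Kp n : K (phi n.+1) by have [] := phiP 0%N n.+1 isT.
  have [|e e0|z zP] := @prec (fun n => phi n.+1) 1; first by move=> n; have [] := Kp n.
    exists 0%N => n _; have [+ _] := Kp n; rewrite /N /eig_shift => ->.
    by rewrite nm0 ltW.
  have [|n _ zn] := zP (1 / 4) _ 0%N; first by lra.
  have [|m nm zm] := zP (1 / 4) _ n.+1; first by lra.
  have [/(_ (Kp n)) + _] := phiP n.+1 m.+1 nm.
  have := nm_tri (phi n.+1) z (phi m.+1); rewrite (nmBC z); lra.
pose n := size s; pose e (i : 'I_n) := s`_i.
have /choice[idx idxP] : forall y, exists i : 'I_n, K y -> K (e i) /\ nm (e i - y) < 1 / 2.
  have [i0|noi] := pselect (exists i : 'I_n, True); last first.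
    have [x xs _] : exists2 x, x \in s & K x /\ nm (x - 0) < 1 / 2.
      by apply: sP; split; [exact: Q0|rewrite nm0].
    exfalso; apply: noi; have := xs; rewrite -index_mem => xi.
    by exists (Ordinal xi).
  have [i0' _] := i0.
  move=> y; have [Ky|nKy] := pselect (K y); last by exists i0'.
  have [x xs [Kx xy]] := sP _ Ky; have := xs; rewrite -index_mem => xi.
  by exists (Ordinal xi) => _; rewrite /e /= nth_index.
exists n, e => x Nx.
pose t := (nm x + 1); have t0 : 0 < t by have := nm_ge0 x; rewrite /t; lra.
pose u := fix u k := if k is k'.+1 then (2%:C : R[i]) *: (u k' - e (idx (u k'))) else t^-1%:C *: x.
have Ku k : K (u k).
  elim: k => [|k ih] /=.
    split; first by rewrite /N QZ Nx scaler0.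
    rewrite nmZr ger0_norm ?invr_ge0 ?(ltW t0)//.
    by rewrite ler_pdivrMl// mulr1 /t lerDl.
  have [[Ne _] le] := idxP _ ih; have [Nu _] := ih.
  split; first by rewrite /N QZ QB Nu Ne subrr scaler0.
  by rewrite nmZr ger0_norm// nmBC; lra.
have uS k : u k = e (idx (u k)) + (2^-1)%:C *: u k.+1.
  rewrite /= scalerA -rmorphM /= mulVf// scale1r addrC subrK//.
pose a i k := idx (u k) == i.
have uE m : u 0%N = \sum_(i < n) (\sum_(k < m) (2^-1 : R) ^+ k *+ a i k)%:C *: e i +
    ((2^-1 : R) ^+ m)%:C *: u m.
  elim: m => [|m ih].
    by rewrite expr0 scale1r big1 ?add0r// => i _; rewrite big_ord0 scale0r.
  rewrite ih {1}(uS m) scalerDr scalerA -rmorphM /= -exprSr addrA; congr (_ + _).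
  rewrite [RHS](eq_bigr (fun i : 'I_n => (\sum_(k < m) (2^-1 : R) ^+ k *+ a i k)%:C *: e i +
     ((2^-1 : R) ^+ m *+ a i m)%:C *: e i)); last first.
    by move=> i _; rewrite big_ord_recr /= rmorphD scalerDl.
  rewrite big_split /=; congr (_ + _).
  rewrite (bigD1 (idx (u m)))//= big1 ?addr0 /a ?eqxx// => i.
  by rewrite eq_sym => /negbTE ->; rewrite mulr0n scale0r.
have /choice[c cP] := fun i => bits_sum (a i).
have u0E : u 0%N = \sum_(i < n) (c i)%:C *: e i.
  apply/eqP; rewrite -subr_eq0; apply/eqP/nm_small => d d0.
  pose C := 1 + \sum_(i < n) 2 * nm (e i).
  have C0 : 0 <= C by rewrite addr_ge0// sumr_ge0// => i _; rewrite mulr_ge0// nm_ge0.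
  have [|m /(_ m (leqnn _)) mP] := @expr_small _ (2^-1) C d _ C0 d0.
    by apply/andP; split; lra.
  apply: le_trans mP; rewrite (uE m) addrAC -sumrB (le_trans (nmD _ _))//.
  rewrite mulrDr mulr1 addrC; apply: lerD.
    rewrite nmZr ger0_norm ?exprn_ge0 ?invr_ge0//.
    by rewrite ler_piMr ?exprn_ge0 ?invr_ge0//; have [] := Ku m.
  rewrite (le_trans (nm_sum _))// mulr_sumr; apply: ler_sum => i _.
  rewrite -scalerBl -rmorphB nmZr distrC mulrA ler_wpM2r ?nm_ge0//.
  by rewrite mulrC.
exists (fun i => (t%:C) * (c i)%:C).
under eq_bigr do rewrite -scalerA.
rewrite -scaler_sumr -u0E /= scalerA -rmorphM /= mulfV ?gt_eqF// scale1r//.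
Qed.

(** Whether l0 is in the resolvent set or a pole is decided by P = 0. *)
Lemma peripheral_dichotomy : exists2 e : R, 0 < e &
  (forall z : R[i], 0 < normc (z - l0) < e -> resolvent_set T z) /\
  (resolvent_set T l0 \/
   [/\ resolvent_pole T l0, is_eigenvalue T l0 &
       finite_algebraic_multiplicity T l0]).
Proof.
have [b b0 bP] := Blow.
have near (z : R[i]) : 0 < normc (z - l0) < b^-1 ->
    [/\ 0 < normc (z - l0), normc (z - l0) * b < 1 & resolvent_set T z].
  move=> /andP[z0 zb]; have mub : normc (z - l0) * b < 1 by rewrite -ltr_pdivlMr// div1r.
  split => //; rewrite -[z](subrK l0) addrC; apply: (mu_resolvent bP) => //.
  by left.
exists b^-1; first by rewrite invr_gt0.
split; first by move=> z /near[].
have [P0|/existsNP[x Px]] := pselect (forall x, P x = 0).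
  left; rewrite -[l0]addr0; apply: (mu_resolvent bP) => //.
    by rewrite normc0 mul0r.
  by right.
right; split; last 2 first.
- exists (P x) => //; apply/eqP; rewrite eq_sym -subr_eq0; apply/eqP.
  exact: NP.
- have [n [e eP]] := fin_dim; exists n, e => y /gen_eig; exact: eP.
have [Pl PlE] := linear_pack Plin.
have Biter k a y z : iter k B (a *: y + z) = a *: iter k B y + iter k B z.
  by elim: k => //= k ->; rewrite Blin.
have /choice[Bl BlE] : forall k, exists g : {linear X -> X}, forall x,
    g x = (- 1) ^+ k *: iter k.+1 B x.
  move=> k; apply: linear_pack => a y z; rewrite Biter scalerDr !scalerA.
  by rewrite mulrC.
pose A k := if k is k'.+1 then Bl k' else Pl.
exists 1%N, A, b^-1; split => //.
- case=> [|k] /=.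
    apply: (@le_lt_trans _ _ 1%:E); last by rewrite ltry.
    by apply: opnorm_le => // y; rewrite PlE mul1r.
  apply: (@le_lt_trans _ _ (b ^+ k.+1)%:E); last by rewrite ltry.
  apply: opnorm_le; last by rewrite exprn_ge0// ltW.
  move=> y; rewrite BlE nmZ (_ : normc _ = 1) ?mul1r.
    elim: k.+1 => [|j ih]; first by rewrite expr0 mul1r.
    by rewrite iterS exprS -mulrA (le_trans (bP _))// ler_wpM2l// ltW.
  elim: k => [|k ih]; first by rewrite expr0 normc1.
  by rewrite exprS normcM ih normcN normc1 mulr1.
- by exists x; rewrite /= PlE.
- by rewrite invr_gt0.
move=> z zb; have {}zb : 0 < normc (z - l0) < b^-1.
  by move/andP: zb => [z0 zb]; apply/andP; split; rewrite -ltcR; [exact: z0|exact: zb].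
have [mu0 mub rz] := near z zb.
split => //; move: mu0 mub; set mu := z - l0 => mu0 mub.
have mu0' : mu != 0 by apply: contraTneq mu0 => ->; rewrite normc0 ltxx.
pose c := b / (1 - normc mu * b).
have c0 : 0 <= c by rewrite divr_ge0 ?(ltW b0)// subr_ge0 ltW.
pose tail m (x : X) : X :=
  resolvent T z x - \sum_(k < m.+1) mu ^ (k%:Z - 1%N%:Z) *: A k x.
have bd m : (opnorm (tail m) <= ((normc mu * b) ^+ m * c)%:E)%E.
  apply: opnorm_le; last by rewrite mulr_ge0// exprn_ge0// mulr_ge0 ?normc_ge0 ?ltW.
  move=> y; have := pole_laurent y bP b0 mu0 mub m.
  rewrite -/mu (_ : l0 + mu = z); last by rewrite addrC subrK.
  rewrite mulrA; congr (nm (_ - _) <= _).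
  rewrite big_ord_recl; congr (_ + _).
    by rewrite PlE sub0r.
  apply: eq_bigr => i _; rewrite /= BlE scalerA.
  rewrite (_ : (lift ord0 i)%:Z - 1 = i%:Z); last by rewrite /= /bump /= PoszD addrAC subrr add0r.
  by rewrite -exprnP -[- mu]mulN1r exprMn mulrC.
suff tail0 : (fun m => opnorm (tail m)) @ \oo --> (0 : \bar R).
  by rewrite -cvg_shiftS; exact: tail0.
apply: (@squeeze_cvge _ _ _ _ (cst 0%E) _ (fun m => ((normc mu * b) ^+ m * c)%:E)).
- near=> m; apply/andP; split; last exact: bd.
  apply: le_trans (ereal_sup_ubound _); last first.
    by exists 0 => //=; rewrite normr0.
  by rewrite lee_fin nm_ge0.
- exact: cvg_cst.
- rewrite -[X in _ --> X]/(0%R%:E) -(mul0r c); apply: cvg_EFin; first by near=> m.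
  apply: cvgMr_tmp; apply: cvg_expr; rewrite ger0_norm ?mulr_ge0 ?normc_ge0 ?ltW//.
Unshelve. all: by end_near. Qed.

End peripheral.

(** * The essential spectral radius of a contraction *)

Section gap.
Context {R : realType} {X : normedModType R[i]}.

(** If spectral points accumulated at the unit circle from inside, they
    would accumulate at some unimodular l0 (compactness of the circle, by an
    ultrafilter); but a punctured disc around l0 is in the resolvent set. *)
Theorem ess_spectral_radius_lt1 (T : {linear X -> X}) : ncomplete X ->
  (forall x, nm (T x) <= nm x) ->
  (forall l0 : R[i], normc l0 = 1 -> almost_eigen_clusters T l0) ->
  (ess_spectral_radius T < 1)%E.
Proof.
move=> cX T1 prec.
have [n nP] : exists n, forall z : R[i], 1 - n.+1%:R^-1 < normc z < 1 ->
    resolvent_set T z.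
  apply: contrapT => /forallNP noN.
  have /choice[z zP] : forall n, exists z : R[i],
      1 - n.+1%:R^-1 < normc z < 1 /\ ~ resolvent_set T z.
    move=> n; apply: contrapT => noz; apply: (noN n) => z zn.
    by apply: contrapT => rz; apply: noz; exists z.
  have [U [UU ooU]] := nat_ultra.
  have zb k : normc (z k) <= 1 by have [/andP[_ /ltW]] := zP k.
  have [a aP] := ultra_lim UU (fun k => le_trans (Re_le_normc _) (zb k)).
  have [b bP] := ultra_lim UU (fun k => le_trans (Im_le_normc _) (zb k)).
  pose l0 : R[i] := Complex a b.
  have zl (e : R) : 0 < e -> U [set k | normc (z k - l0) < e].
    move=> e0; have e2 : 0 < e / 2 by lra.
    apply: filterS2 (aP _ e2) (bP _ e2) => k /= h1 h2.
    rewrite (le_lt_trans (normc_le_ReIm _))//; move: h1 h2.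
    by case: (z k) => x y /=; lra.
  move: l0 zl => l0 zl; have nl0 : normc l0 = 1.
    apply/eqP; rewrite eq_le; apply/andP; split; apply/ler_addgt0Pr => e e0.
      have [k /= kP] := filter_ex (zl _ e0).
      have := normcB_ge l0 (z k); rewrite normcBC.
      by have := zb k; lra.
    have e2 : 0 < e / 2 by lra.
    have [m mP] : exists m, m.+1%:R^-1 < e / 2.
      exists (Num.bound (e / 2)^-1); rewrite invf_plt ?posrE//.
      have e20 : 0 <= (e / 2)^-1 by rewrite invr_ge0; lra.
      by rewrite (lt_trans (archi_boundP e20))// ltr_nat.
    have Um : U [set k | (m <= k)%N] by apply: ooU; exists m.
    have [k /= [kP mk]] := filter_ex (filterI (zl _ e2) Um).
    have := normcB_ge (z k) l0; have [/andP[zk _] _] := zP k.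
    have : k.+1%:R^-1 <= m.+1%:R^-1 :> R by rewrite lef_pV2 ?posrE// ler_nat.
    move=> km; move: zk (le_lt_trans km mP); move: (k.+1%:R^-1 : R) => t; lra.
  have [e e0 [eP _]] := peripheral_dichotomy cX T1 nl0 (prec _ nl0).
  have [k /= kP] := filter_ex (zl _ e0).
  have [/andP[_ zk] nrz] := zP k; apply: nrz; apply: eP; rewrite kP andbT.
  have := normcB_ge l0 (z k); rewrite normcBC nl0; lra.
apply: (@le_lt_trans _ _ (1 - n.+1%:R^-1)%:E); last first.
  by rewrite lte_fin ltrBlDr ltrDl invr_gt0.
apply: ereal_inf_lbound; exists (1 - n.+1%:R^-1) => //; split.
  by rewrite subr_ge0 invf_le1// ler1n.
move=> l nl; have {}nl : 1 - n.+1%:R^-1 < normc l by rewrite -ltcR; exact: nl.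
have [l1|l1|l1] := ltgtP (normc l) 1.
- by left; apply: nP; rewrite nl.
- by left; exact: resolvent_out.
- have [e _ [_ H]] := peripheral_dichotomy cX T1 l1 (prec _ l1).
  exact: H.
Qed.

End gap.

(** * The closed graph theorem *)

Section closed_graph.
Context {R : realType} {X Y : normedModType R[i]}.
Local Notation hf n := ((2^-1 : R) ^+ n).
Hypotheses (cX : ncomplete X) (cY : ncomplete Y).
Variable S : {linear X -> Y}.
Hypothesis S_closed : forall (x : nat -> X) l y,
  (forall e : R, 0 < e -> exists N, forall n, (N <= n)%N -> nm (x n - l) <= e) ->
  (forall e : R, 0 < e -> exists N, forall n, (N <= n)%N -> nm (S (x n) - y) <= e) ->
  S l = y.

(** The Baire argument, done by nested balls: if no closure of a set {|S z|
    <= k} contained a ball, each ball would contain a smaller one on which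
    |S| > k, and S would be infinite at the common point. *)
Let baire_ball : exists (k : R) (x0 : X) (r : R), [/\ 0 <= k, 0 < r &
  forall x, nm (x - x0) <= r -> forall e : R, 0 < e ->
    exists z, nm (z - x) <= e /\ nm (S z) <= k].
Proof.
apply: contrapT => nob.
have step (k : nat) (b : X * R) : exists b' : X * R, 0 < b.2 ->
    [/\ 0 < b'.2, b'.2 <= b.2 / 2, nm (b'.1 - b.1) <= b.2 / 2 &
      forall z, nm (z - b'.1) <= b'.2 -> k%:R < nm (S z)].
  have [b0|b0] := ltP 0 b.2; last first.
    by exists b.
  apply: contrapT => nox; apply: nob; exists k%:R, b.1, (b.2 / 2).
  split => //; first by lra.
  move=> x xb e e0; apply: contrapT => noz; apply: nox.
  exists (x, Num.min e (b.2 / 2)) => _ /=; split => //.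
  - by rewrite lt_min e0/=; lra.
  - by rewrite ge_min lexx orbT.
  - move=> z; rewrite le_min => /andP[ze _]; rewrite ltNge; apply/negP => zk.
    by apply: noz; exists z.
have /choice[f fP] : forall kb : nat * (X * R), exists b' : X * R, 0 < kb.2.2 ->
    [/\ 0 < b'.2, b'.2 <= kb.2.2 / 2, nm (b'.1 - kb.2.1) <= kb.2.2 / 2 &
      forall z, nm (z - b'.1) <= b'.2 -> kb.1%:R < nm (S z)].
  by move=> [k b]; exact: step.
pose b := fix b k := if k is k'.+1 then f (k', b k') else (0 : X, 1 : R).
have b0 k : 0 < (b k).2.
  by elim: k => [|k ih] /=; [exact: ltr01|have [] := fP (k, b k) ih].
have bh k : (b k).2 <= hf k.
  elim: k => [|k ih] /=; first by rewrite expr0.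
  by have [_ + _ _] := fP (k, b k) (b0 k); rewrite exprS /= => h; lra.
have bn k : nm ((b k.+1).1 - (b k).1) <= (b k).2 / 2.
  by have [_ _ + _] := fP (k, b k) (b0 k).
have [l lP] : exists l, forall n, nm ((b n).1 - l) <= 2 * hf n.
  suff H k : nm ((b k.+1).1 - (b k).1) <= hf k.
    by have [l lP] := cX H; exists l.
  by rewrite (le_trans (bn k))//; have := bh k; have := b0 k; lra.
have bj k j : nm ((b (k + j)%N).1 - (b k).1) <= (b k).2 - (b (k + j)%N).2.
  elim: j => [|j ih]; first by rewrite addn0 !subrr nm0.
  rewrite addnS (le_trans (nm_tri _ (b (k + j)%N).1 _))//.
  have := bn (k + j)%N; have [_ + _ _] := fP ((k + j)%N, b (k + j)%N) (b0 (k + j)%N).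
  by rewrite /=; move: ih; lra.
have lb k : nm (l - (b k).1) <= (b k).2.
  apply/ler_addgt0Pr => e e0; have [|m me] := @hf_small R (e / 2); first by lra.
  rewrite (le_trans (nm_tri _ (b (k + m)%N).1 _))// addrC lerD//.
    by rewrite (le_trans (bj _ _))// gerBl ltW.
  rewrite nmBC (le_trans (lP _))// exprD.
  have : hf k * hf m <= hf m.
    by rewrite ler_piMl ?exprn_ge0 ?invr_ge0// exprn_ile1// ?invr_ge0 ?invf_le1// ler1n.
  lra.
have Sl k : k%:R < nm (S l).
  by have [_ _ _] := fP (k, b k) (b0 k); apply; exact: (lb k.+1).
have := Sl (Num.bound (nm (S l))).
by rewrite ltNge (ltW (archi_boundP (nm_ge0 _))).
Qed.

(** Differences of points of the ball of baire_ball fill a ball around 0;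
    then scale. *)
Let approx : exists2 C : R, 0 <= C & forall x (e : R), 0 < e ->
    exists z, nm (z - x) <= e /\ nm (S z) <= C * nm x.
Proof.
have [k [x0 [r [k0 r0 kP]]]] := baire_ball.
have sym x : nm x <= r -> forall e : R, 0 < e ->
    exists z, nm (z - x) <= e /\ nm (S z) <= 2 * k.
  move=> xr e e0; have e2 : 0 < e / 2 by lra.
  have [|z1 [z1x z1k]] := kP (x + x0) _ _ e2; first by rewrite addrK.
  have [|z2 [z2x z2k]] := kP x0 _ _ e2; first by rewrite subrr nm0 ltW.
  exists (z1 - z2); split; last by rewrite linearB (le_trans (nmB _ _))//; lra.
  rewrite (_ : z1 - z2 - x = (z1 - (x + x0)) - (z2 - x0)).
    by rewrite (le_trans (nmB _ _))//; lra.
  by rewrite opprB opprD !addrA subrK addrAC.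
exists (2 * k / r); first by rewrite divr_ge0 ?mulr_ge0 ?(ltW r0).
move=> x e e0; have [->|/eqP x0'] := eqVneq x 0.
  by exists 0; rewrite subrr linear0 !nm0 mulr0 ltW.
have nx := nm_gt0 x0'.
pose t := r / nm x; have t0 : 0 < t by rewrite divr_gt0.
have [|z [zx zk]] := sym (t%:C *: x) _ (t * e) (mulr_gt0 t0 e0).
  by rewrite nmZr gtr0_norm// divfK// gt_eqF.
exists (t^-1%:C *: z); split.
  rewrite (_ : _ - x = t^-1%:C *: (z - t%:C *: x)).
    by rewrite nmZr gtr0_norm ?invr_gt0// ler_pdivrMl.
  by rewrite scalerBr scalerA -rmorphM /= mulVf ?gt_eqF// scale1r.
rewrite linearZ nmZr gtr0_norm ?invr_gt0// ler_pdivrMl//.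
rewrite (_ : t * _ = 2 * k)// /t; field.
by rewrite !gt_eqF.
Qed.

(** x is the sum of successive approximations z_n with |z_n| and |S z_n|
    geometrically small; closedness turns the sum of the S z_n into S x. *)
Theorem closed_graph : exists2 C : R, 0 <= C & forall x, nm (S x) <= C * nm x.
Proof.
have [C C0 CP] := approx.
have unit x : nm x <= 1 -> nm (S x) <= 2 * C.
  move=> x1.
  have /choice[f fP] : forall nx : nat * X, exists z, nm (z - nx.2) <= hf nx.1.+1
      /\ nm (S z) <= C * nm nx.2.
    by move=> [n y]; apply: CP; exact: hf_gt0.
  pose y := fix y n := if n is n'.+1 then y n' - f (n', y n') else x.
  have yh n : nm (y n) <= hf n.
    case: n => [|n] /=; first by rewrite expr0.
    by rewrite nmBC; have [] := fP (n, y n).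
  pose s n := x - y n.
  have sS n : s n.+1 - s n = f (n, y n).
    by rewrite /s /= !opprB !addrA subrK addrAC subrr add0r.
  have Ss n : nm (S (s n.+1) - S (s n)) <= C * hf n.
    rewrite -linearB sS; have [_ le] := fP (n, y n); apply: (le_trans le).
    by rewrite /= ler_wpM2l// yh.
  have Sd n m : nm (S (s (n + m)%N) - S (s n)) <= C * (2 * hf n - 2 * hf (n + m)).
    elim: m => [|m ih]; first by rewrite addn0 !subrr nm0 mulr0.
    rewrite addnS (le_trans (nm_tri _ (S (s (n + m)%N)) _))//.
    have := Ss (n + m)%N; rewrite !exprS; move: ih; lra.
  have hn0 n : 0 <= hf n by rewrite ltW// hf_gt0.
  have Sd' n m : (n <= m)%N -> nm (S (s m) - S (s n)) <= C * 2 * hf n.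
    move=> nm'; rewrite -(subnKC nm') (le_trans (Sd _ _))// -mulrA ler_wpM2l//.
    by have := hn0 (n + (m - n))%N; lra.
  have [l lP] : exists l, forall e : R, 0 < e -> exists N, forall n, (N <= n)%N ->
      nm (S (s n) - l) <= e.
    apply: ncomplete_cauchy => // e e0.
    have C4 : 0 <= C * 4 by rewrite mulr_ge0.
    have [|N NP] := @expr_small R 2^-1 (C * 4) e _ C4 e0; first by apply/andP; split; lra.
    exists N => n m Nn Nm; rewrite (le_trans (nm_tri _ (S (s N)) _))//.
    rewrite (nmBC (S (s N))); have := Sd' _ _ Nn; have := Sd' _ _ Nm.
    by have := NP N (leqnn _); lra.
  have -> : S x = l.
    apply: S_closed lP => e e0.
    have [|//|N NP] := @expr_small R 2^-1 1 e _ _ e0; first by apply/andP; split; lra.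
    exists N => n /NP; rewrite mulr1 /s addrC addKr nmN.
    exact: le_trans.
  apply/ler_addgt0Pr => e /lP[N /(_ N (leqnn _)) NP].
  rewrite -(subrK (S (s N)) l) (le_trans (nmD _ _))// nmBC addrC lerD//.
  have := Sd' 0%N N (leq0n _); rewrite /s /= subrr linear0 subr0 expr0; lra.
exists (2 * C); first by rewrite mulr_ge0.
move=> x; have [->|/eqP x0'] := eqVneq x 0; first by rewrite linear0 !nm0 mulr0.
have nx := nm_gt0 x0'.
have := unit ((nm x)^-1%:C *: x).
rewrite linearZ !nmZr gtr0_norm ?invr_gt0// mulVf ?gt_eqF// ler_pdivrMl// => /(_ (lexx _)).
by rewrite mulrC.
Qed.

End closed_graph.

(** * Classes of p-integrable functions *)

Section Lp.
Context d (Om : measurableType d) (R : realType).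
Variables (mu : {measure set Om -> \bar R}) (p : R) (p1 : 1 <= p).
Local Notation X := (cLspace mu p1).
Local Notation F := (cLfunType mu p1).
Implicit Types (f g : F) (u v : X).

Let p0 : 0 < p. Proof. exact: lt_le_trans ltr01 p1. Qed.

Definition pint (f : Om -> R[i]) : \bar R := (\int[mu]_x (normc (f x) `^ p)%:E)%E.

Lemma measurable_normcp (f : Om -> R[i]) (s : R) : cmeasurable f ->
  measurable_fun setT (fun x => normc (f x) `^ s).
Proof.
move=> mf; apply: (@measurableT_comp _ _ _ _ _ _ (@powR R ^~ s)) => //.
exact: measurable_normc.
Qed.

Lemma pint_cLnorm (f : Om -> R[i]) : pint f = (cLnorm mu p f `^ p)%E.
Proof.
rewrite cLnorm_integralE -poweRrM mulVf ?gt_eqF// poweRe1//.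
by apply: integral_ge0 => x _; rewrite lee_fin powR_ge0.
Qed.

Lemma nm_pi f : ((nm (\pi_X f : X)) `^ p)%:E = pint f.
Proof.
rewrite /nm normr_pi_cLspace /= pint_cLnorm -poweR_EFin fineK//.
exact: cLfun_cLnorm_fin_num.
Qed.

Lemma nm_repr u : ((nm u) `^ p)%:E = pint (repr u).
Proof. by rewrite -nm_pi reprK. Qed.

Lemma cLfunI (f : Om -> R[i]) : cmeasurable f -> (pint f < +oo)%E -> f \in cLfun mu p.
Proof.
move=> mf f_fin; apply/asboolP; split => //.
by rewrite cLnorm_integralE; apply: poweR_lty.
Qed.

Lemma cLfun_meas (f : Om -> R[i]) : f \in cLfun mu p -> cmeasurable f.
Proof. by move=> /asboolP[]. Qed.

Lemma cLfun_fin (f : Om -> R[i]) : f \in cLfun mu p -> (pint f < +oo)%E.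
Proof. by move=> /asboolP[_ h]; rewrite pint_cLnorm poweR_lty. Qed.

(** The class of f, with value 0 when f is not p-integrable. This total map
    keeps integrability proofs out of the terms. *)
Definition cls (f : Om -> R[i]) : X := \pi_X (insubd (0 : F) f).

Lemma cLfun_absE f x : (cLfun_abs f : Om -> R[i]) x = (normc (f x))%:C.
Proof. by []. Qed.

Lemma cmeasurableD (f g : Om -> R[i]) : cmeasurable f -> cmeasurable g ->
  cmeasurable (fun x => f x + g x).
Proof.
move=> mf mg; rewrite (_ : (fun _ => _) = 1 *: f + g); first exact: cmeasurableZD.
by apply/funext => x; rewrite scale1r.
Qed.

Lemma cmeasurableB (f g : Om -> R[i]) : cmeasurable f -> cmeasurable g ->
  cmeasurable (fun x => f x - g x).
Proof.
move=> mf mg; rewrite (_ : (fun _ => _) = (-1) *: g + f); first exact: cmeasurableZD.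
by apply/funext => x; rewrite scaleN1r addrC.
Qed.

Lemma pi_cLspace0 : \pi_X (0 : F) = 0 :> X.
Proof. by apply: (addrI (\pi_X 0)); rewrite addr0 -pi_cLspaceD addr0. Qed.

Lemma cls_val f : cls f = \pi_X f.
Proof. by rewrite /cls; congr (\pi_X _); apply: val_inj; rewrite val_insubd cLfunP. Qed.

Lemma cls0 : cls (fun=> 0) = 0.
Proof. by rewrite -pi_cLspace0 -cls_val. Qed.

Lemma cLfun0 : (fun=> 0) \in cLfun mu p.
Proof. exact: cLfunP (0 : F). Qed.

Lemma cls_repr u : cls (repr u) = u.
Proof. by rewrite cls_val reprK. Qed.

Lemma cls_pi (f : Om -> R[i]) : f \in cLfun mu p -> exists2 g : F, g = f :> (Om -> R[i]) & cls f = \pi_X g.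
Proof. by move=> fp; exists (CLfun p1 fp) => //; rewrite -cls_val. Qed.

Lemma nm_cls (f : Om -> R[i]) : f \in cLfun mu p -> ((nm (cls f)) `^ p)%:E = pint f.
Proof. by move=> /cls_pi[g <- ->]; rewrite nm_pi. Qed.

Lemma clsD (f g : Om -> R[i]) : f \in cLfun mu p -> g \in cLfun mu p ->
  cls (fun x => f x + g x) = cls f + cls g.
Proof.
by move=> /cls_pi[f' <- ->] /cls_pi[g' <- ->]; rewrite -pi_cLspaceD -cls_val.
Qed.

Lemma clsZ a (f : Om -> R[i]) : f \in cLfun mu p ->
  cls (fun x => a * f x) = a *: cls f.
Proof. by move=> /cls_pi[f' <- ->]; rewrite -[RHS]pi_cLspaceZ -cls_val. Qed.

Lemma clsB (f g : Om -> R[i]) : f \in cLfun mu p -> g \in cLfun mu p ->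
  cls (fun x => f x - g x) = cls f - cls g.
Proof.
move=> /cls_pi[f' <- ->] /cls_pi[g' <- ->].
by rewrite -scaleN1r -[_ *: _]pi_cLspaceZ -pi_cLspaceD -cls_val; congr cls;
  apply/funext => x; rewrite -[in LHS]mulN1r.
Qed.

Lemma cls_ae (f g : Om -> R[i]) : f \in cLfun mu p -> g \in cLfun mu p ->
  cls f = cls g <-> f = g %[ae mu].
Proof.
move=> /cls_pi[f' <- ->] /cls_pi[g' <- ->].
by split => [/eqP/cLspace_eqP//|h]; apply/eqP/cLspace_eqP.
Qed.

Lemma repr_cls (f : Om -> R[i]) : f \in cLfun mu p -> (repr (cls f) : Om -> R[i]) = f %[ae mu].
Proof. by move=> fp; apply/cls_ae => //; [exact: cLfunP|rewrite cls_repr]. Qed.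

Lemma reprD_ae u v : (repr (u + v) : Om -> _) = (fun x => repr u x + repr v x) %[ae mu].
Proof.
apply/cls_ae; [exact: cLfunP|exact: (cLfunP (repr u + repr v))|].
by rewrite clsD ?cls_repr//; exact: cLfunP.
Qed.

Lemma nm_le (f g : Om -> R[i]) : f \in cLfun mu p -> g \in cLfun mu p ->
  {ae mu, forall x, normc (f x) <= normc (g x)} -> nm (cls f) <= nm (cls g).
Proof.
move=> fp gp fg; rewrite -(@ler_pXn2r _ 1%N) ?nnegrE ?nm_ge0// !expr1.
rewrite leNgt; apply/negP => /(gt0_ltr_powR p0) h.
have := h; rewrite !nnegrE !nm_ge0 => /(_ isT isT).
apply/negP; rewrite -leNgt -lee_fin !nm_cls//; apply: ae_ge0_le_integral => //.
- by move=> x _; rewrite lee_fin powR_ge0.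
- by apply/measurable_EFinP/measurable_normcp/cLfun_meas.
- by move=> x _; rewrite lee_fin powR_ge0.
- by apply/measurable_EFinP/measurable_normcp/cLfun_meas.
- apply: filterS fg => x fgx _; rewrite lee_fin.
  by apply: ge0_ler_powR; rewrite ?nnegrE ?normc_ge0// ltW.
Qed.

(** Riesz-Fischer: the increments f_(n+1) - f_n are summable in norm, so by
    monotone convergence they are absolutely summable off a null set, where
    the f_n converge. The limit G of the p-th powers of the partial sums s
    dominates that of the distance to the limit. *)
Section riesz_fischer.
Variable u : nat -> X.
Hypothesis u_cauchy : forall n, nm (u n.+1 - u n) <= (2^-1 : R) ^+ n.
Local Notation hf n := ((2^-1 : R) ^+ n).

Let f n : F := repr (u n).
Let S n m : F := \sum_(n <= k < n + m) cLfun_abs (f k.+1 - f k).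

Let SE n m x : (S n m : Om -> R[i]) x = (\sum_(n <= k < n + m) normc (f k.+1 x - f k x))%:C.
Proof.
rewrite /S; elim: m => [|m ih]; first by rewrite addn0 !big_geq.
by rewrite addnS !big_nat_recr ?leq_addr//= rmorphD /= -ih.
Qed.

Let s n m x : R := \sum_(n <= k < n + m) normc (f k.+1 x - f k x).

Let s_ge0 n m x : 0 <= s n m x.
Proof. by apply: sumr_ge0 => k _; exact: normc_ge0. Qed.

Let s_mono n x : {homo (fun m => s n m x) : m m' / (m <= m')%N >-> m <= m'}.
Proof.
apply: homo_leq => [//|? ? ?|m]; first exact: le_trans.
by rewrite /s addnS big_nat_recr ?leq_addr//= lerDl normc_ge0.
Qed.

Let s_bound n m : (\int[mu]_x (s n m x `^ p)%:E <= ((2 * hf n) `^ p)%:E)%E.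
Proof.
have -> : (\int[mu]_x (s n m x `^ p)%:E = pint (S n m))%E.
  by apply: eq_integral => x _; rewrite SE normc_real ger0_norm// s_ge0.
have h0 k : 0 <= hf k by rewrite exprn_ge0// invr_ge0.
rewrite -nm_pi lee_fin; apply: ge0_ler_powR; rewrite ?nnegrE ?nm_ge0 ?(ltW p0)//.
suff : nm (\pi_X (S n m) : X) <= 2 * hf n - 2 * hf (n + m).
  move=> /le_trans; apply; rewrite gerBl mulr_ge0// exprn_ge0// invr_ge0//.
have abs_le k : nm (\pi_X (cLfun_abs (f k.+1 - f k)) : X) <= hf k.
  apply: le_trans (u_cauchy k).
  have -> : u k.+1 - u k = \pi_X (f k.+1 - f k).
    rewrite -(cls_val (f k.+1 - f k)) -{1}(cls_repr (u k.+1)) -{1}(cls_repr (u k)).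
    by rewrite -clsB; [|exact: cLfunP|exact: cLfunP].
  rewrite -!cls_val; apply: nm_le; [exact: cLfunP|exact: cLfunP|].
  apply: aeW => x; set g := (f k.+1 - f k : F).
  by rewrite cLfun_absE normc_real ger0_norm// normc_ge0.
rewrite /S; elim: m => [|m ih].
  by rewrite addn0 big_geq// subrr pi_cLspace0 nm0.
rewrite addnS big_nat_recr ?leq_addr//= pi_cLspaceD (le_trans (nmD _ _))//.
by have := abs_le (n + m)%N; rewrite exprS; move: ih; lra.
Qed.

Let h n m x : \bar R := (s n m x `^ p)%:E.

Let h_ge0 n m x : (0 <= h n m x)%E.
Proof. by rewrite lee_fin powR_ge0. Qed.

Let h_nd n x : nondecreasing_seq (h n ^~ x).
Proof.
move=> a b ab; rewrite lee_fin.
by apply: ge0_ler_powR; rewrite ?nnegrE ?s_ge0 ?(ltW p0)//; exact: s_mono.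
Qed.

Let h_meas n m : measurable_fun setT (h n m).
Proof.
apply/measurable_EFinP.
rewrite (_ : (fun _ => _) = (fun x => normc ((S n m : Om -> R[i]) x) `^ p)).
  exact/measurable_normcp/cLfun_cmeasurable.
by apply/funext => x; rewrite SE normc_real ger0_norm// s_ge0.
Qed.

Let G n x : \bar R := limn (h n ^~ x).

Let G_meas n : measurable_fun setT (G n).
Proof.
apply: (@emeasurable_fun_cvg _ _ _ setT (h n)) => // x _.
exact: ereal_nondecreasing_is_cvgn (h_nd n x).
Qed.

Let G_ge0 n x : (0 <= G n x)%E.
Proof.
apply: lime_ge; first exact: ereal_nondecreasing_is_cvgn (h_nd n x).
exact: nearW.
Qed.

Let h_le_G n m x : (h n m x <= G n x)%E.
Proof.
apply: lime_ge; first exact: ereal_nondecreasing_is_cvgn (h_nd n x).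
by exists m => // k /= mk; exact: h_nd.
Qed.

Let G_bound n : (\int[mu]_x G n x <= ((2 * hf n) `^ p)%:E)%E.
Proof.
rewrite /G (monotone_convergence mu measurableT (h_meas n)) //.
apply: lime_le.
  apply: ereal_nondecreasing_is_cvgn => a b ab; apply: ge0_le_integral => //.
  by move=> x _; exact: h_nd.
by apply: nearW => m; exact: s_bound.
Qed.

Let G_ae : {ae mu, forall x, (G 0%N x < +oo)%E}.
Proof.
have : mu.-integrable setT (G 0%N).
  apply/integrableP; split; first exact: G_meas.
  under eq_integral do rewrite gee0_abs//.
  by rewrite (le_lt_trans (G_bound _))// ltry.
move=> /(integrable_ae measurableT); apply: filterS => x /(_ I).
by rewrite ge0_fin_numE.
Qed.

Let A := [set x | (G 0%N x < +oo)%E].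

Let mA : measurable A.
Proof.
rewrite (_ : A = ~` (G 0%N @^-1` [set +oo%E])).
  apply: measurableC; rewrite -[X in measurable X]setTI.
  by apply: G_meas => //; exact: emeasurable_set1.
by apply/seteqP; split => x; rewrite /A /setC /preimage /mkset ltey => /eqP.
Qed.

Let f_close n k x : normc (f (n + k)%N x - f n x) <= s n k x.
Proof.
elim: k => [|k ih]; first by rewrite addn0 subrr normc0 s_ge0.
rewrite /s addnS big_nat_recr ?leq_addr//= -/(s n k x).
rewrite -(subrKA (f (n + k)%N x)) (le_trans (normcD _ _))//.
by rewrite addrC lerD.
Qed.

Let part_cvg (a : nat -> R) x : A x ->
  (forall n k, `|a (n + k)%N - a n| <= s n k x) -> cvgn a.
Proof.
move=> Ax ak; have [B sB] : exists B, forall m, s 0%N m x <= B.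
  exists (fine (G 0%N x) `^ p^-1) => m.
  have : (h 0%N m x <= (fine (G 0%N x))%:E)%E by rewrite fineK ?ge0_fin_numE.
  rewrite lee_fin => le; rewrite -[leLHS]powRr1// -(mulfV (lt0r_neq0 p0)) powRrM.
  by apply: ge0_ler_powR; rewrite ?nnegrE ?powR_ge0 ?invr_ge0 ?(ltW p0)// fine_ge0.
have s_cvg : cvgn (fun m => s 0%N m x).
  apply: nondecreasing_is_cvgn; first exact: s_mono.
  by exists B => _ [m _ <-].
have as_cvg : cvgn (fun m => a m + s 0%N m x).
  apply: nondecreasing_is_cvgn.
    apply: homo_leq => [//|? ? ?|m]; first exact: le_trans.
    have := ak m 1%N; rewrite addn1 /s addn1 big_nat1 !add0n big_nat_recr//= ler_norml.
    move=> /andP[+ _]; lra.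
  exists (`|a 0%N| + B + B) => _ [m _ <-]; rewrite lerD//.
  have := ak 0%N m; rewrite add0n => am.
  rewrite -(subrK (a 0%N) (a m)) addrC lerD ?ler_norm//.
  by rewrite (le_trans (ler_norm _))// (le_trans am).
rewrite (_ : a = (fun m => a m + s 0%N m x) - (fun m => s 0%N m x)).
  exact: is_cvgB.
by apply/funext => m; rewrite /= fctE addrK.
Qed.

Let ReF (x : Om) : R := limn (fun m => complex.Re (f m x) * \1_A x).
Let ImF (x : Om) : R := limn (fun m => complex.Im (f m x) * \1_A x).

Let Re_cvg x : (fun m => complex.Re (f m x) * \1_A x) @ \oo --> ReF x.
Proof.
rewrite /ReF indicE; case: (boolP (x \in A)) => [/set_mem xA|_].
  under eq_fun do rewrite mulr1.
  apply: (part_cvg xA) => n k; apply: le_trans (f_close n k x).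
  by rewrite (le_trans _ (Re_le_normc _))//; case: (f _ x) => ? ?; case: (f _ x).
by under eq_fun do rewrite mulr0; exact: is_cvg_cst.
Qed.

Let Im_cvg x : (fun m => complex.Im (f m x) * \1_A x) @ \oo --> ImF x.
Proof.
rewrite /ImF indicE; case: (boolP (x \in A)) => [/set_mem xA|_].
  under eq_fun do rewrite mulr1.
  apply: (part_cvg xA) => n k; apply: le_trans (f_close n k x).
  by rewrite (le_trans _ (Im_le_normc _))//; case: (f _ x) => ? ?; case: (f _ x).
by under eq_fun do rewrite mulr0; exact: is_cvg_cst.
Qed.

Let Fl (x : Om) : R[i] := Complex (ReF x) (ImF x).

Let Fl_meas : cmeasurable Fl.
Proof.
split.
  apply: (@measurable_fun_cvg _ _ _ _ (fun m x => complex.Re (f m x) * \1_A x)).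
    move=> m; apply: measurable_funM; last by apply: measurable_indic; exact: mA.
    by have [] := cLfun_cmeasurable (f m).
  by move=> x _; exact: Re_cvg.
apply: (@measurable_fun_cvg _ _ _ _ (fun m x => complex.Im (f m x) * \1_A x)).
  move=> m; apply: measurable_funM; last by apply: measurable_indic; exact: mA.
  by have [] := cLfun_cmeasurable (f m).
by move=> x _; exact: Im_cvg.
Qed.

Let Fl_close n x : A x -> ((normc (Fl x - f n x) `^ p)%:E <= G n x)%E.
Proof.
move=> Ax; have [->|Gn] := eqVneq (G n x) +oo%E; first by rewrite leey.
have Gfin : G n x \is a fin_num.
  by rewrite ge0_fin_numE; [rewrite ltey|exact: G_ge0].
rewrite -(fineK Gfin) lee_fin.
pose r := fine (G n x) `^ p^-1.
have sr k : s n k x <= r.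
  have : (h n k x <= (fine (G n x))%:E)%E by rewrite fineK.
  rewrite lee_fin => le; rewrite -[leLHS]powRr1// -(mulfV (lt0r_neq0 p0)) powRrM.
  by apply: ge0_ler_powR; rewrite ?nnegrE ?powR_ge0 ?invr_ge0 ?(ltW p0)// fine_ge0.
have -> : fine (G n x) = r `^ p.
  by rewrite -powRrM mulVf ?lt0r_neq0// powRr1// fine_ge0.
apply: ge0_ler_powR; rewrite ?nnegrE ?powR_ge0 ?normc_ge0 ?(ltW p0)//.
apply/ler_addgt0Pr => e e0; have e2 : 0 < e / 2 by lra.
have := @Re_cvg x; have := @Im_cvg x; rewrite indicE mem_set//.
move=> /cvgrPdist_lt/(_ _ e2) imP /cvgrPdist_lt/(_ _ e2) reP.
have nP : \forall m \near \oo, (n <= m)%N by exists n.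
have [m [/= [im re] nm']] := filter_ex (filterI (filterI imP reP) nP).
rewrite (_ : Fl x - f n x = (f m x - f n x) + (Fl x - f m x)); last first.
  by rewrite [RHS]addrC subrKA.
rewrite (le_trans (normcD _ _))// lerD//.
  by have := f_close n (m - n)%N x; rewrite subnKC// => /le_trans; apply.
rewrite (le_trans (normc_le_ReIm _))//; move: im re; rewrite !mulr1 /Fl.
by case: (f m x) => a b /=; lra.
Qed.

Let Fl_pint n : (pint (fun x => Fl x - f n x)%R <= ((2 * hf n) `^ p)%:E)%E.
Proof.
apply: le_trans (G_bound n); apply: ae_ge0_le_integral => //.
- by move=> x _; rewrite lee_fin powR_ge0.
- apply/measurable_EFinP/measurable_normcp.
  exact: cmeasurableB Fl_meas (cLfun_cmeasurable (f n)).
- by apply: filterS G_ae => x xA _; exact: Fl_close.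
Qed.

Lemma cauchy_has_limit : exists l, forall n, nm (u n - l) <= 2 * hf n.
Proof.
have mD n := cmeasurableB Fl_meas (cLfun_cmeasurable (f n)).
have Dp n : (fun x => Fl x - f n x) \in cLfun mu p.
  by apply: cLfunI => //; rewrite (le_lt_trans (Fl_pint n))// ltry.
exists (cls (fun x => Fl x - f 0%N x) + u 0%N) => n.
have <- : cls (fun x => Fl x - f n x) + u n = cls (fun x => Fl x - f 0%N x) + u 0%N.
  rewrite -[u n]cls_repr -[u 0%N]cls_repr -!clsD//; try exact: cLfunP.
  by congr cls; apply/funext => x; rewrite !subrK.
rewrite opprD addrCA subrr addr0 nmN.
have h0 : 0 <= 2 * hf n by rewrite mulr_ge0// exprn_ge0// invr_ge0.
have := Fl_pint n; rewrite -nm_cls// lee_fin => le.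
rewrite leNgt; apply/negP => /(gt0_ltr_powR p0).
by rewrite !nnegrE nm_ge0 h0 => /(_ isT isT); rewrite ltNge le.
Qed.

End riesz_fischer.

Lemma cLspace_complete : ncomplete X.
Proof. by move=> u; exact: cauchy_has_limit. Qed.

End Lp.

(** * Moduli and positive elements *)

Section modulus.
Context d (Om : measurableType d) (R : realType).
Variables (mu : {measure set Om -> \bar R}) (p : R) (p1 : 1 <= p).
Local Notation X := (cLspace mu p1).
Implicit Types (u v : X) (f g : Om -> R[i]).

(** A representative of the modulus of a class, see cls_abs. *)
Definition absf f : Om -> R[i] := fun x => (normc (f x))%:C.

Lemma normc_absf f x : normc (absf f x) = normc (f x).
Proof. by rewrite normc_real ger0_norm// normc_ge0. Qed.

Lemma absf_cLfun f : f \in cLfun mu p -> absf f \in cLfun mu p.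
Proof. by move=> fp; have [g <- _] := cls_pi p1 fp; exact: cLfunP (cLfun_abs g). Qed.

Lemma cls_abs f : f \in cLfun mu p -> cLspace_abs (cls mu p1 f) = cls mu p1 (absf f).
Proof.
move=> fp; have [g <- ->] := cls_pi p1 fp.
by rewrite -pi_cLspace_abs -cls_val.
Qed.

Lemma abs_repr u : cLspace_abs u = cls mu p1 (absf (repr u)).
Proof. by rewrite -cls_abs ?cls_repr//; exact: cLfunP. Qed.

Lemma eq_nm_cls f g : f \in cLfun mu p -> g \in cLfun mu p ->
  (forall x, normc (f x) = normc (g x)) -> nm (cls mu p1 f) = nm (cls mu p1 g).
Proof.
move=> fp gp fg; apply/eqP; rewrite eq_le; apply/andP.
by split; apply: nm_le => //; apply: aeW => x; rewrite fg.
Qed.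

Lemma nm_abs u : nm (cLspace_abs u) = nm u.
Proof.
rewrite abs_repr -[in RHS](cls_repr u); apply: eq_nm_cls.
- by apply: absf_cLfun; exact: cLfunP.
- exact: cLfunP.
- by move=> x; exact: normc_absf.
Qed.

Lemma cLfunD f g : f \in cLfun mu p -> g \in cLfun mu p ->
  (fun x => f x + g x) \in cLfun mu p.
Proof.
by move=> /(cls_pi p1)[f' <- _] /(cls_pi p1)[g' <- _]; exact: cLfunP (f' + g').
Qed.

Lemma cLfunZ a f : f \in cLfun mu p -> (fun x => a * f x) \in cLfun mu p.
Proof. by move=> /(cls_pi p1)[f' <- _]; exact: cLfunP (a *: f'). Qed.

Lemma cLfunB f g : f \in cLfun mu p -> g \in cLfun mu p ->
  (fun x => f x - g x) \in cLfun mu p.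
Proof.
by move=> /(cls_pi p1)[f' <- _] /(cls_pi p1)[g' <- _]; exact: cLfunP (f' - g').
Qed.

(** The modulus is a contraction, in particular continuous. *)
Lemma nm_absB u v : nm (cLspace_abs u - cLspace_abs v) <= nm (u - v).
Proof.
rewrite !abs_repr -clsB; [|by apply: absf_cLfun; exact: cLfunP..].
rewrite -{2}(cls_repr u) -{2}(cls_repr v) -clsB; [|exact: cLfunP..].
apply: nm_le.
- by apply: cLfunB; apply: absf_cLfun; exact: cLfunP.
- by apply: cLfunB; exact: cLfunP.
apply: aeW => x; rewrite /absf -rmorphB normc_real ler_norml.
have := normcB_ge (repr u x) (repr v x); have := normcB_ge (repr v x) (repr u x).
by rewrite (normcBC (repr v x)) => h1 h2; apply/andP; split; lra.
Qed.

Definition pos u := cLspace_abs u = u.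

Lemma pos_abs u : pos (cLspace_abs u).
Proof.
rewrite /pos (abs_repr u) cls_abs; last by apply: absf_cLfun; exact: cLfunP.
by congr cls; apply/funext => x; rewrite {1}/absf normc_absf.
Qed.

Lemma posD u v : pos u -> pos v -> pos (u + v) /\ nm v <= nm (u + v).
Proof.
move=> <- <-; rewrite !abs_repr -clsD; [|by apply: absf_cLfun; exact: cLfunP..].
set f := repr u; set g := repr v.
have fp : absf f \in cLfun mu p by apply: absf_cLfun; exact: cLfunP.
have gp : absf g \in cLfun mu p by apply: absf_cLfun; exact: cLfunP.
have nE x : normc (absf f x + absf g x) = normc (f x) + normc (g x).
  by rewrite /absf -rmorphD normc_real ger0_norm// addr_ge0 ?normc_ge0.
split.
  rewrite /pos cls_abs; last exact: cLfunD.
  by congr cls; apply/funext => x; rewrite {1}/absf nE rmorphD.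
apply: nm_le => //; first exact: cLfunD.
by apply: aeW => x; rewrite nE normc_absf lerDr normc_ge0.
Qed.

Lemma pos0 : pos (0 : X).
Proof. by apply: nm_eq0; rewrite nm_abs nm0. Qed.

Lemma pos_sum (I : Type) (r : seq I) (P : pred I) (F : I -> X) : (forall i, P i -> pos (F i)) ->
  pos (\sum_(i <- r | P i) F i).
Proof.
move=> Fp; elim/big_ind : _ => //; first exact: pos0.
by move=> u v up vp; have [] := posD up vp.
Qed.

Lemma pos_ae u : pos u -> {ae mu, forall x, repr u x = (normc (repr u x))%:C}.
Proof.
rewrite /pos abs_repr -{2}(cls_repr u) => /cls_ae.
move=> /(_ (absf_cLfun (cLfunP _)) (cLfunP _)).
by apply: filterS => x /(_ I).
Qed.

End modulus.

(** * Lattice homomorphisms between L^q and L^p *)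

Section lattice_hom.
Context (R : realType) (p q : R) (p1 : 1 <= p) (q1 : 1 <= q).
Context (d1 d2 : measure_display) (Om1 : measurableType d1) (Om2 : measurableType d2).
Variables (mu1 : {measure set Om1 -> \bar R}) (mu2 : {measure set Om2 -> \bar R}).
Variable j : {linear cLspace mu2 q1 -> cLspace mu1 p1}.
Hypothesis j_lat : lattice_homomorphism j.
Local Notation X := (cLspace mu1 p1).
Local Notation Y := (cLspace mu2 q1).
Local Notation hf n := ((2^-1 : R) ^+ n).

Lemma j_pos u : pos u -> pos (j u).
Proof. by rewrite /pos j_lat => ->. Qed.

(** Positive operators are bounded: otherwise there are positive v_n of norm
    at most 2^-n whose images have norm at least 2^n; their sum l dominates
    each v_n, so j l would have infinite norm. *)
Lemma j_bounded : exists2 C : R, 0 < C & forall u, nm (j u) <= C * nm u.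
Proof.
apply: contrapT => noC.
have /choice[v vP] : forall n, exists v, [/\ pos v, nm v <= hf n & 2 ^+ n <= nm (j v)].
  move=> n; apply: contrapT => nov; apply: noC; exists (4 ^+ n); first by rewrite exprn_gt0.
  move=> u; rewrite leNgt; apply/negP => ult.
  have u0 : 0 < nm u.
    rewrite lt_neqAle nm_ge0 andbT; apply/eqP => /esym/nm_eq0 u0.
    by move: ult; rewrite u0 linear0 !nm0 mulr0 ltxx.
  apply: nov; exists (cLspace_abs ((hf n / nm u)%:C *: u)); split.
  - exact: pos_abs.
  - rewrite nm_abs nmZr ger0_norm ?divr_ge0 ?exprn_ge0 ?invr_ge0 ?nm_ge0//.
    by rewrite divfK// gt_eqF.
  - rewrite -j_lat nm_abs linearZ nmZr ger0_norm ?divr_ge0 ?exprn_ge0 ?invr_ge0 ?nm_ge0//.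
    rewrite mulrAC ler_pdivlMr//.
    have -> : 2 ^+ n * nm u = hf n * (4 ^+ n * nm u).
      rewrite mulrA -exprMn; congr (_ ^+ _ * _); lra.
    by rewrite ler_wpM2l ?exprn_ge0 ?invr_ge0// ltW.
pose s n := \sum_(k < n) v k.
have [l lP] : exists l, forall n, nm (s n - l) <= 2 * hf n.
  apply: (@cLspace_complete _ _ _ mu2 _ q1) => n.
  by rewrite /s big_ord_recr /= addrAC subrr add0r; have [] := vP n.
have lv n : pos (l - v n).
  rewrite /pos; apply/eqP; rewrite -subr_eq0; apply/eqP/nm_small => e e0.
  have [m me] := @hf_small R (e / 4) ltac:(lra).
  pose k := (m + n.+1)%N.
  have sv : pos (s k - v n).
    have nk : (n < k)%N by rewrite /k addnS ltnS leq_addl.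
    rewrite /s (bigD1 (Ordinal nk))//= addrAC subrr add0r.
    by apply: pos_sum => i _; have [] := vP i.
  have hk : hf k <= hf m.
    rewrite /k exprD ler_piMr ?exprn_ge0 ?invr_ge0// exprn_ile1// ?invr_ge0//.
    by rewrite invf_le1// ler1n.
  rewrite (_ : cLspace_abs (l - v n) - (l - v n) = (cLspace_abs (l - v n) - cLspace_abs (s k - v n)) +
     ((s k - v n) - (l - v n))); last by rewrite (sv : cLspace_abs _ = _) addrA subrK.
  rewrite (le_trans (nmD _ _))//; have := nm_absB (l - v n) (s k - v n).
  have -> : nm (l - v n - (s k - v n)) = nm (s k - l).
    by rewrite nmBC opprB addrA subrK.
  have -> : nm (s k - v n - (l - v n)) = nm (s k - l) by rewrite opprB addrA subrK.
  have := lP k; lra.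
have jl n : 2 ^+ n <= nm (j l).
  have [vp _ le] := vP n; apply: (le_trans le).
  rewrite -(subrK (v n) l) linearD.
  by have [] := posD (j_pos (lv n)) (j_pos vp).
have := jl (Num.bound (nm (j l))); apply/negP; rewrite -ltNge.
rewrite (lt_le_trans (archi_boundP (nm_ge0 _)))//.
by rewrite -natrX ler_nat ltnW// ltn_expl.
Qed.

(** Disjointness of f and g means ||f| - |g|| = |f| + |g|, an identity
    preserved by j; so j f and j g are disjoint, and their p-th powers add
    up. *)
Lemma j_disjoint (f g : Om2 -> R[i]) : f \in cLfun mu2 q -> g \in cLfun mu2 q ->
  (forall x, f x = 0 \/ g x = 0) ->
  nm (j (cls mu2 q1 f + cls mu2 q1 g)) `^ p =
  nm (j (cls mu2 q1 f)) `^ p + nm (j (cls mu2 q1 g)) `^ p.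
Proof.
move=> fq gq fg; set u := cls mu2 q1 f; set v := cls mu2 q1 g.
have ju := pos_ae (j_pos (pos_abs u)); have jv := pos_ae (j_pos (pos_abs v)).
set a := repr (j (cLspace_abs u)) in ju *.
set b := repr (j (cLspace_abs v)) in jv *.
have afq := absf_cLfun q1 fq; have agq := absf_cLfun q1 gq.
have absE : cLspace_abs (cLspace_abs u - cLspace_abs v) = cLspace_abs u + cLspace_abs v.
  rewrite !cls_abs// -clsB// cls_abs; last exact: (cLfunB q1).
  rewrite -clsD//; congr cls; apply/funext => x; rewrite /absf -rmorphB normc_real.
  case: (fg x) => ->; rewrite normc0 ?subr0 ?sub0r ?normrN ger0_norm ?normc_ge0//.
    by rewrite [in RHS]rmorph0 add0r.
  by rewrite [in RHS]rmorph0 addr0.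
have ab0 : {ae mu1, forall x, normc (a x) = 0 \/ normc (b x) = 0}.
  have := congr1 j absE; rewrite -j_lat linearB linearD abs_repr.
  rewrite -[RHS](cls_repr (j _ + _)) => /cls_ae.
  move=> /(_ (absf_cLfun p1 (cLfunP _)) (cLfunP _)) h.
  have hB : (repr (j (cLspace_abs u) - j (cLspace_abs v)) : Om1 -> _) =
      (fun x => a x - b x) %[ae mu1].
    apply/(cls_ae p1); [exact: cLfunP|by apply: (cLfunB p1); exact: cLfunP|].
    by rewrite clsB ?cls_repr//; exact: cLfunP.
  have hD := reprD_ae (j (cLspace_abs u)) (j (cLspace_abs v)).
  apply: filter_app hB; apply: filter_app hD.
  apply: filterS3 h ju jv => x h' aE bE hD' hB'.
  have := h' I; rewrite /absf (hB' I) (hD' I) -/a -/b.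
  move: aE bE (normc_ge0 (a x)) (normc_ge0 (b x)).
  move: (normc (a x)) (normc (b x)) => al be -> -> a0 b0.
  rewrite -rmorphB -rmorphD normc_real => /complexI.
  case: (leP be al) => [ba|ab].
    by rewrite ger0_norm ?subr_ge0// => ?; right; lra.
  by rewrite ltr0_norm ?subr_lt0// => ?; left; lra.
have normE w : {ae mu1, forall x, normc (repr (j (cLspace_abs w)) x) = normc (repr (j w) x)}.
  rewrite -j_lat (abs_repr (j w)).
  have := repr_cls p1 (absf_cLfun p1 (cLfunP (repr (j w)))).
  by apply: filterS => x /(_ I) ->; exact: normc_absf.
have UV0 : {ae mu1, forall x, repr (j u) x = 0 \/ repr (j v) x = 0}.
  apply: filterS3 (normE u) (normE v) ab0 => x uE vE.
  by rewrite /a /b uE vE => -[/eq0_normc|/eq0_normc]; [left|right].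
have hD := reprD_ae (j u) (j v).
apply: EFin_inj; rewrite linearD EFinD !nm_repr /pint -ge0_integralD//; last 4 first.
- by move=> x _; rewrite lee_fin powR_ge0.
- by apply/measurable_EFinP/measurable_normcp/cLfun_cmeasurable.
- by move=> x _; rewrite lee_fin powR_ge0.
- by apply/measurable_EFinP/measurable_normcp/cLfun_cmeasurable.
have p0 : p != 0 by rewrite gt_eqF// (lt_le_trans ltr01 p1).
apply: ae_eq_integral => //.
- by apply/measurable_EFinP/measurable_normcp/cLfun_cmeasurable.
- by apply: emeasurable_funD; apply/measurable_EFinP/measurable_normcp/cLfun_cmeasurable.
- apply: filterS2 hD UV0 => x /(_ I) -> + _.
  by move=> [->|->]; rewrite ?add0r ?addr0 normc0 powR0// ?add0e ?adde0.
Qed.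

End lattice_hom.

(** * The density of the image of a measure under a lattice homomorphism *)

Section domination.
Context d (Om : measurableType d) (R : realType).
Variables (mu : {measure set Om -> \bar R}) (q : R) (q1 : 1 <= q).
Implicit Types f g : Om -> R[i].

Let q0 : 0 < q. Proof. exact: lt_le_trans ltr01 q1. Qed.

Lemma cmeasurable_real (h : Om -> R) : measurable_fun setT h ->
  cmeasurable (fun x => (h x)%:C).
Proof. by split => //; exact: measurable_cst. Qed.

Lemma cLfun_dom f g : cmeasurable f -> g \in cLfun mu q ->
  (forall x, normc (f x) <= normc (g x)) -> f \in cLfun mu q.
Proof.
move=> mf gq fg; apply: cLfunI => //; apply: le_lt_trans (cLfun_fin q1 gq).
apply: ge0_le_integral => //.
- by move=> x _; rewrite lee_fin powR_ge0.
- by apply/measurable_EFinP/measurable_normcp.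
- by apply/measurable_EFinP/measurable_normcp; exact: cLfun_meas gq.
- move=> x _; rewrite lee_fin.
  by apply: ge0_ler_powR; rewrite ?nnegrE ?normc_ge0// ltW.
Qed.

Lemma dom_cvg (g_ : nat -> Om -> R[i]) g F :
  (forall n, g_ n \in cLfun mu q) -> g \in cLfun mu q -> F \in cLfun mu q ->
  (forall n x, normc (g x - g_ n x) <= normc (F x)) ->
  (forall x, (fun n => normc (g x - g_ n x)) @ \oo --> (0 : R)) ->
  forall e : R, 0 < e -> exists N, forall n, (N <= n)%N ->
    nm (cls mu q1 (g_ n) - cls mu q1 g) <= e.
Proof.
move=> gq' gq Fq gF g0 e e0.
have dq n : (fun x => g x - g_ n x) \in cLfun mu q by exact: cLfunB.
have : (fun n => pint mu q (fun x => g x - g_ n x)) @ \oo --> 0%E.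
  rewrite -[X in _ --> X](integral0 mu setT).
  apply: (@dominated_cvg _ _ _ mu setT measurableT
    (fun n x => (normc (g x - g_ n x) `^ q)%:E) (cst 0%E)
    (fun x => (normc (F x) `^ q)%:E)) => //.
  - by move=> n; apply/measurable_EFinP/measurable_normcp/cLfun_meas.
  - move=> x _; apply: cvg_EFin; first exact: nearW.
    apply/cvgrPdist_lt => t t0 /=.
    have t1 : 0 < t `^ q^-1 by rewrite powR_gt0.
    have /cvgrPdist_lt/(_ _ t1) := g0 x.
    apply: filterS => n /=; rewrite !sub0r !normrN !ger0_norm ?normc_ge0 ?powR_ge0//.
    move=> lt; rewrite (_ : t = (t `^ q^-1) `^ q).
      by apply: gt0_ltr_powR; rewrite ?nnegrE ?normc_ge0 ?powR_ge0.
    by rewrite -powRrM mulVf ?gt_eqF// powRr1// ltW.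
  - apply/integrableP; split.
      by apply/measurable_EFinP/measurable_normcp; exact: cLfun_meas Fq.
    under eq_integral do rewrite gee0_abs ?lee_fin ?powR_ge0//.
    exact: cLfun_fin Fq.
  - move=> n x _; rewrite gee0_abs ?lee_fin ?powR_ge0//.
    by apply: ge0_ler_powR; rewrite ?nnegrE ?normc_ge0// ltW.
move=> /fine_cvgP[_ /cvgrPdist_lt /(_ _ (powR_gt0 q e0))] [N _ NP].
exists N => n /NP /=; rewrite sub0r normrN -(nm_cls q1 (dq n)) /=.
rewrite ger0_norm ?powR_ge0// (clsB q1 gq (gq' n)) nmBC => lt.
rewrite leNgt; apply/negP => /(gt0_ltr_powR q0).
by rewrite !nnegrE nm_ge0 ltW// => /(_ isT isT)/(lt_trans lt); rewrite ltxx.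
Qed.

End domination.

Lemma powR_cvg (R : realType) (r a : R) (u : nat -> R) : 0 < r -> 0 <= a ->
  (forall n, 0 <= u n) -> u @ \oo --> a -> (fun n => u n `^ r) @ \oo --> a `^ r.
Proof.
move=> r0 a0 u0 ua; have [a_eq0|an0] := eqVneq a 0.
  rewrite a_eq0 powR0 ?gt_eqF//; apply/cvgrPdist_lt => e e0.
  have e1 : 0 < e `^ r^-1 by rewrite powR_gt0.
  move: ua; rewrite a_eq0 => /cvgrPdist_lt/(_ _ e1); apply: filterS => n /=.
  rewrite !sub0r !normrN !ger0_norm ?powR_ge0// => lt.
  rewrite (_ : e = (e `^ r^-1) `^ r); last first.
    by rewrite -powRrM mulVf ?gt_eqF// powRr1// ltW.
  by apply: gt0_ltr_powR; rewrite ?nnegrE ?powR_ge0.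
have agt0 : 0 < a by rewrite lt_neqAle eq_sym an0.
apply: (@cvg_comp _ _ _ u (fun x : R => x `^ r) _ _ _ ua).
have : {for a, continuous (fun x : R => x `^ r)}.
  apply: differentiable_continuous; apply/derivable1_diffP.
  by apply: derivable_powR; rewrite in_itv/= agt0.
exact.
Qed.

Section density.
Context (R : realType) (p q : R) (p1 : 1 <= p) (q1 : 1 <= q).
Context (d1 d2 : measure_display) (Om1 : measurableType d1) (Om2 : measurableType d2).
Variables (mu1 : {measure set Om1 -> \bar R}) (mu2 : {measure set Om2 -> \bar R}).
Variable j : {linear cLspace mu2 q1 -> cLspace mu1 p1}.
Hypothesis j_lat : lattice_homomorphism j.
Local Notation cl f := (cls mu2 q1 f).

Let p0 : 0 < p. Proof. exact: lt_le_trans ltr01 p1. Qed.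
Let q0 : 0 < q. Proof. exact: lt_le_trans ltr01 q1. Qed.

Lemma j_cvg (u_ : nat -> cLspace mu2 q1) u :
  (forall e : R, 0 < e -> exists N, forall n, (N <= n)%N -> nm (u_ n - u) <= e) ->
  (fun n => nm (j (u_ n)) `^ p) @ \oo --> nm (j u) `^ p.
Proof.
move=> uu; have [C C0 jC] := j_bounded j_lat.
have h : (fun n => nm (j (u_ n))) @ \oo --> nm (j u).
  apply/cvgrPdist_le => e e0; have [|N NP] := uu (e / C); first by rewrite divr_gt0.
  exists N => // n /NP; rewrite ler_pdivlMr// mulrC => le.
  have := jC (u_ n - u); rewrite linearB => /le_trans/(_ le) le'.
  apply: le_trans le'; rewrite ler_norml; have := nmBl (j (u_ n)) (j u).
  have := nmBl (j u) (j (u_ n)); rewrite (nmBC (j u)) => a b.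
  by apply/andP; split; lra.
by apply: powR_cvg => //; [exact: nm_ge0|move=> n; exact: nm_ge0].
Qed.

Variable e : Om2 -> R.
Hypotheses (e_meas : measurable_fun setT e) (e_ge0 : forall x, 0 <= e x).
Hypothesis e_cLfun : (fun x => (e x)%:C) \in cLfun mu2 q.

Let cut (A : set Om2) : Om2 -> R[i] := fun x => (e x * \1_A x)%:C.

Let cut_cLfun A : measurable A -> cut A \in cLfun mu2 q.
Proof.
move=> mA; apply: (cLfun_dom q1 _ e_cLfun).
  by apply: cmeasurable_real; apply: measurable_funM => //; exact: measurable_indic.
move=> x; rewrite !normc_real !ger0_norm ?mulr_ge0// indicE.
by case: (x \in A); rewrite ?mulr1// mulr0.
Qed.

(** Additive by disjointness of images (j_disjoint), countably additive by
    boundedness of j and dominated convergence. *)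
Definition image_mass (A : set Om2) : \bar R := (nm (j (cl (cut A))) `^ p)%:E.

Let mass0 : image_mass set0 = 0%E.
Proof.
rewrite /image_mass (_ : cut set0 = cst 0).
  by rewrite (cls0 mu2 q1) linear0 nm0 powR0 ?gt_eqF.
by apply/funext => x; rewrite /cut indicE in_set0 mulr0.
Qed.

Let mass_ge0 A : (0 <= image_mass A)%E.
Proof. by rewrite lee_fin powR_ge0. Qed.

Let massU A B : measurable A -> measurable B -> A `&` B = set0 ->
  image_mass (A `|` B) = (image_mass A + image_mass B)%E.
Proof.
move=> mA mB AB; rewrite /image_mass -EFinD -(j_disjoint j_lat); first last.
- move=> x; rewrite /cut !indicE; case: (boolP (x \in A)) => xA.
    right; rewrite memNset ?mulr0// => xB.
    by have : set0 x by rewrite -AB; split => //; exact: set_mem.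
  by left; rewrite mulr0.
- exact: cut_cLfun.
- exact: cut_cLfun.
congr (nm (j _) `^ p)%:E; rewrite -clsD ?cut_cLfun//; congr (cl _).
apply/funext => x; rewrite /cut -rmorphD -mulrDr; congr (_ * _)%:C.
rewrite !indicE in_setU; case: (boolP (x \in A)) => xA; last by rewrite add0r.
rewrite memNset ?addr0// => xB.
by have : set0 x by rewrite -AB; split => //; exact: set_mem.
Qed.

Let mass_sigma : semi_sigma_additive image_mass.
Proof.
move=> F mF tF mUF.
have fin n : (\sum_(0 <= i < n) image_mass (F i) = image_mass (\big[setU/set0]_(i < n) F i))%E.
  elim: n => [|n ih]; first by rewrite big_ord0 mass0; exact: big_geq.
  have tF' : trivIset (fun x => predT x) F by apply: sub_trivIset tF.
  have mU : measurable (\big[setU/set0]_(i < n) F i) by exact: bigsetU_measurable.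
  have UF := trivIset_bigsetUI tF' (isT : predT n) (leqnn n).
  rewrite [RHS](_ : _ = (image_mass (\big[setU/set0]_(i < n) F i) + image_mass (F n))%E).
    by rewrite -ih; exact: big_nat_recr.
  by rewrite big_ord_recr; exact: massU.
under eq_fun do rewrite fin.
apply: cvg_EFin; first exact: nearW.
apply: j_cvg; apply: (dom_cvg q1 (F := cut setT)).
- by move=> n; apply: cut_cLfun; exact: bigsetU_measurable.
- exact: cut_cLfun.
- exact: cut_cLfun.
- move=> n x; rewrite /cut -rmorphB !normc_real -mulrBr normrM (normrM _ (\1_setT _)).
  rewrite ler_wpM2l// !indicE in_setT normr1.
  by case: (_ \in _); case: (_ \in _); rewrite ?subrr ?subr0 ?sub0r ?normrN ?normr0 ?normr1.
- move=> x; apply/cvgrPdist_lt => t t0.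
  have [[N _ FN]|nx] := pselect ((\bigcup_n F n) x); last first.
    apply: nearW => n; rewrite /cut !indicE memNset// memNset ?mulr0 ?subrr ?normc0 ?subrr ?normr0//.
    by rewrite -bigcup_mkord => -[i _ Fi]; apply: nx; exists i.
  exists N.+1 => // n Nn.
  have U1 : (\1_(\bigcup_n F n) x : R) = 1 by rewrite indicE mem_set//; exists N.
  have U2 : (\1_(\big[setU/set0]_(i < n) F i) x : R) = 1.
    by rewrite indicE mem_set// -bigcup_mkord; exists N.
  by rewrite /cut U1 U2 subrr normc0 subrr normr0.
Qed.

HB.instance Definition _ := isMeasure.Build _ _ _ image_mass mass0 mass_ge0 mass_sigma.

Let mass_fin : fin_num_fun image_mass.
Proof. by []. Qed.

HB.instance Definition _ := Measure_isFinite.Build _ _ _ image_mass mass_fin.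

Let D := [set x | e x != 0].

Let mD : measurable D.
Proof.
rewrite (_ : D = ~` (e @^-1` [set 0])).
  by apply: measurableC; rewrite -[X in measurable X]setTI; exact: e_meas.
by apply/seteqP; split => x /=; [move/eqP|move/eqP].
Qed.

(** Restricted to the support of the q-integrable function e, mu2 becomes
    sigma-finite, as the Radon-Nikodym theorem requires. *)
Definition supp_measure : set Om2 -> \bar R := mrestr mu2 mD.

HB.instance Definition _ := Measure.on supp_measure.

Let supp_sigma : sigma_finite setT supp_measure.
Proof.
exists (fun n => if n is n'.+1 then [set x | n'.+1%:R^-1 <= e x] else ~` D).
  apply/seteqP; split => // x _; have [ex|ex] := eqVneq (e x) 0.
    by exists 0%N => //= /negP; rewrite ex eqxx.
  have e0 : 0 < e x by rewrite lt_neqAle eq_sym ex e_ge0.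
  exists (Num.bound (e x)^-1).+1 => //=; rewrite invf_ple ?posrE//.
  have e0' : 0 <= (e x)^-1 by rewrite invr_ge0 ltW.
  by rewrite (le_trans (ltW (archi_boundP e0')))// ler_nat.
case=> [|n]; split.
- exact: measurableC.
- by rewrite /supp_measure /mrestr setICl measure0 ltry.
- rewrite (_ : [set x | _] = e @^-1` `[n.+1%:R^-1, +oo[).
    by rewrite -[X in measurable X]setTI; apply: e_meas.
  by apply/seteqP; split => x /=; rewrite in_itv/= andbT.
- set A := [set x | _].
  have mA : measurable A.
    rewrite (_ : A = e @^-1` `[n.+1%:R^-1, +oo[).
      by rewrite -[X in measurable X]setTI; apply: e_meas.
    by apply/seteqP; split => x /=; rewrite in_itv/= andbT.
  have n0 : 0 < (n.+1%:R^-1 : R) by rewrite invr_gt0.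
  apply: (@le_lt_trans _ _ (mu2 A)).
    by apply: le_measure; rewrite ?inE//; exact: measurableI.
  have : (((n.+1%:R^-1 : R) `^ q)%:E * mu2 A <= pint mu2 q (fun x => (e x)%:C))%E.
    have -> : mu2 A = (\int[mu2]_x (\1_A x)%:E)%E by rewrite integral_indic// setIT.
    rewrite -ge0_integralZl//; last exact/measurable_EFinP/measurable_indic.
    apply: ge0_le_integral => //.
    + apply: emeasurable_funM; first exact: measurable_cst.
      exact/measurable_EFinP/measurable_indic.
    + by apply/measurable_EFinP/measurable_normcp; exact: cLfun_meas e_cLfun.
    + move=> x _; rewrite -EFinM lee_fin indicE normc_real ger0_norm//.
      case: (boolP (x \in A)) => xA; last by rewrite mulr0 powR_ge0.
      rewrite mulr1; apply: ge0_ler_powR; rewrite ?nnegrE ?(ltW q0) ?(ltW n0)//.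
      exact: set_mem xA.
  move=> /le_lt_trans/(_ (cLfun_fin q1 e_cLfun)) fin; rewrite ltNge leye_eq.
  apply/eqP => muA; move: fin; rewrite muA gt0_muley ?ltxx// lte_fin.
Qed.

HB.instance Definition _ := Measure_isSigmaFinite.Build _ _ _ supp_measure supp_sigma.

Let mass_ac : image_mass `<< supp_measure.
Proof.
apply/null_content_dominatesP => A mA A0.
rewrite /image_mass (_ : cl (cut A) = 0) ?linear0 ?nm0 ?powR0 ?gt_eqF//.
rewrite -(cls0 mu2 q1); apply/cls_ae; [exact: cut_cLfun|exact: cLfun0|].
exists (A `&` D); split => //; first exact: measurableI.
move=> x /= /not_implyP[_ /eqP cx]; move: cx; rewrite /cut indicE.
case: (boolP (x \in A)) => [/set_mem xA|]; last by rewrite mulr0 eqxx.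
by rewrite mulr1 => ex; split => //; apply: contra_neq ex => ->.
Qed.

Let pieces (h : Om2 -> R) (s : seq R) : measurable_fun setT h -> uniq s ->
  let f := (fun x => ((\sum_(r <- s) r * \1_(h @^-1` [set r]) x) * e x)%:C) in
  f \in cLfun mu2 q /\
  (nm (j (cl f)) `^ p)%:E =
    (\sum_(r <- s) (`|r| `^ p)%:E * image_mass (h @^-1` [set r]))%E.
Proof.
move=> mh; elim: s => [_ f|r s ih]; last rewrite cons_uniq => /andP[rs us] f.
  rewrite (_ : f = fun=> 0); first by rewrite (cLfun0 mu2 q1) (cls0 mu2 q1) linear0 nm0 powR0 ?gt_eqF// big_nil.
  by apply/funext => x; rewrite /f big_nil mul0r.
have [gq IH] := ih us; set g := (fun x => _) in gq IH.
have mA : measurable (h @^-1` [set r]) by rewrite -[X in measurable X]setTI; exact: mh.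
pose g' x := r%:C * cut (h @^-1` [set r]) x.
have g'q : g' \in cLfun mu2 q by apply: (cLfunZ q1); exact: cut_cLfun.
have fE : f = fun x => g' x + g x.
  apply/funext => x; rewrite /f big_cons mulrDl rmorphD; congr (_ + _).
  by rewrite /g' /cut -rmorphM mulrAC -mulrA.
split; first by rewrite fE; exact: (cLfunD q1).
rewrite fE clsD// (j_disjoint j_lat)//; last first.
  move=> x; have [hx|hx] := eqVneq (h x) r.
    right; rewrite /g big_seq big1 ?mul0r// => t ts.
    rewrite indicE memNset ?mulr0//= hx => rt.
    by move: rs; rewrite rt ts.
  by left; rewrite /g' /cut indicE memNset ?mulr0//= => /eqP; apply/negP.
rewrite big_cons EFinD -IH; apply: (f_equal (fun t => t + _)%E).
rewrite /g' clsZ ?cut_cLfun// linearZ nmZr powRM ?nm_ge0//.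
Qed.

Import HBNNSimple.

(** On a simple function times e, j acts piece by piece, and the pieces have
    disjoint images. *)
Let simple_mass (h : {nnsfun Om2 >-> R}) :
  let f := (fun x => (h x * e x)%:C) in f \in cLfun mu2 q /\
  (nm (j (cl f)) `^ p)%:E = (\int[image_mass]_x ((h x) `^ p)%:E)%E.
Proof.
have mh : measurable_fun setT h by [].
pose s : seq R := finmap.enum_fset (fset_set (range h)).
have us : uniq s by exact: finmap.fset_uniq.
have hs x : h x \in s by rewrite /s in_fset_set// mem_set//; exists x.
have sumE (F : R -> R) x : \sum_(r <- s) F r * \1_(h @^-1` [set r]) x = F (h x).
  rewrite (bigD1_seq (h x))//= indicE mem_set// mulr1 big1 ?addr0// => r rx.
  by rewrite indicE memNset ?mulr0//= => hr; move: rx; rewrite hr eqxx.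
have [fq fE] := pieces mh us.
set f := (fun x => _) in fq fE.
have -> : (fun x => (h x * e x)%:C) = f.
  by apply/funext => x; rewrite /f (sumE id).
move=> f'; rewrite /f'; split => //; rewrite fE.
have mA r : measurable (h @^-1` [set r]) by rewrite -[X in measurable X]setTI; exact: mh.
have mI r : measurable_fun setT (fun x => (\1_(h @^-1` [set r]) x)%:E : \bar R).
  exact/measurable_EFinP/measurable_indic.
rewrite [RHS](_ : _ = (\int[image_mass]_x
    \sum_(r <- s) (`|r| `^ p)%:E * (\1_(h @^-1` [set r]) x)%:E)%E); last first.
  apply: eq_integral => x _; rewrite -[in LHS](ger0_norm (_ : 0 <= h x))//.
  by rewrite -(sumE (fun r => `|r| `^ p) x) -sumEFin.
rewrite ge0_integral_sum//; last first.
  by move=> r; apply: emeasurable_funM => //; exact: measurable_cst.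
apply: eq_bigr => r _; rewrite ge0_integralZl//.
by have := @integral_indic _ _ _ image_mass setT measurableT _ (mA r); rewrite setIT => ->.
Qed.

(** The Radon-Nikodym derivative of image_mass, rescaled by e^-p. The
    formula holds for g = h e with h simple, and passes to monotone limits h
    of such functions. *)
Lemma image_density : exists W : Om2 -> R, [/\ measurable_fun setT W,
  (forall x, 0 <= W x) & forall g, g \in cLfun mu2 q -> (forall x, e x = 0 -> g x = 0) ->
  (nm (j (cl g)) `^ p)%:E = (\int[mu2]_x (normc (g x) `^ p * W x)%:E)%E].
Proof.
pose f := Radon_Nikodym_SigmaFinite.f image_mass supp_measure.
have f_fin : forall x, f x \is a fin_num := Radon_Nikodym_SigmaFinite.f_fin_num mass_ac.
have f_ge0 : forall x, (0 <= f x)%E := Radon_Nikodym_SigmaFinite.f_ge0 mass_ac.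
have f_meas : measurable_fun setT f.
  by have /measurable_int := Radon_Nikodym_SigmaFinite.f_integrable mass_ac.
exists (fun x => (e x `^ (-1)) `^ p * fine (f x)); split.
- apply: measurable_funM; last exact: measurableT_comp f_meas.
  apply: (@measurableT_comp _ _ _ _ _ _ (@powR R ^~ p)) => //.
  exact: (@measurableT_comp _ _ _ _ _ _ (@powR R ^~ (-1))).
- by move=> x; rewrite mulr_ge0 ?powR_ge0// fine_ge0.
move=> g gq g0.
(* |g| / e, with value 0 where e = 0, as 0 `^ (-1) = 0. *)
pose u x := normc (g x) * e x `^ (-1).
have u_ge0 x : 0 <= u x by rewrite mulr_ge0 ?normc_ge0 ?powR_ge0.
have mg : measurable_fun setT (fun x => normc (g x)).
  by apply: measurable_normc; exact: cLfun_meas gq.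
have u_meas : measurable_fun setT (EFin \o u).
  apply/measurable_EFinP; apply: measurable_funM => //.
  exact: (@measurableT_comp _ _ _ _ _ _ (@powR R ^~ (-1))).
have ue x : u x * e x = normc (g x).
  rewrite /u; have [ex|ex] := eqVneq (e x) 0; first by rewrite ex mulr0 g0// normc0.
  by rewrite powR_inv1// divfK.
pose h := nnsfun_approx measurableT u_meas.
have h_cvg x : (fun n => h n x) @ \oo --> u x.
  have : (EFin \o h^~ x) @ \oo --> (u x)%:E.
    by apply: (cvg_nnsfun_approx measurableT u_meas) => // y _; rewrite lee_fin.
  by move=> /fine_cvgP[_].
have h_nd x : nondecreasing_seq (fun n => h n x).
  by move=> a b ab; have /lefP := nd_nnsfun_approx measurableT u_meas ab; exact.
have h_le n x : h n x <= u x.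
  have <- : limn (fun n => h n x) = u x by apply/cvg_lim => //; exact: h_cvg.
  by apply: nondecreasing_cvgn_le => //; apply/cvg_ex; exists (u x); exact: h_cvg.
have lhs : (fun n => (nm (j (cl (fun x => (h n x * e x)%:C))) `^ p)%:E) @ \oo -->
    (nm (j (cl g)) `^ p)%:E.
  have -> : nm (j (cl g)) = nm (j (cl (absf g))).
    by rewrite -cls_abs// -j_lat nm_abs.
  apply: cvg_EFin; first exact: nearW.
  apply: j_cvg; apply: (dom_cvg q1 (F := absf g)).
  - by move=> n; have [] := simple_mass (h n).
  - exact: (absf_cLfun q1).
  - exact: (absf_cLfun q1).
  - move=> n x; rewrite normc_absf /absf -rmorphB normc_real -ue -mulrBl.
    rewrite ger0_norm ?mulr_ge0 ?subr_ge0//.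
    by rewrite ler_wpM2r// lerBlDr lerDl.
  - move=> x; under eq_fun do rewrite /absf -rmorphB normc_real -ue -mulrBl.
    rewrite -(normr0 R) -(mul0r (e x)) -(subrr (u x)); apply: cvg_norm.
    by apply: cvgMr_tmp; apply: cvgB; [exact: cvg_cst|exact: h_cvg].
have rhs : (fun n => (nm (j (cl (fun x => (h n x * e x)%:C))) `^ p)%:E) @ \oo -->
    (\int[image_mass]_x ((u x) `^ p)%:E)%E.
  under eq_fun do rewrite (proj2 (simple_mass _)).
  have -> : (\int[image_mass]_x ((u x) `^ p)%:E =
      \int[image_mass]_x (limn (fun n => ((h n x) `^ p)%:E)))%E.
    apply: eq_integral => x _; apply/esym/cvg_lim => //.
    apply: cvg_EFin; first exact: nearW.
    by apply: powR_cvg.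
  apply: cvg_monotone_convergence => //.
  - move=> n; apply/measurable_EFinP.
    by apply: (@measurableT_comp _ _ _ _ _ _ (@powR R ^~ p)).
  - by move=> n x _; rewrite lee_fin powR_ge0.
  - move=> x _ a b ab; rewrite lee_fin.
    by apply: ge0_ler_powR; rewrite ?nnegrE ?(ltW p0)//; exact: h_nd.
rewrite (cvg_unique _ lhs rhs)//.
rewrite -(Radon_Nikodym_SigmaFinite.change_of_variables mass_ac (f := fun x => (u x `^ p)%:E))//; last first.
- apply/measurable_EFinP; apply: (@measurableT_comp _ _ _ _ _ _ (@powR R ^~ p)) => //.
  exact/measurable_EFinP.
- by move=> x; rewrite lee_fin powR_ge0.
pose G x : \bar R := (normc (g x) `^ p * ((e x `^ (-1)) `^ p * fine (f x)))%:E.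
have GD x : ~ D x -> G x = 0%E.
  by move=> /negP; rewrite negbK => /eqP ex; rewrite /G g0// normc0 powR0 ?gt_eqF// mul0r.
have GE : G = G \_ D.
  apply/funext => x; rewrite /patch; case: (boolP (x \in D)) => // /negP xD.
  by apply: GD => Dx; apply: xD; exact: mem_set.
transitivity (\int[supp_measure]_x G x)%E.
  apply: eq_integral => x _; rewrite -/f -(fineK (f_fin x)) -EFinM /G.
  by rewrite /u powRM ?normc_ge0 ?powR_ge0// mulrA.
transitivity (\int[mu2]_x G x)%E; last by [].
rewrite GE -!integral_mkcond; apply: eq_measure_integral => A mA AD.
by change (mu2 (A `&` D) = mu2 A); rewrite setIidl.
Qed.

End density.

(** * Charts *)

Section charts.
Context (R : realType) (p q : R) (p1 : 1 <= p) (q1 : 1 <= q).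
Context (d1 d2 : measure_display) (Om1 : measurableType d1) (Om2 : measurableType d2).
Variables (mu1 : {measure set Om1 -> \bar R}) (mu2 : {measure set Om2 -> \bar R}).
Variable j : {linear cLspace mu2 q1 -> cLspace mu1 p1}.
Hypotheses (j_lat : lattice_homomorphism j) (j_inj : injective j) (pq : p <> q).
Local Notation cl f := (cls mu2 q1 f).
Implicit Types (E : Om2 -> R) (u : cLspace mu2 q1).

Let p0 : 0 < p. Proof. exact: lt_le_trans ltr01 p1. Qed.
Let q0 : 0 < q. Proof. exact: lt_le_trans ltr01 q1. Qed.
Let qp : q - p != 0. Proof. by rewrite subr_eq0; apply/eqP => h; apply: pq. Qed.

(** The weight E carries both norms of a function v E to one measure m with
    density E^q: the norm in L^q becomes the L^q(m)-norm of v, and the norm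
    of the image under j becomes its L^p(m)-norm (elt_nm, elt_np). This
    fixes the exponent q - p. *)
Definition chart E := [/\ measurable_fun setT E, forall x, 0 <= E x &
  forall g, g \in cLfun mu2 q -> (forall x, E x = 0 -> g x = 0) ->
  (nm (j (cl g)) `^ p)%:E = (\int[mu2]_x (normc (g x) `^ p * E x `^ (q - p))%:E)%E].

Definition extends E E' := forall x, E x != 0 -> E' x = E x.

Lemma cmeasurableM (h : Om2 -> R) (f : Om2 -> R[i]) : measurable_fun setT h ->
  cmeasurable f -> cmeasurable (fun x => (h x)%:C * f x).
Proof.
move=> mh [mr mi]; split.
  rewrite (_ : (fun _ => _) = (fun x => h x * complex.Re (f x))).
    exact: measurable_funM.
  by apply/funext => x; case: (f x) => a b /=; rewrite mul0r subr0.
rewrite (_ : (fun _ => _) = (fun x => h x * complex.Im (f x))).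
  exact: measurable_funM.
by apply/funext => x; case: (f x) => a b /=; rewrite mul0r addr0.
Qed.

Lemma measurable_ne0 (h : Om2 -> R) : measurable_fun setT h ->
  measurable [set x | h x != 0].
Proof.
move=> mh; rewrite (_ : [set x | _] = ~` (h @^-1` [set 0])).
  by apply: measurableC; rewrite -[X in measurable X]setTI; exact: mh.
by apply/seteqP; split => x /=; [move/eqP|move/eqP].
Qed.

Lemma cLfun_cut (A : set Om2) (g : Om2 -> R[i]) : measurable A -> g \in cLfun mu2 q ->
  (fun x => (\1_A x)%:C * g x) \in cLfun mu2 q.
Proof.
move=> mA gq; apply: (cLfun_dom q1 _ gq).
  by apply: cmeasurableM; [exact: measurable_indic|exact: cLfun_meas gq].
move=> x; rewrite normcM normc_real indicE.
by case: (_ \in _); rewrite ?normr1 ?mul1r// normr0 mul0r normc_ge0.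
Qed.

Lemma chart0 : chart (fun=> 0).
Proof.
split=> // g gq g0; rewrite (_ : g = fun=> 0); last by apply/funext => x; exact: g0.
rewrite cls0 linear0 nm0 powR0 ?gt_eqF//; apply/esym; apply: integral0_eq => x _.
by rewrite normc0 (powR0 (lt0r_neq0 p0)) mul0r.
Qed.

(** The density W of image_density for the part of u outside the support of
    E is turned into a new piece of weight W^(1/(q-p)), which is where p <>
    q enters. Injectivity of j makes W positive almost everywhere on that
    part. *)
Lemma chart_glue E u : chart E -> exists E', [/\ chart E', extends E E' &
  exists f, [/\ f \in cLfun mu2 q, u = cl f & forall x, E' x = 0 -> f x = 0]].
Proof.
move=> [mE E0 chE]; pose f : Om2 -> R[i] := repr u.
have fq : f \in cLfun mu2 q by exact: cLfunP.
pose Z := ~` [set x | E x != 0].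
have mZ : measurable Z by apply: measurableC; exact: measurable_ne0.
have ZE x : (\1_Z x : R) = (E x == 0)%:R.
  rewrite indicE; congr (nat_of_bool _)%:R; apply/idP/idP.
    by move=> /set_mem /negP; rewrite negbK.
  by move=> h; apply/mem_set => /negP; exact.
pose e x := \1_Z x * normc (f x).
have me : measurable_fun setT e.
  by apply: measurable_funM; [exact: measurable_indic|apply: measurable_normc; exact: cLfun_meas fq].
have e0 x : 0 <= e x by rewrite mulr_ge0 ?normc_ge0.
have eq' : (fun x => (e x)%:C) \in cLfun mu2 q.
  rewrite (_ : (fun _ => _) = (fun x => (\1_Z x)%:C * absf f x)).
    by apply: cLfun_cut => //; exact: absf_cLfun.
  by apply/funext => x; rewrite /e rmorphM.
have [W [mW W0 WE]] := image_density j_lat me e0 eq'.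
pose P := ~` [set x | W x != 0].
have mP : measurable P by apply: measurableC; exact: measurable_ne0.
have nullN : {ae mu2, forall x, e x != 0 -> W x != 0}.
  pose g x := (\1_P x)%:C * (e x)%:C.
  have gq : g \in cLfun mu2 q by exact: cLfun_cut.
  have : cl g = cl (fun=> 0).
    rewrite cls0; apply: j_inj; rewrite linear0; apply: nm_eq0.
    have : (nm (j (cl g)) `^ p)%:E = 0%E.
      rewrite WE//; last by move=> x ex; rewrite /g ex mulr0.
      apply: integral0_eq => x _; rewrite /g indicE.
      case: (boolP (x \in P)) => [/set_mem/negP|_].
        by rewrite negbK => /eqP ->; rewrite mulr0.
      by rewrite mul0r normc0 powR0 ?gt_eqF// mul0r.
    by case=> /powR_eq0_eq0.
  move=> /(cls_ae q1 gq (cLfun0 mu2 q1)); apply: filterS => x /= h ex.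
  apply/negP => /eqP Wx; have := h I; rewrite /g indicE mem_set; last first.
    by move=> /=; rewrite Wx eqxx.
  by rewrite mul1r => -[] /eqP; rewrite (negbTE ex).
(* W1 is W made positive everywhere; W1 = W almost everywhere where e != 0. *)
pose W1 x := W x + \1_P x.
have mW1 : measurable_fun setT W1 by apply: measurable_funD => //; exact: measurable_indic.
have W1gt x : 0 < W1 x.
  rewrite /W1 indicE; case: (boolP (x \in P)) => xP; first by rewrite ltr_wpDl.
  rewrite addr0 lt_neqAle W0 andbT eq_sym; apply/negP => /eqP Wx.
  by move/negP: xP; apply; apply/mem_set => /negP; rewrite Wx eqxx.
pose E' x := E x + \1_[set x | e x != 0] x * W1 x `^ (q - p)^-1.
have ee x : (\1_[set x | e x != 0] x : R) = (e x != 0)%:R.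
  rewrite indicE; congr (nat_of_bool _)%:R; apply/idP/idP; first by move=> /set_mem.
  by move=> h; apply/mem_set.
have e_E x : E x != 0 -> e x = 0.
  by move=> Ex; rewrite /e ZE (negbTE Ex) mul0r.
have E'_0 x : E' x = 0 -> E x = 0 /\ e x = 0.
  rewrite /E' ee => /eqP; rewrite paddr_eq0 ?mulr_ge0 ?powR_ge0//.
  move=> /andP[/eqP -> +]; case: (eqVneq (e x) 0) => [->//|_].
  by rewrite mul1r => /eqP/powR_eq0_eq0 h; have := W1gt x; rewrite h ltxx.
have ext : extends E E' by move=> x Ex; rewrite /E' ee e_E// eqxx mul0r addr0.
exists E'; split => //; last first.
  exists f; split => //; first by rewrite cls_repr.
  move=> x /E'_0 [Ex]; rewrite /e ZE Ex eqxx mul1r; exact: eq0_normc.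
split.
- apply: measurable_funD => //; apply: measurable_funM.
    by apply: measurable_indic; exact: measurable_ne0.
  exact: (@measurableT_comp _ _ _ _ _ _ (fun x : R => x `^ (q - p)^-1)).
- by move=> x; rewrite /E' addr_ge0// mulr_ge0// powR_ge0.
move=> g gq g0.
pose g1 x := (\1_(~` Z) x)%:C * g x; pose g2 x := (\1_Z x)%:C * g x.
have ZC x : (\1_(~` Z) x : R) = (E x != 0)%:R.
  rewrite /Z setCK indicE; congr (nat_of_bool _)%:R; apply/idP/idP; first by move=> /set_mem.
  by move=> h; apply/mem_set.
have g1q : g1 \in cLfun mu2 q by apply: cLfun_cut => //; exact: measurableC.
have g2q : g2 \in cLfun mu2 q by exact: cLfun_cut.
have gE : g = fun x => g1 x + g2 x.
  apply/funext => x; rewrite /g1 /g2 ZE ZC.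
  by case: (E x == 0); rewrite ?mul1r ?mul0r ?addr0 ?add0r.
rewrite gE clsD// (j_disjoint j_lat)//; last first.
  move=> x; rewrite /g1 /g2 ZE ZC.
  by case: (E x == 0); [left|right]; rewrite mul0r.
rewrite EFinD chE//; last by move=> x Ex; rewrite /g1 ZC Ex eqxx mul0r.
have g2_0 x : e x = 0 -> g2 x = 0.
  rewrite /g2 ZE; have [Ex|Ex] := eqVneq (E x) 0; last by rewrite mul0r.
  move=> ex; rewrite mul1r; apply: g0.
  by rewrite /E' ee ex Ex eqxx mul0r addr0.
rewrite WE// -ge0_integralD//; first last.
- apply/measurable_EFinP; apply: measurable_funM => //.
  by apply: measurable_normcp; exact: cLfun_meas g2q.
- by move=> x _; rewrite lee_fin mulr_ge0 ?powR_ge0.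
- apply/measurable_EFinP; apply: measurable_funM.
    by apply: measurable_normcp; exact: cLfun_meas g1q.
  exact: (@measurableT_comp _ _ _ _ _ _ (fun x : R => x `^ (q - p))).
- by move=> x _; rewrite lee_fin mulr_ge0 ?powR_ge0.
have mE' : measurable_fun setT E'.
  apply: measurable_funD => //; apply: measurable_funM.
    by apply: measurable_indic; exact: measurable_ne0.
  exact: (@measurableT_comp _ _ _ _ _ _ (fun x : R => x `^ (q - p)^-1)).
apply: ae_eq_integral => //.
- apply/measurable_EFinP; apply: measurable_funD; apply: measurable_funM => //.
  + by apply: measurable_normcp; exact: cLfun_meas g1q.
  + exact: (@measurableT_comp _ _ _ _ _ _ (fun x : R => x `^ (q - p))).
  + by apply: measurable_normcp; exact: cLfun_meas g2q.
- apply/measurable_EFinP; apply: measurable_funM => //.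
  + by apply: measurable_normcp; apply: cmeasurableD; [exact: cLfun_meas g1q|exact: cLfun_meas g2q].
  + exact: (@measurableT_comp _ _ _ _ _ _ (fun x : R => x `^ (q - p))).
apply: filterS nullN => x hW _; rewrite -EFinD; congr EFin.
have z0 : (0 : R) `^ p = 0 by rewrite powR0 ?gt_eqF.
have [Ex|Ex] := eqVneq (E x) 0; last first.
  have -> : g2 x = 0 by rewrite /g2 ZE (negbTE Ex) mul0r.
  by rewrite normc0 z0 mul0r !addr0 ext.
have -> : g1 x = 0 by rewrite /g1 ZC Ex eqxx mul0r.
rewrite normc0 z0 mul0r !add0r.
have [ex|ex] := eqVneq (e x) 0; first by rewrite g2_0// normc0 z0 !mul0r.
have Wx := hW ex; congr (_ * _).
rewrite /E' ee ex Ex add0r mul1r -powRrM mulVf// powRr1 ?(ltW (W1gt x))//.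
by rewrite /W1 indicE memNset ?addr0//= => /negP; rewrite negbK (negbTE Wx).
Qed.

End charts.

(** * Integrals against a weight *)

Section weighted_integral.
Context d (Om : measurableType d) (R : realType).
Variables (mu : {measure set Om -> \bar R}) (w : Om -> R).
Hypotheses (mw : measurable_fun setT w) (w0 : forall x, 0 <= w x).
Implicit Types (f g : Om -> R) (a b c : R).

(** Relational, and with a real value: finiteness and measurability come
    with the relation, so that weighted integrals can be added, scaled and
    compared as real numbers. *)
Definition hasI f a := [/\ measurable_fun setT f, forall x, 0 <= f x &
  (\int[mu]_x (f x * w x)%:E)%E = a%:E].

Lemma hasI_ge0 f a : hasI f a -> 0 <= a.
Proof.
move=> [_ f0 fa]; rewrite -lee_fin -fa; apply: integral_ge0 => x _.
by rewrite lee_fin mulr_ge0.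
Qed.

Let mfw f : measurable_fun setT f -> measurable_fun setT (fun x => (f x * w x)%:E).
Proof. by move=> mf; apply/measurable_EFinP; exact: measurable_funM. Qed.

Lemma hasI0 : hasI (fun=> 0) 0.
Proof. by split => //; apply: integral0_eq => x _; rewrite mul0r. Qed.

Lemma hasI_D f g a b : hasI f a -> hasI g b -> hasI (fun x => f x + g x) (a + b).
Proof.
move=> [mf f0 fa] [mg g0 gb]; split; first exact: measurable_funD.
  by move=> x; exact: addr_ge0.
under eq_integral do rewrite mulrDl EFinD.
rewrite ge0_integralD//; first by rewrite fa gb.
- by move=> x _; rewrite lee_fin mulr_ge0.
- exact: mfw.
- by move=> x _; rewrite lee_fin mulr_ge0.
- exact: mfw.
Qed.

Lemma hasI_Z c f a : 0 <= c -> hasI f a -> hasI (fun x => c * f x) (c * a).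
Proof.
move=> c0 [mf f0 fa]; split; first exact: measurable_funM.
  by move=> x; exact: mulr_ge0.
under eq_integral do rewrite -mulrA EFinM.
rewrite ge0_integralZl//; first by rewrite fa.
- exact: mfw.
- by move=> x _; rewrite lee_fin mulr_ge0.
Qed.

Lemma hasI_sum (I : Type) (r : seq I) (f : I -> Om -> R) (a : I -> R) :
  (forall i, hasI (f i) (a i)) -> hasI (fun x => \sum_(i <- r) f i x) (\sum_(i <- r) a i).
Proof.
move=> fa; elim: r => [|i r ih].
  rewrite (_ : (fun x => _) = (fun=> 0)); first by rewrite big_nil; exact: hasI0.
  by apply/funext => x; rewrite big_nil.
rewrite big_cons (_ : (fun x => _) = (fun x => f i x + \sum_(k <- r) f k x)).
  exact: hasI_D.
by apply/funext => x; rewrite big_cons.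
Qed.

Lemma hasI_le_ae f g a b : hasI f a -> hasI g b ->
  {ae mu, forall x, f x <= g x} -> a <= b.
Proof.
move=> [mf f0 fa] [mg g0 gb] fg; rewrite -lee_fin -fa -gb.
apply: ae_ge0_le_integral => //.
- by move=> x _; rewrite lee_fin mulr_ge0.
- exact: mfw.
- by move=> x _; rewrite lee_fin mulr_ge0.
- exact: mfw.
- by apply: filterS fg => x fg _; rewrite lee_fin ler_wpM2r.
Qed.

(** The pointwise inequalities of the sequel are integrated through this
    lemma. *)
Lemma hasI_le f g a b : hasI f a -> hasI g b -> (forall x, f x <= g x) -> a <= b.
Proof. by move=> fa gb fg; apply: hasI_le_ae fa gb _; exact: aeW. Qed.

Lemma hasI_dom f g b : measurable_fun setT f -> (forall x, 0 <= f x) -> hasI g b ->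
  (forall x, f x <= g x) -> exists2 a, hasI f a & a <= b.
Proof.
move=> mf f0 gb fg; have [mg g0 gE] := gb.
have le : (\int[mu]_x (f x * w x)%:E <= \int[mu]_x (g x * w x)%:E)%E.
  apply: ge0_le_integral => //.
  - by move=> x _; rewrite lee_fin mulr_ge0.
  - exact: mfw.
  - exact: mfw.
  - by move=> x _; rewrite lee_fin ler_wpM2r.
have ge : (0 <= \int[mu]_x (f x * w x)%:E)%E.
  by apply: integral_ge0 => x _; rewrite lee_fin mulr_ge0.
have fin : (\int[mu]_x (f x * w x)%:E)%E \is a fin_num.
  by rewrite ge0_fin_numE// (le_lt_trans le)// gE ltry.
exists (fine (\int[mu]_x (f x * w x)%:E)%E).
  by split => //; rewrite fineK.
by rewrite -lee_fin fineK// -gE.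
Qed.

Lemma hasI_cut A f a : measurable A -> hasI f a ->
  exists2 b, hasI (fun x => f x * \1_A x) b & b <= a.
Proof.
move=> mA fa; have [mf f0 _] := fa; apply: (hasI_dom _ _ fa).
- by apply: measurable_funM => //; exact: measurable_indic.
- by move=> x; exact: mulr_ge0.
- by move=> x; rewrite indicE; case: (_ \in _); rewrite ?mulr1// mulr0.
Qed.

Lemma hasI_uniq f a b : hasI f a -> hasI f b -> a = b.
Proof. by move=> [_ _ fa] [_ _]; rewrite fa => -[]. Qed.

End weighted_integral.

(** * Coordinates in a chart *)

Section coordinates.
Context (R : realType) (p q : R) (p1 : 1 <= p) (q1 : 1 <= q).
Context (d1 d2 : measure_display) (Om1 : measurableType d1) (Om2 : measurableType d2).
Variables (mu1 : {measure set Om1 -> \bar R}) (mu2 : {measure set Om2 -> \bar R}).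
Variable j : {linear cLspace mu2 q1 -> cLspace mu1 p1}.
Hypotheses (j_lat : lattice_homomorphism j) (j_inj : injective j) (pq : p <> q).
Implicit Types (E : Om2 -> R) (u : cLspace mu2 q1) (v : Om2 -> R[i]).

Let p0 : 0 < p. Proof. exact: lt_le_trans ltr01 p1. Qed.
Let q0 : 0 < q. Proof. exact: lt_le_trans ltr01 q1. Qed.

(** Coordinates are normalized to vanish where E does; extending the chart
    then changes neither v nor elt E v. *)
Definition fits E v := [/\ cmeasurable v, forall x, E x = 0 -> v x = 0 &
  (fun x => (E x)%:C * v x) \in cLfun mu2 q].

Definition elt E v := cls mu2 q1 (fun x => (E x)%:C * v x).

Local Notation chart := (chart j).
Local Notation wt E := (fun x => E x `^ q).

Lemma measurable_powRl (h : Om2 -> R) (s : R) : measurable_fun setT h ->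
  measurable_fun setT (fun x => h x `^ s).
Proof. by move=> mh; exact: (@measurableT_comp _ _ _ _ _ _ (fun x : R => x `^ s)). Qed.

Lemma wt_meas E : chart E -> measurable_fun setT (wt E).
Proof. by move=> [mE _ _]; exact: measurable_powRl. Qed.

Lemma elt_nm E v : chart E -> fits E v ->
  hasI mu2 (wt E) (fun x => normc (v x) `^ q) (nm (elt E v) `^ q).
Proof.
move=> [mE E0 _] [mv v0 vq]; split; [exact: measurable_normcp|by move=> x; exact: powR_ge0|].
rewrite nm_cls//; apply: eq_integral => x _.
by rewrite normcM normc_real ger0_norm// powRM ?normc_ge0// mulrC.
Qed.

Lemma elt_np E v : chart E -> fits E v ->
  hasI mu2 (wt E) (fun x => normc (v x) `^ p) (nm (j (elt E v)) `^ p).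
Proof.
move=> [mE E0 chE] [mv v0 vq]; split; [exact: measurable_normcp|by move=> x; exact: powR_ge0|].
have -> := chE _ vq; last by move=> x Ex; rewrite Ex mul0r.
apply: eq_integral => x _.
rewrite normcM normc_real ger0_norm// powRM ?normc_ge0//.
have [Ex|Ex] := eqVneq (E x) 0.
  by rewrite Ex v0// normc0 (powR0 (lt0r_neq0 p0)) mulr0 !mul0r.
rewrite mulrAC -powRD ?subrKC//; first by rewrite mulrC.
by apply/implyP => _.
Qed.

Lemma fitsD E v v' : fits E v -> fits E v' -> fits E (fun x => v x + v' x).
Proof.
move=> [mv v0 vq] [mv' v0' vq']; split; first exact: cmeasurableD.
  by move=> x Ex; rewrite v0// v0'// addr0.
rewrite (_ : (fun x => _) = (fun x => (E x)%:C * v x + (E x)%:C * v' x)).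
  exact: (cLfunD q1).
by apply/funext => x; rewrite mulrDr.
Qed.

Lemma fits_dom E v v' c : chart E -> fits E v -> cmeasurable v' ->
  (forall x, normc (v' x) <= c * normc (v x)) -> fits E v'.
Proof.
move=> [mE E0 _] [mv v0 vq] mv' le; split => //.
  move=> x Ex; apply: eq0_normc; apply: le_anti.
  by rewrite normc_ge0 andbT (le_trans (le x))// v0// normc0 mulr0.
apply: (cLfun_dom q1 (g := fun x => c%:C * ((E x)%:C * v x))).
- exact: cmeasurableM.
- exact: (cLfunZ q1).
- move=> x; rewrite !normcM mulrCA !normc_real ler_wpM2l//.
  by rewrite (le_trans (le x))// ler_wpM2r ?normc_ge0// ler_norm.
Qed.

Lemma fitsZ E v c : chart E -> fits E v -> fits E (fun x => c * v x).
Proof.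
move=> chE vE; have [mv _ _] := vE; apply: (fits_dom (c := normc c) chE vE).
  by have := cmeasurableZ c mv.
by move=> x; rewrite normcM.
Qed.

Lemma fits_cut E A v : chart E -> fits E v -> measurable A ->
  fits E (fun x => (\1_A x)%:C * v x).
Proof.
move=> chE vE mA; have [mv _ _] := vE; apply: (fits_dom (c := 1) chE vE).
  by apply: cmeasurableM => //; exact: measurable_indic.
move=> x; rewrite normcM normc_real indicE.
by case: (_ \in _); rewrite ?normr1// normr0 mul0r mul1r normc_ge0.
Qed.

Lemma eltD E v v' : fits E v -> fits E v' ->
  elt E (fun x => v x + v' x) = elt E v + elt E v'.
Proof.
move=> [_ _ vq] [_ _ vq']; rewrite /elt -clsD//; congr cls.
by apply/funext => x; rewrite mulrDr.
Qed.

Lemma eltZ E v c : fits E v -> elt E (fun x => c * v x) = c *: elt E v.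
Proof.
move=> [_ _ vq]; rewrite /elt -clsZ//; congr cls.
by apply/funext => x; rewrite mulrCA.
Qed.

Lemma fitsB E v v' : chart E -> fits E v -> fits E v' -> fits E (fun x => v x - v' x).
Proof.
move=> chE vE vE'; rewrite (_ : (fun x => _) = (fun x => v x + -1 * v' x)).
  by apply: fitsD => //; exact: fitsZ.
by apply/funext => x; rewrite mulN1r.
Qed.

Lemma eltB E v v' : chart E -> fits E v -> fits E v' ->
  elt E (fun x => v x - v' x) = elt E v - elt E v'.
Proof.
move=> chE vE vE'; rewrite -scaleN1r -eltZ// -eltD//; last exact: fitsZ.
by congr elt; apply/funext => x; rewrite mulN1r.
Qed.

Lemma fits0 E : fits E (fun=> 0).
Proof.
split => //.
by rewrite (_ : (fun x => _) = fun=> 0) ?(cLfun0 mu2 q1)//; apply/funext => x; rewrite mulr0.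
Qed.

Lemma elt0 E : elt E (fun=> 0) = 0.
Proof.
by rewrite /elt (_ : (fun x => _) = fun=> 0) ?(cls0 mu2 q1)//; apply/funext => x; rewrite mulr0.
Qed.

Lemma fits_sum E (I : Type) (r : seq I) (v_ : I -> Om2 -> R[i]) : chart E ->
  (forall i, fits E (v_ i)) -> fits E (fun x => \sum_(i <- r) v_ i x) /\
  elt E (fun x => \sum_(i <- r) v_ i x) = \sum_(i <- r) elt E (v_ i).
Proof.
move=> chE vE; elim: r => [|i r [ih ihE]].
  rewrite (_ : (fun x => _) = (fun=> 0)); last by apply/funext => x; rewrite big_nil.
  by rewrite big_nil elt0; split => //; exact: fits0.
rewrite (_ : (fun x => _) = (fun x => v_ i x + \sum_(k <- r) v_ k x)); last first.
  by apply/funext => x; rewrite big_cons.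
by rewrite eltD// ihE big_cons; split => //; exact: fitsD.
Qed.

(** E and E' differ only where E, hence v, vanishes. *)
Lemma fits_extend E E' v : extends E E' -> fits E v ->
  fits E' v /\ elt E' v = elt E v.
Proof.
move=> ext [mv v0 vq].
have eqE : (fun x => (E' x)%:C * v x) = (fun x => (E x)%:C * v x).
  apply/funext => x; have [Ex|Ex] := eqVneq (E x) 0; last by rewrite ext.
  by rewrite v0// !mulr0.
split; last by rewrite /elt eqE.
split => //; last by rewrite eqE.
move=> x Ex'; have [Ex|Ex] := eqVneq (E x) 0; first exact: v0.
by have /esym/eqP := ext x Ex; rewrite Ex' (negbTE Ex).
Qed.

Lemma hasI_extend E E' f a : extends E E' -> (forall x, E x = 0 -> f x = 0) ->
  hasI mu2 (wt E') f a <-> hasI mu2 (wt E) f a.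
Proof.
move=> ext f0.
have wE x : f x * E' x `^ q = f x * E x `^ q.
  have [Ex|Ex] := eqVneq (E x) 0; first by rewrite f0// !mul0r.
  by rewrite (ext x Ex).
split => -[mf fge fa]; (split; [exact: mf|exact: fge|apply: etrans fa]);
  by apply: eq_integral => x _; rewrite wE.
Qed.

Lemma chart_coord E u : chart E -> exists E' v,
  [/\ chart E', extends E E', fits E' v & u = elt E' v].
Proof.
move=> chE; have [E' [chE' ext [f [fq -> f0]]]] := chart_glue j_lat j_inj pq u chE.
have [mE' E'0 _] := chE'.
(* f / E', with value 0 where E' = 0. *)
exists E', (fun x => (E' x `^ (-1))%:C * f x).
have fE : f = (fun x => (E' x)%:C * ((E' x `^ (-1))%:C * f x)).
  apply/funext => x; have [Ex|Ex] := eqVneq (E' x) 0.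
    by rewrite f0// !mulr0.
  by rewrite mulrA -rmorphM powR_inv1// divff// mul1r.
split => //; last by rewrite /elt -fE.
split; last by rewrite -fE.
- by apply: cmeasurableM; [exact: measurable_powRl|exact: cLfun_meas fq].
- by move=> x Ex; rewrite f0// mulr0.
Qed.

(** The chart is extended by one element at a time, the coordinates found
    before remaining valid. *)
Lemma chart_seq (u_ : nat -> cLspace mu2 q1) n : exists E (v_ : nat -> Om2 -> R[i]),
  chart E /\ forall i, (i < n)%N -> fits E (v_ i) /\ u_ i = elt E (v_ i).
Proof.
elim: n => [|n [E [v_ [chE vE]]]].
  by exists (fun=> 0), (fun _ _ => 0); split => //; exact: chart0.
have [E' [v [chE' ext vE' un]]] := chart_coord (u_ n) chE.
exists E', (fun i => if i == n then v else v_ i); split => // i.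
rewrite ltnS leq_eqVlt; case: eqP => [-> _|_ /= /vE[iE ->]]; first by split.
by have [? ->] := fits_extend ext iE.
Qed.

End coordinates.

(** * Inequalities for real powers *)

Section real_powers.
Context (R : realType).
Implicit Types (a b s r x y t e : R).

Lemma powR_mulB1 x r : 0 <= x -> 0 < r -> x `^ (r - 1) * x = x `^ r.
Proof. by move=> x0 r0; rewrite mulrC mulr_powRB1. Qed.

Lemma powRDp x r t : 0 < x -> x `^ (r + t) = x `^ r * x `^ t.
Proof. by move=> x0; rewrite powRD// (lt0r_neq0 x0) implybT. Qed.

Lemma powR_le x y r : 0 <= x -> x <= y -> 0 <= r -> x `^ r <= y `^ r.
Proof.
move=> x0 xy r0; apply: ge0_ler_powR => //; rewrite nnegrE//.
exact: le_trans xy.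
Qed.

Lemma powR_lt x y r : 0 <= x -> x < y -> 0 < r -> x `^ r < y `^ r.
Proof.
move=> x0 xy r0; apply: gt0_ltr_powR => //; rewrite nnegrE//.
by rewrite ltW// (le_lt_trans x0).
Qed.

Lemma powRVK x r : 0 <= x -> r != 0 -> (x `^ r^-1) `^ r = x.
Proof. by move=> x0 r0; rewrite -powRrM mulVf// powRr1. Qed.

(** Convexity; this inequality stands in for differentiation below. *)
Lemma tangent_powR r x y : 1 < r -> 0 <= x -> 0 <= y ->
  x `^ r + r * x `^ (r - 1) * (y - x) <= y `^ r.
Proof.
move=> r1 x0 y0; have r0 : 0 < r by rewrite (lt_trans ltr01).
have rn0 := lt0r_neq0 r0.
have rB : 0 < r - 1 by rewrite subr_gt0.
have rB0 := lt0r_neq0 rB.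
have := @conjugate_powR R (x `^ (r - 1)) y (r / (r - 1)) r (powR_ge0 _ _) y0
  (divr_gt0 r0 rB) r0.
rewrite invf_div -[X in _ + X]mul1r -mulrDl subrK divff// => /(_ erefl).
rewrite -powRrM (_ : (r - 1) * (r / (r - 1)) = r); last by field.
rewrite -(ler_pM2l r0) mulrDr.
rewrite (_ : r * (x `^ r * ((r - 1) / r)) = (r - 1) * x `^ r); last by field.
rewrite (_ : r * (y `^ r / r) = y `^ r); last by field.
move=> h; rewrite mulrBr -[r * _ * x]mulrA powR_mulB1//.
rewrite -subr_ge0; rewrite -subr_ge0 in h; apply: le_trans h _.
rewrite le_eqVlt; apply/orP; left; apply/eqP; ring.
Qed.

(** Young inequality with a small factor in front of one of the two powers;
    the two cases compare a and b up to a constant. *)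
Lemma young_small r t : 1 < r -> 0 < t -> exists2 C : R, 0 <= C &
  forall a b : R, 0 <= a -> 0 <= b -> a `^ (r - 1) * b <= C * a `^ r + t * b `^ r.
Proof.
move=> r1 t0; have r0 : 0 < r by rewrite (lt_trans ltr01).
have rB : 0 < r - 1 by rewrite subr_gt0.
have rB0 := lt0r_neq0 rB.
exists (t^-1 `^ (r - 1)^-1); first exact: powR_ge0.
move=> a b a0 b0; have [le|lt] := leP (a `^ (r - 1)) (t * b `^ (r - 1)).
  have := ler_wpM2r b0 le; rewrite -mulrA powR_mulB1// => h.
  by rewrite (le_trans h)// lerDr mulr_ge0// powR_ge0.
have h : b <= t^-1 `^ (r - 1)^-1 * a.
  rewrite leNgt; apply/negP => /(fun h => powR_lt _ h rB).
  rewrite powRM// ?powR_ge0// powRVK// ?invr_ge0 ?(ltW t0)// mulr_ge0 ?powR_ge0// => /(_ isT).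
  by rewrite ltr_pdivrMl// => /(lt_trans lt); rewrite ltxx.
apply: (@le_trans _ _ (t^-1 `^ (r - 1)^-1 * a `^ r)).
  by rewrite -(powR_mulB1 a0 r0) mulrCA; apply: ler_wpM2l => //; exact: powR_ge0.
by rewrite lerDl mulr_ge0 ?powR_ge0// ltW.
Qed.

Lemma interp_small p q t : 1 < p -> p < q -> 0 < t -> exists2 C : R, 0 <= C &
  forall x, 0 <= x -> x `^ p <= t * x `^ q + C * x.
Proof.
move=> p1 pq t0; have p0 : 0 < p by rewrite (lt_trans ltr01).
have qp : 0 < q - p by rewrite subr_gt0.
have q0 : 0 < q by rewrite (lt_trans p0).
pose S := t^-1 `^ (q - p)^-1.
exists (S `^ (p - 1)); first exact: powR_ge0.
move=> x x0; have [le|lt] := leP x S.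
  have := ler_wpM2r x0 (powR_le x0 le (_ : 0 <= p - 1)).
  rewrite powR_mulB1// subr_ge0 ltW// => /(_ isT) /le_trans -> //.
  by rewrite lerDr mulr_ge0 ?powR_ge0// ltW.
have := powR_lt (powR_ge0 _ _) lt qp.
rewrite powRVK ?lt0r_neq0 ?invr_ge0 ?(ltW t0)// -(ltr_pM2l t0) mulfV ?lt0r_neq0// => h.
have := ler_wpM2r (powR_ge0 x p) (ltW h).
rewrite mul1r -mulrA -powRD ?subrK; last by rewrite gt_eqF.
by move=> /le_trans -> //; rewrite lerDl mulr_ge0 ?powR_ge0.
Qed.

Lemma linear_le_powR e r x : 0 < e -> 1 <= r -> 0 <= x ->
  x <= e + e `^ (1 - r) * x `^ r.
Proof.
move=> e0 r1 x0; have [le|lt] := leP x e.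
  by rewrite (le_trans le)// lerDl mulr_ge0 ?powR_ge0.
have xgt : 0 < x by rewrite (lt_trans e0).
have h : e `^ (r - 1) <= x `^ (r - 1) by apply: powR_le; rewrite ?subr_ge0// ltW.
rewrite -opprB powRN; apply: (@le_trans _ _ ((e `^ (r - 1))^-1 * x `^ r)); last by rewrite lerDr ltW.
rewrite ler_pdivlMl ?powR_gt0//.
have := ler_wpM2r x0 h; rewrite powR_mulB1//; exact: lt_le_trans ltr01 r1.
Qed.

Lemma powR_add_le r x y : 0 <= r -> 0 <= x -> 0 <= y ->
  (x + y) `^ r <= 2 `^ r * (x `^ r + y `^ r).
Proof.
move=> r0; wlog xy : x y / x <= y => [h x0 y0|x0 y0].
  have [le|/ltW le] := leP x y; first exact: h.
  by rewrite addrC [X in _ * X]addrC; exact: h.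
apply: (@le_trans _ _ ((2 * y) `^ r)).
  by apply: powR_le => //; [exact: addr_ge0|lra].
by rewrite powRM// ler_wpM2l ?powR_ge0// lerDr powR_ge0.
Qed.

Lemma powR_continuous1 r e : 0 < e -> exists2 d : R, 0 < d &
  forall x : R, 0 <= x -> `|x - 1| <= d -> `|x `^ r - 1| <= e.
Proof.
move=> e0; have c : {for (1 : R), continuous (fun x : R => x `^ r)}.
  apply: differentiable_continuous; apply/derivable1_diffP.
  by apply: derivable_powR; rewrite in_itv/= ltr01.
move: c => /cvgrPdist_le /(_ _ e0); rewrite powR1 => /nbhs_ballP [d /= d0 dP].
exists (d / 2); first by rewrite divr_gt0.
move=> x x0 xd; rewrite distrC; apply: dP; rewrite /ball /= distrC.
by rewrite (le_lt_trans xd)// ltr_pdivrMr// ltr_pMr// ltr1n.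
Qed.

(** The numbers x and y stand for |z + w| / |z| and |z - w| / |z|, with r =
    |w| / |z|; the quadratic relation is the parallelogram identity. For
    small r the first-order terms cancel, as x + y - 2 <= r^2; for large r
    the power r^q dominates. *)
Lemma smooth_real q e : 1 < q -> 0 < e -> exists2 K : R, 0 <= K &
  forall x y r : R, 0 <= x -> 0 <= y -> `|x - 1| <= r -> `|y - 1| <= r ->
  x ^+ 2 + y ^+ 2 = 2 + 2 * r ^+ 2 -> x `^ q + y `^ q - 2 <= e * r + K * r `^ q.
Proof.
move=> q1 e0; have q0 : 0 < q by rewrite (lt_trans ltr01).
have e1 : 0 < e / (4 * q) by rewrite divr_gt0// mulr_gt0.
have [d d0 dP] := powR_continuous1 (q - 1) e1.
pose sg := Num.min d (e / (2 * q)).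
have sg0 : 0 < sg by rewrite lt_min d0 divr_gt0// mulr_gt0.
exists (2 * (sg^-1 + 1) `^ q); first by rewrite mulr_ge0 ?powR_ge0.
move=> x y r x0 y0 xr yr xy; have r0 : 0 <= r by exact: le_trans xr.
have [le|lt] := leP r sg.
  have [rd re] : r <= d /\ r <= e / (2 * q) by move: le; rewrite le_min => /andP.
  have one (z : R) : 0 <= z -> `|z - 1| <= r ->
      z `^ q <= 1 + q * (z - 1) + q * (e / (4 * q) * r).
    move=> z0 zr; have := tangent_powR q1 z0 ler01; rewrite powR1 -lerBrDr => /le_trans -> //.
    suff : (z `^ (q - 1) - 1) * (z - 1) <= e / (4 * q) * r.
      move=> /(ler_wpM2l (ltW q0)) h; apply: le_trans (_ : 1 + q * (z - 1) +
        q * ((z `^ (q - 1) - 1) * (z - 1)) <= _); last by rewrite lerD2l.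
      by rewrite le_eqVlt; apply/orP; left; apply/eqP; ring.
    apply: le_trans (ler_norm _) _; rewrite normrM.
    by apply: ler_pM => //; apply: dP => //; exact: le_trans rd.
  have xy2 : x + y - 2 <= r ^+ 2.
    rewrite lerBlDr -(@ler_pXn2r _ 2)// ?nnegrE ?addr_ge0 ?sqr_ge0//.
    have := sqr_ge0 (x - y); have := sqr_ge0 (r ^+ 2); nra.
  have r2 : q * r ^+ 2 <= e / 2 * r.
    rewrite expr2 mulrA ler_wpM2r//; move: re; rewrite ler_pdivlMr ?mulr_gt0//.
    lra.
  have K0 : 0 <= 2 * (sg^-1 + 1) `^ q * r `^ q by rewrite !mulr_ge0 ?powR_ge0.
  have := one x x0 xr; have := one y y0 yr.
  have -> : q * (e / (4 * q) * r) = e / 4 * r by field; exact: lt0r_neq0.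
  have := ler_wpM2l (ltW q0) xy2; move=> h1 h2 h3.
  lra.
have one (z : R) : 0 <= z -> `|z - 1| <= r -> z `^ q <= (sg^-1 + 1) `^ q * r `^ q.
  move=> z0 zr; rewrite -powRM//; last by rewrite addr_ge0 ?invr_ge0// ltW.
  apply: powR_le => //; last exact: ltW.
  have h : 1 <= sg^-1 * r by rewrite ler_pdivlMl// mulr1 ltW.
  by move: zr; rewrite ler_norml => /andP[_ zr]; rewrite mulrDl mul1r; lra.
have := one x x0 xr; have := one y y0 yr.
have er : 0 <= e * r by rewrite mulr_ge0// ltW.
by rewrite -mulrA; move=> a b; lra.
Qed.

Section gap.
Variable p : R.
Hypothesis p1 : 1 < p.
Let p0 : 0 < p. Proof. exact: lt_trans ltr01 p1. Qed.
Let pB : 0 < p - 1. Proof. by rewrite subr_gt0. Qed.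

Let phi s := s `^ p / p + (1 - p^-1) - s.

Let phi_incr x y : 0 <= x -> 0 <= y ->
  (x `^ (p - 1) - 1) * (y - x) <= phi y - phi x.
Proof.
move=> x0 y0; have := tangent_powR p1 x0 y0; rewrite /phi -(ler_pM2r (_ : 0 < p^-1)) ?invr_gt0//.
rewrite mulrDl (_ : p * _ * _ / p = x `^ (p - 1) * (y - x)); last by field; exact: lt0r_neq0.
by move=> h; lra.
Qed.

Let phi1 : phi 1 = 0.
Proof. by rewrite /phi powR1; lra. Qed.

Let phi_ge0 s : 0 <= s -> 0 <= phi s.
Proof. by move=> s0; have := phi_incr ler01 s0; rewrite phi1 powR1; lra. Qed.

Let powB_gt1 x : 1 < x -> 1 < x `^ (p - 1).
Proof. by move=> x1; have := powR_lt ler01 x1 pB; rewrite powR1. Qed.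

Let powB_lt1 x : 0 <= x -> x < 1 -> x `^ (p - 1) < 1.
Proof. by move=> x0 x1; have := powR_lt x0 x1 pB; rewrite powR1. Qed.

Let phi_gt0 s : 0 <= s -> s != 1 -> 0 < phi s.
Proof.
move=> s0 s1; pose m := (1 + s) / 2; have m0 : 0 <= m by rewrite /m; lra.
have := phi_incr m0 s0; have := phi_ge0 m0; rewrite /m in m0 *.
case: (ltgtP s 1) s1 => // lt _ h1 h2.
  have := powB_lt1 m0 (_ : (1 + s) / 2 < 1).
  by move=> /(_ ltac:(lra)) h3; nra.
have := powB_gt1 (_ : 1 < (1 + s) / 2).
by move=> /(_ ltac:(lra)) h3; nra.
Qed.

Let phi_away d : 0 < d -> exists2 k : R, 0 < k &
  forall s : R, 0 <= s -> d <= `|s - 1| -> k <= phi s.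
Proof.
move=> d0; have h1 : 0 < phi (1 + d) by apply: phi_gt0; [lra|apply/eqP; lra].
have right s : 1 + d <= s -> phi (1 + d) <= phi s.
  move=> le; have := @phi_incr (1 + d) s ltac:(lra) ltac:(lra).
  have := powB_gt1 (_ : 1 < 1 + d); move=> /(_ ltac:(lra)) h2 h3.
  have : 0 <= ((1 + d) `^ (p - 1) - 1) * (s - (1 + d)).
    by apply: mulr_ge0; lra.
  by lra.
have [dl|dg] := leP d 1; last first.
  exists (phi (1 + d)) => // s s0; rewrite ler_normr => /orP[h|h]; first by apply: right; lra.
  by lra.
have h2 : 0 < phi (1 - d) by apply: phi_gt0; [lra|apply/eqP; lra].
exists (Num.min (phi (1 + d)) (phi (1 - d))); first by rewrite lt_min h1.
move=> s s0; rewrite ler_normr => /orP[h|h]; rewrite ge_min.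
  by apply/orP; left; apply: right; lra.
apply/orP; right; have := @phi_incr (1 - d) s ltac:(lra) s0.
have := powB_lt1 (_ : 0 <= 1 - d); move=> /(_ ltac:(lra) ltac:(lra)) h3 h4.
have : 0 <= ((1 - d) `^ (p - 1) - 1) * (s - (1 - d)) by apply: mulr_le0; lra.
by lra.
Qed.

(** Away from s = 1 the defect is bounded below; for large s it is at least
    a multiple of s^p. *)
Let phi_coercive d : 0 < d -> exists2 k : R, 0 < k &
  forall s : R, 0 <= s -> d <= `|s - 1| -> k * (1 + s `^ p) <= phi s.
Proof.
move=> d0; have [k k0 kP] := phi_away d0.
pose S := (2 * p) `^ (p - 1)^-1.
have p2 : 0 < 2 * p by rewrite mulr_gt0.
have pv : p^-1 < 1 by rewrite invf_lt1.
have k1 : 0 < k / (1 + S `^ p) by rewrite divr_gt0// ltr_wpDr ?powR_ge0.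
have k2 : 0 < (2 * p)^-1 by rewrite invr_gt0.
have k3 : 0 < 1 - p^-1 by rewrite subr_gt0.
exists (Num.min (k / (1 + S `^ p)) (Num.min (2 * p)^-1 (1 - p^-1))).
  by rewrite !lt_min k1 k2.
set kk := Num.min _ _; move=> s s0 ds.
have kk1 : kk <= k / (1 + S `^ p) by rewrite ge_min lexx.
have kk2 : kk <= (2 * p)^-1 by rewrite /kk !ge_min lexx orbT.
have kk3 : kk <= 1 - p^-1 by rewrite /kk !ge_min lexx !orbT.
have sp := powR_ge0 s p.
have [le|lt] := leP s S.
  apply: le_trans (kP s s0 ds).
  apply: (@le_trans _ _ (k / (1 + S `^ p) * (1 + S `^ p))); last first.
    by rewrite divfK// lt0r_neq0// ltr_wpDr ?powR_ge0.
  apply: ler_pM => //; [by rewrite /kk !le_min !ltW|lra|].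
  by rewrite lerD2l powR_le// ltW.
have := powR_lt (powR_ge0 _ _) lt pB; rewrite powRVK ?lt0r_neq0 ?(ltW p2)// => h.
have := ler_wpM2r s0 (ltW h); rewrite powR_mulB1// => {}h.
have h' : s <= s `^ p / (2 * p) by rewrite ler_pdivlMr// mulrC.
have e : s `^ p / p = 2 * (s `^ p / (2 * p)) by field; exact: lt0r_neq0.
have := ler_wpM2r sp kk2; rewrite /phi e mulrDr mulr1 [_^-1 * _]mulrC; lra.
Qed.

(** The expression multiplied by C is the defect in Young inequality for z =
    1 and |w| = s, with r the real part of w and d = |z - w|. It vanishes
    only at w = 1, and for large s it is at least a multiple of s^p, so it
    controls d^p wherever w is not close to 1. *)
Lemma gap_real e : 0 < e -> exists2 C : R, 0 <= C &
  forall s r d : R, 0 <= s -> r <= s -> 0 <= d -> d <= 1 + s ->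
  d ^+ 2 = 1 - 2 * r + s ^+ 2 ->
  d `^ p <= e * (1 + s `^ p) + C * (s `^ p / p + (1 - p^-1) - r).
Proof.
move=> e0; pose dl := e `^ p^-1; have dl0 : 0 < dl by rewrite powR_gt0.
have [k k0 kP] := @phi_coercive (dl / 2) ltac:(lra).
pose B := 2 `^ p * (1 + (1 + dl / 2) `^ p).
have B0 : 0 <= B by rewrite mulr_ge0 ?powR_ge0// addr_ge0 ?powR_ge0.
have dl2 : 0 < 3 * dl ^+ 2 / 8 by rewrite divr_gt0// mulr_gt0// exprn_gt0.
exists (2 `^ p / k + B / (3 * dl ^+ 2 / 8)).
  by rewrite addr_ge0// divr_ge0 ?powR_ge0// ltW.
move=> s r d s0 rs d0 ds dE; set C1 := 2 `^ p / k; set C2 := B / _.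
have C10 : 0 <= C1 by rewrite divr_ge0 ?powR_ge0// ltW.
have C20 : 0 <= C2 by rewrite divr_ge0// ltW.
have gapE : s `^ p / p + (1 - p^-1) - r = phi s + (s - r) by rewrite /phi; lra.
have ph := phi_ge0 s0; have sp := powR_ge0 s p.
have gap0 : 0 <= phi s + (s - r) by rewrite addr_ge0// subr_ge0.
have dp : d `^ p <= 2 `^ p * (1 + s `^ p).
  apply: le_trans (powR_le d0 ds (ltW p0)) _.
  by have := powR_add_le (ltW p0) (@ler01 R) s0; rewrite powR1.
rewrite gapE; have e1 : 0 <= e * (1 + s `^ p) by rewrite mulr_ge0// ?addr_ge0// ltW.
have [le|lt] := leP d dl.
  have : d `^ p <= e.
    by have := powR_le d0 le (ltW p0); rewrite /dl powRVK// ?lt0r_neq0// ltW.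
  have : 0 <= (C1 + C2) * (phi s + (s - r)) by apply: mulr_ge0 => //; exact: addr_ge0.
  have : e <= e * (1 + s `^ p) by apply: ler_peMr; [exact: ltW|rewrite lerDl].
  by lra.
have [le|{}lt'] := leP (dl / 2) `|s - 1|.
  have := kP s s0 le; rewrite -ler_pdivlMl// => h.
  have : d `^ p <= C1 * phi s.
    apply: le_trans dp _; rewrite /C1 -mulrA ler_wpM2l ?powR_ge0//.
  have : 0 <= C1 * (s - r) by rewrite mulr_ge0// subr_ge0.
  have : 0 <= C2 * (phi s + (s - r)) by rewrite mulr_ge0.
  by rewrite mulrDl mulrDr; lra.
have sr : 3 * dl ^+ 2 / 8 <= s - r.
  have h1 : (s - 1) ^+ 2 <= (dl / 2) ^+ 2.
    have d2 : 0 <= dl / 2 by apply: divr_ge0; [exact: ltW|].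
    by rewrite -(@real_normK _ (s - 1)) ?num_real//; apply: lerXn2r;
      rewrite ?nnegrE// ltW.
  have h2 : dl ^+ 2 <= d ^+ 2 by rewrite lerXn2r ?nnegrE// ltW.
  have h3 : (dl / 2) ^+ 2 = dl ^+ 2 / 4 by field.
  have h4 : (s - 1) ^+ 2 = s ^+ 2 - 2 * s + 1 by ring.
  by lra.
have s1 : s <= 1 + dl / 2 by move: lt'; rewrite ltr_norml => /andP[_]; lra.
have : d `^ p <= C2 * (s - r).
  apply: (@le_trans _ _ B).
    apply: le_trans dp _; rewrite ler_wpM2l ?powR_ge0// lerD2l.
    by apply: powR_le => //; exact: ltW.
  by rewrite /C2 mulrAC ler_pdivlMr// ler_wpM2l.
have : 0 <= C2 * phi s by rewrite mulr_ge0.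
have : 0 <= C1 * (phi s + (s - r)) by rewrite mulr_ge0.
by rewrite mulrDl [C2 * (_ + _)]mulrDr; lra.
Qed.

End gap.
End real_powers.

(** * Inequalities for powers of complex moduli *)

Section complex_powers.
Context (R : realType).
Implicit Types (z w v : R[i]) (e t r : R).

Definition dotc z w : R := complex.Re z * complex.Re w + complex.Im z * complex.Im w.

(** The derivative at z, in the direction w, of z |-> |z|^r / r. *)
Definition lin r z w : R := normc z `^ (r - 2) * dotc z w.

Lemma normc_sq z : normc z ^+ 2 = complex.Re z ^+ 2 + complex.Im z ^+ 2.
Proof. by case: z => a b /=; rewrite sqr_sqrtr// addr_ge0// sqr_ge0. Qed.

Lemma normcD_sq z w : normc (z + w) ^+ 2 = normc z ^+ 2 + 2 * dotc z w + normc w ^+ 2.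
Proof. by rewrite !normc_sq /dotc; case: z w => a b [c d] /=; ring. Qed.

Lemma dotc_le z w : `|dotc z w| <= normc z * normc w.
Proof.
rewrite -(@ler_pXn2r _ 2)// ?nnegrE ?mulr_ge0 ?normc_ge0//.
rewrite real_normK ?num_real// exprMn !normc_sq /dotc.
set a := complex.Re z; set b := complex.Im z; set c := complex.Re w; set d := complex.Im w.
have := sqr_ge0 (a * d - b * c); rewrite -subr_ge0 => h; apply: le_trans h _.
by rewrite le_eqVlt; apply/orP; left; apply/eqP; ring.
Qed.

Lemma dotcZr z w (c : R) : dotc z (c%:C * w) = c * dotc z w.
Proof. by rewrite /dotc; case: z w => a b [d e] /=; ring. Qed.

Lemma dotcZl z w (c : R) : dotc (c%:C * z) w = c * dotc z w.
Proof. by rewrite /dotc; case: z w => a b [d e] /=; ring. Qed.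

Lemma linZr r z w (c : R) : lin r z (c%:C * w) = c * lin r z w.
Proof. by rewrite /lin dotcZr mulrCA. Qed.

Lemma dotcc z : dotc z z = normc z ^+ 2.
Proof. by rewrite normc_sq /dotc; ring. Qed.

Lemma dotcNr z w : dotc z (- w) = - dotc z w.
Proof. by rewrite /dotc; case: z w => a b [d e] /=; ring. Qed.

Lemma linNr r z w : lin r z (- w) = - lin r z w.
Proof. by rewrite /lin dotcNr mulrN. Qed.

Lemma powR_mulB2 (x r : R) : 0 < x -> x `^ (r - 2) * x ^+ 2 = x `^ r.
Proof.
by move=> x0; rewrite -powR_mulrn ?ltW// -powRDp// subrK.
Qed.

Lemma lin_le r z w : 1 < r -> `|lin r z w| <= normc z `^ (r - 1) * normc w.
Proof.
move=> r1; rewrite /lin normrM (ger0_norm (powR_ge0 _ _)).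
have [->|z0] := eqVneq z 0.
  by rewrite /dotc /= !mul0r addr0 normr0 mulr0 mulr_ge0 ?powR_ge0 ?normc_ge0.
have zgt := normc_gt0 z0.
apply: le_trans (ler_wpM2l (powR_ge0 _ _) (dotc_le z w)) _.
rewrite mulrA ler_wpM2r ?normc_ge0// -[X in _ * X](@powRr1 _ (normc z)) ?normc_ge0//.
by rewrite -powRDp// (_ : r - 2 + 1 = r - 1)//; lra.
Qed.

Lemma tangentc r z w : 1 < r ->
  normc z `^ r + r * lin r z w <= normc (z + w) `^ r.
Proof.
move=> r1; have r0 : 0 < r by rewrite (lt_trans ltr01).
have [->|z0] := eqVneq z 0.
  rewrite /lin /dotc /= !mul0r addr0 !mulr0 addr0 add0r expr0n addr0 sqrtr0.
  by rewrite powR0 ?lt0r_neq0// powR_ge0.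
have zgt := normc_gt0 z0.
apply: le_trans (tangent_powR r1 (normc_ge0 z) (normc_ge0 (z + w))).
rewrite lerD2l -mulrA ler_pM2l// /lin.
have -> : normc z `^ (r - 1) = normc z `^ (r - 2) * normc z.
  rewrite -[X in _ = _ * X](@powRr1 _ (normc z)) ?normc_ge0// -powRDp//.
  by rewrite (_ : r - 2 + 1 = r - 1)//; lra.
rewrite -mulrA ler_wpM2l ?powR_ge0// mulrBr -expr2 lerBrDl.
have := dotc_le z (z + w); rewrite ler_norml => /andP[_]; apply: le_trans.
by rewrite -dotcc /dotc; case: (z) (w) => a b [c d] /=; rewrite le_eqVlt; apply/orP; left; apply/eqP; ring.
Qed.

(** The pointwise form of uniform smoothness of L^q. *)
Lemma smoothc q e : 1 < q -> 0 < e -> exists2 t0 : R, 0 < t0 &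
  forall t z w, 0 <= t -> t <= t0 ->
  normc (z + t%:C * w) `^ q + normc (z - t%:C * w) `^ q <=
    2 * normc z `^ q + e * t * (normc z `^ q + normc w `^ q).
Proof.
move=> q1 e0; have q0 : 0 < q by rewrite (lt_trans ltr01).
have qB : 0 < q - 1 by rewrite subr_gt0.
have [K K0 KP] := smooth_real q1 (divr_gt0 e0 (@ltr0n R 2)).
pose c := e / (2 * (K + 1)).
have c0 : 0 < c by rewrite divr_gt0// mulr_gt0// ltr_wpDl.
exists (c `^ (q - 1)^-1); first by rewrite powR_gt0.
move=> t z w t0 tc.
have tq : t `^ (q - 1) <= c.
  by have := powR_le t0 tc (ltW qB); rewrite powRVK// ?lt0r_neq0// ltW.
have cE : c * (K + 1) = e / 2 by rewrite /c; field; rewrite lt0r_neq0// ltr_wpDl.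
have ctw : normc (t%:C * w) = t * normc w by rewrite normcM normc_real ger0_norm.
have wq := powR_ge0 (normc w) q; have zq := powR_ge0 (normc z) q.
have tqE : (t * normc w) `^ q = t * t `^ (q - 1) * normc w `^ q.
  by rewrite (powRM q t0 (normc_ge0 w)) -(powR_mulB1 t0 q0) (mulrC t).
have [->|z0] := eqVneq z 0.
  rewrite add0r sub0r normcN ctw normc0 powR0 ?lt0r_neq0// mulr0 !add0r tqE.
  have h : t `^ (q - 1) * 2 <= e.
    apply: le_trans (ler_wpM2r _ tq) _ => //.
    by have := ltW c0; nra.
  have := ler_wpM2l (mulr_ge0 t0 wq) h; lra.
have zgt := normc_gt0 z0.
set a := normc z in zgt zq *; set b := normc w in ctw wq tqE *.
have an := lt0r_neq0 zgt; have a0 := ltW zgt.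
have b0 : 0 <= b by exact: normc_ge0.
have x1 (y : R[i]) : normc y = t * b -> `|normc (z + y) / a - 1| <= t * b / a.
  move=> yE; rewrite -[X in _ - X](divff an) -mulrBl normrM.
  rewrite [X in _ * X]ger0_norm ?invr_ge0// ler_wpM2r ?invr_ge0//.
  rewrite -yE ler_norml; have := normcD z y; have := normcD (z + y) (- y).
  by rewrite addrK normcN -/a => h1 h2; apply/andP; split; lra.
have y1 := x1 (t%:C * w) ctw; have y2 := x1 (- (t%:C * w)) ltac:(by rewrite normcN).
have hx : 0 <= normc (z + t%:C * w) / a by rewrite divr_ge0 ?normc_ge0.
have hy : 0 <= normc (z - t%:C * w) / a by rewrite divr_ge0 ?normc_ge0.
have := KP _ _ _ hx hy y1 y2.
have sq : (normc (z + t%:C * w) / a) ^+ 2 + (normc (z - t%:C * w) / a) ^+ 2 =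
    2 + 2 * (t * b / a) ^+ 2.
  rewrite !exprMn !normcD_sq normcN ctw dotcNr !exprMn -/a.
  by field.
move=> /(_ sq) h; have := ler_wpM2r zq h.
rewrite mulrBl !mulrDl -!powRM ?divr_ge0// ?normc_ge0// ?mulr_ge0 ?divr_ge0 ?mulr_ge0//.
rewrite !divfK// -[K * _ * _]mulrA -powRM ?divr_ge0 ?mulr_ge0// divfK// tqE => {}h.
have ab : a `^ (q - 1) * b <= a `^ q + b `^ q.
  have [le|/ltW le] := leP b a.
    have := ler_wpM2l (powR_ge0 a (q - 1)) le; rewrite powR_mulB1// => /le_trans -> //.
    by rewrite lerDl.
  have := ler_wpM2r b0 (powR_le a0 le (ltW qB)); rewrite powR_mulB1// => /le_trans -> //.
  by rewrite lerDr.
have h1 : e / 2 * (t * b / a) * a `^ q = e / 2 * t * (a `^ (q - 1) * b).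
  by rewrite -(@powR_mulB1 _ a q)//; field.
have h2 := ler_wpM2l (mulr_ge0 (ltW (divr_gt0 e0 (@ltr0n R 2))) t0) ab.
have h3 : K * t `^ (q - 1) <= e / 2.
  apply: le_trans (ler_wpM2l K0 tq) _; have := ltW c0; lra.
have h4 := ler_wpM2l (mulr_ge0 t0 wq) h3.
have h5 : 0 <= e / 2 * t * a `^ q by rewrite !mulr_ge0// ltW.
rewrite h1 in h; lra.
Qed.

Lemma gap_ge0 p z w : 1 < p ->
  0 <= normc w `^ p / p + (1 - p^-1) * normc z `^ p - lin p z w.
Proof.
move=> p1; have p0 : 0 < p by rewrite (lt_trans ltr01).
have := tangent_powR p1 (normc_ge0 z) (normc_ge0 w).
rewrite mulrBr -[p * _ * normc z]mulrA powR_mulB1 ?normc_ge0// -(ler_pM2r (_ : 0 < p^-1)) ?invr_gt0//.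
rewrite mulrDl mulrBl -mulrA [p * _]mulrC mulfK ?lt0r_neq0//.
have := lin_le z w p1; rewrite ler_norml => /andP[_].
rewrite (_ : p * normc z `^ (p - 1) * (normc w / p) = normc z `^ (p - 1) * normc w); last first.
  by field; exact: lt0r_neq0.
lra.
Qed.

(** The pointwise form of uniform convexity of L^p: near equality in Young
    inequality forces z and w to be close. *)
Lemma gapc p e : 1 < p -> 0 < e -> exists2 C : R, 0 <= C &
  forall z w, normc (z - w) `^ p <= e * (normc z `^ p + normc w `^ p) +
    C * (normc w `^ p / p + (1 - p^-1) * normc z `^ p - lin p z w).
Proof.
move=> p1 e0; have p0 : 0 < p by rewrite (lt_trans ltr01).
have [C C0 CP] := gap_real p1 e0.
exists (C + p); first by rewrite addr_ge0// ltW.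
move=> z w; have gap := gap_ge0 z w p1.
have wp := powR_ge0 (normc w) p; have zp := powR_ge0 (normc z) p.
have [zE|z0] := eqVneq z 0.
  rewrite zE in gap *; rewrite sub0r normcN normc0 powR0 ?lt0r_neq0//.
  have -> : lin p 0 w = 0 by rewrite /lin /dotc /= !mul0r addr0 mulr0.
  rewrite mulr0 add0r addr0 subr0 mulrDl [p * _]mulrC divfK ?lt0r_neq0//.
  have h1 : 0 <= e * normc w `^ p by rewrite mulr_ge0// ltW.
  have h2 : 0 <= C * (normc w `^ p / p) by rewrite mulr_ge0// divr_ge0// ltW.
  by lra.
have zgt := normc_gt0 z0.
set a := normc z in zp zgt gap *; set b := normc w in wp gap *.
have an := lt0r_neq0 zgt; have a0 := ltW zgt.
have b0 : 0 <= b by exact: normc_ge0.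
have dl := dotc_le z w; rewrite ler_norml -/a -/b in dl; case/andP: dl => _ dl.
have s0 : 0 <= b / a by rewrite divr_ge0.
have rs : dotc z w / a ^+ 2 <= b / a.
  rewrite ler_pdivrMr ?exprn_gt0// expr2 mulrA divfK//; lra.
have d0 : 0 <= normc (z - w) / a by rewrite divr_ge0 ?normc_ge0.
have ds : normc (z - w) / a <= 1 + b / a.
  rewrite ler_pdivrMr// mulrDl divfK// mul1r /a /b -(normcN w); exact: normcD.
have dE : (normc (z - w) / a) ^+ 2 = 1 - 2 * (dotc z w / a ^+ 2) + (b / a) ^+ 2.
  rewrite !exprMn normcD_sq normcN dotcNr -/a -/b.
  by field.
have := CP _ _ _ s0 rs d0 ds dE => h.
have := ler_wpM2r zp h; rewrite -powRM ?divr_ge0 ?normc_ge0// divfK//.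
have sE : (b / a) `^ p * a `^ p = b `^ p by rewrite -powRM ?divr_ge0// divfK.
have lE : dotc z w / a ^+ 2 * a `^ p = lin p z w.
  by rewrite -(@powR_mulB2 a p zgt) /lin -/a; field.
have -> : (e * (1 + (b / a) `^ p) + C * ((b / a) `^ p / p + (1 - p^-1) - dotc z w / a ^+ 2)) * a `^ p =
  e * (a `^ p + (b / a) `^ p * a `^ p) + C * ((b / a) `^ p * a `^ p / p + (1 - p^-1) * a `^ p -
    dotc z w / a ^+ 2 * a `^ p) by ring.
rewrite sE lE => {}h; apply: le_trans h _; rewrite [(C + p) * _]mulrDl addrA lerDl.
by rewrite mulr_ge0// ltW.
Qed.

Section master.
Variables p q : R.
Hypotheses (p1 : 1 < p) (q1 : 1 < q).
Let bt := (q - 1) / (p - 1).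
Let p0 : 0 < p. Proof. exact: lt_trans ltr01 p1. Qed.
Let q0 : 0 < q. Proof. exact: lt_trans ltr01 q1. Qed.
Let pB : 0 < p - 1. Proof. by rewrite subr_gt0. Qed.
Let qB : 0 < q - 1. Proof. by rewrite subr_gt0. Qed.
Let bt0 : 0 < bt. Proof. by rewrite divr_gt0. Qed.
Let btE : bt * (p - 1) = q - 1. Proof. by rewrite /bt divfK// lt0r_neq0. Qed.

(** Chosen so that the differentials of |.|^q / q at v and of |.|^p / p at
    dual_map v coincide (lin_dual_map). *)
Definition dual_map v : R[i] := (normc v `^ (bt - 1))%:C * v.

Lemma normc_dual_map v : normc (dual_map v) = normc v `^ bt.
Proof. by rewrite normcM normc_real ger0_norm ?powR_ge0// powR_mulB1 ?normc_ge0. Qed.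

Lemma lin_dual_map v w : lin p (dual_map v) w = lin q v w.
Proof.
rewrite /lin normc_dual_map dotcZl mulrA; have [->|v0] := eqVneq v 0.
  by rewrite /dotc /= !mul0r addr0 !mulr0.
have vgt := normc_gt0 v0.
congr (_ * _); rewrite -powRrM -powRDp//.
by congr (_ `^ _); have := btE; lra.
Qed.

Lemma lin_dual_mapr v : lin q v (dual_map v) = normc (dual_map v) `^ p.
Proof.
rewrite /lin normc_dual_map dotcZr dotcc; have [->|v0] := eqVneq v 0.
  rewrite normc0 expr0n !mulr0 powR0 ?lt0r_neq0//.
  by rewrite powR0 ?lt0r_neq0.
have vgt := normc_gt0 v0.
rewrite mulrCA (powR_mulB2 q vgt) -(powRDp (bt - 1) q vgt).
by rewrite -powRrM; congr (_ `^ _); have := btE; lra.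
Qed.

(** chi marks the points where the duality map is kept; the truncation makes
    it q-integrable. *)
Definition trunc_dual (chi : bool) v : R[i] := if chi then dual_map v else 0.

(** The pointwise inequality behind gap_estimate. Here z is the truncated
    dual of v, and w stands for the coordinate of the image of z under the
    operator: gapc bounds |z - w|^p by the defect, whose linear term lin p z
    w is compared with lin q v w, equal to it where chi holds and bounded by
    Young inequality elsewhere; the tangent inequalities at v in the
    directions t z and - t w replace both differentials by values of |.|^q. *)
Lemma master_ineq (e C t tau Ct : R) v w (chi : bool) :
  (forall z w, normc (z - w) `^ p <= e * (normc z `^ p + normc w `^ p) +
    C * (normc w `^ p / p + (1 - p^-1) * normc z `^ p - lin p z w)) ->
  (forall a b : R, 0 <= a -> 0 <= b -> a `^ (q - 1) * b <= Ct * a `^ q + tau * b `^ q) ->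
  0 <= C -> 0 <= t -> 0 <= tau -> 0 <= Ct ->
  t * q * normc (trunc_dual chi v - w) `^ p + C * (2 * normc v `^ q + t * q * normc (trunc_dual chi v) `^ p) <=
  t * q * e * (normc (trunc_dual chi v) `^ p + normc w `^ p) +
  C * (normc (v + t%:C * trunc_dual chi v) `^ q + normc (v - t%:C * w) `^ q +
       t * q * (normc w `^ p / p + (1 - p^-1) * normc (trunc_dual chi v) `^ p) +
       t * q * (Ct * (normc v `^ q * (~~ chi)%:R) + tau * normc w `^ q)).
Proof.
move=> eC yC C0 t0 tau0 Ct0; set z := trunc_dual _ _.
have tq0 : 0 <= t * q by rewrite mulr_ge0// ltW.
have := ler_wpM2l tq0 (eC z w).
have T1 : normc v `^ q + t * q * normc z `^ p <= normc (v + t%:C * z) `^ q.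
  have := tangentc v (t%:C * z) q1; rewrite linZr.
  rewrite (_ : lin q v z = normc z `^ p); first by rewrite mulrA [q * t]mulrC.
  rewrite /z /trunc_dual; case: (chi); first exact: lin_dual_mapr.
  by rewrite normc0 powR0 ?lt0r_neq0// /lin /dotc /= !mulr0 addr0 mulr0.
have T2 : normc v `^ q - t * q * lin q v w <= normc (v - t%:C * w) `^ q.
  have := tangentc v (- (t%:C * w)) q1; rewrite linNr linZr mulrN.
  by rewrite mulrA [q * t]mulrC.
have T3 : lin q v w <= lin p z w + (Ct * (normc v `^ q * (~~ chi)%:R) + tau * normc w `^ q).
  have wq : 0 <= tau * normc w `^ q by rewrite mulr_ge0// powR_ge0.
  rewrite /z /trunc_dual; case: (chi); first by rewrite lin_dual_map mulr0 mulr0 add0r lerDl.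
  rewrite mulr1 {2}/lin /dotc /= !mul0r addr0 mulr0 add0r.
  apply: le_trans (yC _ _ (normc_ge0 v) (normc_ge0 w)).
  by have := lin_le v w q1; rewrite ler_norml => /andP[_].
set Z := normc z `^ p in T1 *; set W := normc w `^ p.
set V := normc v `^ q in T1 T2 T3 *.
set P1 := normc (v + _) `^ q in T1 *; set P2 := normc (v - _) `^ q in T2 *.
set X := Ct * _ + _ in T3 *; set L := lin q v w in T2 T3; set L' := lin p z w in T3 *.
move=> h; apply: le_trans (_ : t * q * (e * (Z + W) + C * (W / p + (1 - p^-1) * Z - L')) +
  C * (2 * V + t * q * Z) <= _); first by rewrite lerD2r.
rewrite mulrDr mulrA -addrA lerD2l [t * q * (C * _)]mulrCA -mulrDr ler_wpM2l//.
have := ler_wpM2l tq0 T3; lra.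
Qed.

End master.
End complex_powers.

(** * Smooth norms, almost fixed vectors and signed sums *)

(** Uniform smoothness of power type only in the weak sense needed for
    first-order arguments: an error e t with e as small as desired for small
    t. *)
Definition smooth_norm (R : realType) (X : normedModType R[i]) (q : R) :=
  forall e : R, 0 < e -> exists2 t0 : R, 0 < t0 &
  forall (t : R) (x y : X), 0 <= t -> t <= t0 ->
  nm (x + t%:C *: y) `^ q + nm (x - t%:C *: y) `^ q <=
    2 * nm x `^ q + e * t * (nm x `^ q + nm y `^ q).

Section Lp_smooth.
Context d (Om : measurableType d) (R : realType).
Variables (mu : {measure set Om -> \bar R}) (q : R) (q1 : 1 < q).

Lemma nm_hasI (f : Om -> R[i]) : f \in cLfun mu q ->
  hasI mu (fun=> 1) (fun x => normc (f x) `^ q) (nm (cls mu (ltW q1) f) `^ q).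
Proof.
move=> fq; split.
- by apply: measurable_normcp; exact: cLfun_meas fq.
- by move=> x; exact: powR_ge0.
- by rewrite nm_cls//; apply: eq_integral => x _; rewrite mulr1.
Qed.

Lemma Lp_smooth : smooth_norm (cLspace mu (ltW q1)) q.
Proof.
move=> e e0; have [t0 t00 tP] := smoothc q1 e0.
exists t0 => // t x y tge tle.
have rq (u : cLspace mu (ltW q1)) : (repr u : Om -> R[i]) \in cLfun mu q by exact: cLfunP.
have et : 0 <= e * t by rewrite mulr_ge0// ltW.
have tyq : (fun s => t%:C * (repr y : Om -> R[i]) s) \in cLfun mu q by exact: (cLfunZ (ltW q1)).
have w1 : measurable_fun setT (fun _ : Om => 1 : R) by exact: measurable_cst.
have w0 (s : Om) : 0 <= (1 : R) by [].
have hx := nm_hasI (rq x); have hy := nm_hasI (rq y).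
have hp := nm_hasI (cLfunD (ltW q1) (rq x) tyq).
have hm := nm_hasI (cLfunB (ltW q1) (rq x) tyq).
rewrite !cls_repr in hx hy; rewrite clsD// clsZ// !cls_repr in hp.
rewrite clsB// clsZ// !cls_repr in hm.
apply: (hasI_le w1 w0 (hasI_D w1 w0 hp hm)
  (hasI_D w1 w0 (hasI_Z w1 w0 (ler0n _ 2) hx)
     (hasI_Z w1 w0 et (hasI_D w1 w0 hx hy)))) => s.
exact: tP.
Qed.

End Lp_smooth.

Section smooth_norms.
Context {R : realType} {X : normedModType R[i]}.
Variable q : R.
Hypotheses (q1 : 1 < q) (sX : smooth_norm X q).
Implicit Types (x y k g : X).
Let q0 : 0 < q. Proof. exact: lt_trans ltr01 q1. Qed.

(** T maps k - t g to within d of k - t T g, so the norm of the latter is at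
    most that of k - t g plus d; smoothness compares k - t g with k + t g.
    Thus an almost fixed k has almost the same slope along g as along T g. *)
Lemma almost_fixed_ineq (T : {linear X -> X}) (B e : R) : (forall x, nm (T x) <= nm x) ->
  1 <= B -> 0 < e -> exists t d : R, [/\ 0 < t, t <= 1, 0 < d &
  forall k g, nm k <= B -> nm g <= B -> nm (T k - k) <= d ->
  nm (k + t%:C *: g) `^ q + nm (k - t%:C *: T g) `^ q <= 2 * nm k `^ q + e * t].
Proof.
move=> T1 B1 e0; have B0 : 0 < B by exact: lt_le_trans ltr01 B1.
have Bq : 0 < B `^ q by rewrite powR_gt0.
have [t0 t00 tP] := sX (divr_gt0 e0 (mulr_gt0 (@ltr0n R 4) Bq)).
pose t := Num.min t0 1; have tgt : 0 < t by rewrite lt_min t00 ltr01.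
have tle : t <= t0 by rewrite ge_min lexx.
have t1 : t <= 1 by rewrite ge_min lexx orbT.
pose D := q * (2 * B + 1) `^ (q - 1).
have D0 : 0 < D by rewrite mulr_gt0// powR_gt0//; lra.
pose d := Num.min 1 (e * t / 2 / D).
have d0 : 0 < d by rewrite lt_min ltr01 divr_gt0// divr_gt0// mulr_gt0.
have d1 : d <= 1 by rewrite ge_min lexx.
have dD : d * D <= e * t / 2 by rewrite -ler_pdivlMr// ge_min lexx orbT.
exists t, d; split => // k g kB gB Tk.
have := tP t k g (ltW tgt) tle.
set a := nm (k - t%:C *: g).
have a0 : 0 <= a by exact: nm_ge0.
have aB : a <= 2 * B.
  apply: le_trans (nmB _ _) _; rewrite nmZr ger0_norm ?(ltW tgt)//.
  have : t * nm g <= 1 * B by apply: ler_pM => //; [exact: ltW|exact: nm_ge0].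
  lra.
have le1 : nm (k - t%:C *: T g) <= a + d.
  have -> : k - t%:C *: T g = T (k - t%:C *: g) + (k - T k).
    by rewrite [RHS]addrC linearB /= subrKA [T (_ *: _)]linearZ.
  by apply: le_trans (nmD _ _) _; apply: lerD; [exact: T1|rewrite nmBC].
have le2 : nm (k - t%:C *: T g) `^ q <= a `^ q + e * t / 2.
  apply: le_trans (powR_le (nm_ge0 _) le1 (ltW q0)) _.
  have ad : 0 <= a + d by rewrite addr_ge0// ltW.
  have := tangent_powR q1 ad a0.
  have h : (a + d) `^ (q - 1) <= (2 * B + 1) `^ (q - 1).
    by apply: powR_le => //; [lra|rewrite subr_ge0 ltW].
  have h2 : q * (a + d) `^ (q - 1) * d <= e * t / 2.
    apply: le_trans dD; rewrite mulrC ler_wpM2l ?(ltW d0)// /D ler_wpM2l//.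
    exact: ltW.
  have -> : a - (a + d) = - d by rewrite opprD addrA subrr add0r.
  by rewrite mulrN; lra.
have kq : nm k `^ q <= B `^ q by apply: powR_le => //; [exact: nm_ge0|exact: ltW].
have gq : nm g `^ q <= B `^ q by apply: powR_le => //; [exact: nm_ge0|exact: ltW].
have h3 : e / (4 * B `^ q) * t * (nm k `^ q + nm g `^ q) <= e * t / 2.
  apply: (@le_trans _ _ (e / (4 * B `^ q) * t * (2 * B `^ q))).
    rewrite ler_wpM2l//; last lra.
    by rewrite mulr_ge0 ?(ltW tgt)// divr_ge0 ?(ltW e0)// mulr_ge0// ltW.
  by rewrite le_eqVlt; apply/orP; left; apply/eqP; field; exact: lt0r_neq0.
by move=> h4; lra.
Qed.

(** All the finitely many bounded sequences converge along a common
    ultrafilter, so two large indices give close values. *)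
Lemma pigeonhole (I : finType) (u : I -> nat -> R) (B e : R) n0 : 0 < e ->
  (forall i n, `|u i n| <= B) ->
  exists a b : nat, [/\ (n0 <= a)%N, (a < b)%N & forall i, `|u i a - u i b| <= e].
Proof.
move=> e0 uB; have [U [UU infU]] := nat_ultra.
have e2 : 0 < e / 2 by rewrite divr_gt0.
pose l i := projT1 (cid (ultra_lim UU (uB i))).
have lP i : U [set n | `|u i n - l i| < e / 2].
  by rewrite /l; case: cid => /= li; apply.
pose G := [set n | forall i, `|u i n - l i| < e / 2].
have UG : U G.
  have h (s : seq I) : U [set n | forall i, i \in s -> `|u i n - l i| < e / 2].
    elim: s => [|i s ih]; first by apply: filterS filterT.
    apply: filterS2 (lP i) ih => n /= hi hs i'; rewrite inE => /predU1P[->//|].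
    exact: hs.
  by apply: filterS (h (enum I)) => n /= hn i; apply: hn; rewrite mem_enum.
have Uge N : U [set n | (N <= n)%N] by apply: infU; exists N.
have [a [Ga na]] : G `&` [set n | (n0 <= n)%N] !=set0.
  by apply: (@filter_ex _ _ (@ultra_proper _ _ UU)); exact: filterI.
have [b [Gb ab]] : G `&` [set n | (a.+1 <= n)%N] !=set0.
  by apply: (@filter_ex _ _ (@ultra_proper _ _ UU)); exact: filterI.
exists a, b; split => // i; have := Ga i; have := Gb i.
rewrite !ltr_norml ler_norml => /andP[h1 h2] /andP[h3 h4].
by apply/andP; split; lra.
Qed.

Lemma convex_powR (x y : X) : nm (2^-1 *: (x + y)) `^ q <= (nm x `^ q + nm y `^ q) / 2.
Proof.
set m := nm _; have m0 : 0 <= m by exact: nm_ge0.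
have mle : 2 * m <= nm x + nm y.
  have -> : 2 * m = nm (x + y).
    rewrite /m (_ : (2^-1 : R[i]) = (2^-1 : R)%:C); last by rewrite rmorphV ?unitfE//= rmorph_nat.
    by rewrite nmZr ger0_norm ?invr_ge0// mulrA divff// mul1r.
  exact: nmD.
have h1 := tangent_powR q1 m0 (nm_ge0 x); have h2 := tangent_powR q1 m0 (nm_ge0 y).
have h3 : 0 <= q * m `^ (q - 1) * (nm x - m + (nm y - m)).
  by rewrite mulr_ge0 ?mulr_ge0 ?powR_ge0 ?(ltW q0)//; lra.
rewrite mulrDr in h3; lra.
Qed.

(** The vector s + (t / 2) (x a - x b) is the midpoint of s + t x a and s -
    t x b. If all the norms of s i + t x a and s i + t x b agree up to e t,
    smoothness bounds the mean of their q-th powers. *)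
Lemma signed_step (x : nat -> X) (I : finType) (s : I -> X) (t e : R) n0 :
  0 < e -> 0 <= t -> (forall n, nm (x n) <= 1) -> (forall i, nm (s i) `^ q <= 1) ->
  (forall (z y : X), nm (z + t%:C *: y) `^ q + nm (z - t%:C *: y) `^ q <=
    2 * nm z `^ q + e * t * (nm z `^ q + nm y `^ q)) -> 0 < t ->
  exists a b : nat, [/\ (n0 <= a)%N, (a < b)%N &
    forall i (c : bool), nm (s i + (-1) ^+ c *: ((t / 2)%:C *: (x a - x b))) `^ q <=
       nm (s i) `^ q + 2 * e * t].
Proof.
move=> e0 t0 x1 s1 tP tgt.
pose u (ic : I * bool) n := nm (s ic.1 + (-1) ^+ ic.2 *: (t%:C *: x n)) `^ q.
have uB ic n : `|u ic n| <= (1 + t) `^ q.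
  rewrite ger0_norm ?powR_ge0//; apply: powR_le; [exact: nm_ge0| |exact: ltW].
  apply: le_trans (nmD _ _) _; apply: lerD.
    rewrite leNgt; apply/negP => lt; have := s1 ic.1.
    by have := powR_lt ler01 lt q0; rewrite powR1 => /lt_le_trans h /h; rewrite ltxx.
  have -> : nm ((-1) ^+ ic.2 *: (t%:C *: x n)) = nm (t%:C *: x n).
    by case: (ic.2); rewrite ?expr1 ?scaleN1r ?nmN// expr0 scale1r.
  by rewrite nmZr ger0_norm// -[leRHS]mulr1 ler_wpM2l.
have et : 0 < e * t by rewrite mulr_gt0.
have [a [b [na ab ub]]] := pigeonhole n0 et uB.
exists a, b; split => // i c.
have half : (2^-1 : R[i]) = (2^-1 : R)%:C by rewrite rmorphV ?unitfE//= rmorph_nat.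
have -> : s i + (-1) ^+ c *: ((t / 2)%:C *: (x a - x b)) =
  2^-1 *: ((s i + (-1) ^+ c *: (t%:C *: x a)) + (s i - (-1) ^+ c *: (t%:C *: x b))).
  rewrite addrACA [RHS]scalerDr; congr (_ + _).
    have -> : s i + s i = 2%:R *: s i by rewrite scaler_nat mulr2n.
    by rewrite scalerA mulVf ?pnatr_eq0// scale1r.
  rewrite -scalerBr -scalerBr rmorphM /= -half !scalerA; congr (_ *: _).
  by rewrite mulrA mulrC.
apply: le_trans (convex_powR _ _) _.
have h1 := ub (i, c); rewrite /u /= ler_norml in h1; case/andP: h1 => _ h1.
have h2 : nm (s i + (-1) ^+ c *: (t%:C *: x b)) `^ q +
    nm (s i - (-1) ^+ c *: (t%:C *: x b)) `^ q <= 2 * nm (s i) `^ q + 2 * (e * t).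
  have h : e * t * (nm (s i) `^ q + nm (x b) `^ q) <= 2 * (e * t).
    rewrite mulrC ler_wpM2r ?(ltW et)//; have := s1 i.
    have := powR_le (nm_ge0 (x b)) (x1 b) (ltW q0); rewrite powR1; lra.
  have := tP (s i) (x b); case: (c); rewrite ?expr1 ?scaleN1r ?opprK ?expr0 ?scale1r; lra.
lra.
Qed.

Lemma signed_sums_aux (x : nat -> X) (t e : R) n0 : 0 < e -> 0 < t ->
  (forall n, nm (x n) <= 1) ->
  (forall (z y : X), nm (z + t%:C *: y) `^ q + nm (z - t%:C *: y) `^ q <=
    2 * nm z `^ q + e * t * (nm z `^ q + nm y `^ q)) ->
  forall n : nat, 2 * e * t * n%:R <= 1 -> exists a b : nat -> nat,
  (forall i, (n0 <= a i)%N /\ (a i < b i)%N) /\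
  forall f : {ffun 'I_n -> bool},
    nm (\sum_(i < n) (-1) ^+ (f i) *: ((t / 2)%:C *: (x (a i) - x (b i)))) `^ q <= 2 * e * t * n%:R.
Proof.
move=> e0 t0 x1 tP; have et : 0 < 2 * e * t by rewrite !mulr_gt0.
elim => [_|n ih le].
  exists (fun=> n0), (fun=> n0.+1); split => // f.
  by rewrite big_ord0 nm0 powR0 ?lt0r_neq0// mulr0.
have nS : n.+1%:R = n%:R + 1 :> R by rewrite -natr1.
have le' : 2 * e * t * n%:R <= 1 by move: le; rewrite nS mulrDr mulr1; lra.
have [a [b [ab abP]]] := ih le'.
pose s (f : {ffun 'I_n -> bool}) : X :=
  \sum_(i < n) (-1) ^+ (f i) *: ((t / 2)%:C *: (x (a i) - x (b i))).
have s1 f : nm (s f) `^ q <= 1 by apply: le_trans le'; exact: abP.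
have [a1 [b1 [na1 ab1 sP]]] := signed_step n0 e0 (ltW t0) x1 s1 tP t0.
exists (fun i => if i == n then a1 else a i), (fun i => if i == n then b1 else b i).
split; first by move=> i; case: eqP.
move=> f; rewrite big_ord_recr /= eqxx.
pose f' : {ffun 'I_n -> bool} := [ffun i => f (widen_ord (leqnSn n) i)].
have -> : \sum_(i < n) (-1) ^+ f (widen_ord (leqnSn n) i) *: ((t / 2)%:C *:
    (x (if (i : nat) == n then a1 else a i) - x (if (i : nat) == n then b1 else b i))) = s f'.
  by apply: eq_bigr => i _; rewrite ffunE ltn_eqF.
apply: le_trans (sP f' (f ord_max)) _.
by rewrite nS mulrDr mulr1 lerD2r; exact: abP.
Qed.

(** N = K m steps of size t = 1 / m increase the q-th power of the norm by 2
    e t each, hence by 1 in all, if e = 1 / (2 K). The sums scaled by t / 2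
    thus have norm at most 1, which is a gain of the factor K over the
    triangle inequality. *)
Lemma signed_sums (x : nat -> X) (K : nat) : (0 < K)%N -> (forall n, nm (x n) <= 1) ->
  exists2 N : nat, (0 < N)%N & forall n0, exists a b : nat -> nat,
  (forall i, (n0 <= a i)%N /\ (a i < b i)%N) /\
  forall f : {ffun 'I_N -> bool},
    nm (\sum_(i < N) (-1) ^+ (f i) *: (x (a i) - x (b i))) <= 2 * N%:R / K%:R.
Proof.
move=> K0 x1; have KR : 0 < K%:R :> R by rewrite ltr0n.
pose e : R := (2 * K%:R)^-1; have e0 : 0 < e by rewrite invr_gt0 mulr_gt0.
have [t0 t00 tP] := sX e0.
(* The step 1 / m must not exceed t0. *)
pose m := (Num.bound t0^-1).+1; have m0 : 0 < m%:R :> R by rewrite ltr0n.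
pose t : R := m%:R^-1; have tgt : 0 < t by rewrite invr_gt0.
have tt0 : t <= t0.
  rewrite /t -[leRHS]invrK lef_pV2 ?posrE ?invr_gt0//.
  have /archi_boundP/ltW h : 0 <= t0^-1 by rewrite invr_ge0 ltW.
  by rewrite (le_trans h)// ler_nat.
exists (K * m)%N; first by rewrite muln_gt0 K0.
have N1 : 2 * e * t * (K * m)%:R = 1.
  by rewrite natrM /e /t; field; rewrite !lt0r_neq0.
move=> n0; have [a [b [ab abP]]] := signed_sums_aux n0 e0 tgt x1
  (fun z y => tP t z y (ltW tgt) tt0) (eq_ind_r (fun r => r <= 1) (lexx 1) N1).
exists a, b; split => // f; have := abP f; rewrite N1.
set S := \sum_(i < _) _ *: (x _ - x _).
have -> : \sum_(i < K * m) (-1) ^+ f i *: ((t / 2)%:C *: (x (a i) - x (b i))) = (t / 2)%:C *: S.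
  by rewrite scaler_sumr; apply: eq_bigr => i _; rewrite !scalerA mulrC.
rewrite nmZr ger0_norm ?divr_ge0 ?(ltW tgt)// => h.
have h1 : t / 2 * nm S <= 1.
  rewrite leNgt; apply/negP => lt; have := powR_lt ler01 lt q0.
  by rewrite powR1 => /lt_le_trans/(_ h); rewrite ltxx.
rewrite natrM (_ : 2 * (K%:R * m%:R) / K%:R = 2 / t); last first.
  by rewrite /t; field; rewrite !lt0r_neq0.
by rewrite ler_pdivlMr//; lra.
Qed.

End smooth_norms.

(** * Concentration of almost fixed elements *)

Section concentration.
Context (R : realType) (p q : R) (p1 : 1 < p) (q1 : 1 < q) (pq : p <> q).
Context (d1 d2 : measure_display) (Om1 : measurableType d1) (Om2 : measurableType d2).
Variables (mu1 : {measure set Om1 -> \bar R}) (mu2 : {measure set Om2 -> \bar R}).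
Variable j : {linear cLspace mu2 (ltW q1) -> cLspace mu1 (ltW p1)}.
Hypotheses (j_lat : lattice_homomorphism j) (j_inj : injective j).
Local Notation Y := (cLspace mu2 (ltW q1)).
Variables (S : {linear Y -> Y}) (C : R).
Hypotheses (C1 : 1 <= C) (S_q : forall u, nm (S u) <= nm u)
  (S_p : forall u, nm (j (S u)) <= nm (j u))
  (jC : forall u, nm (j u) <= C * nm u) (SC : forall u, nm (S u) <= C * nm (j u)).
Local Notation chart := (chart j).
Local Notation Fits E v := (fits q mu2 E v).
Local Notation el E v := (elt (ltW q1) mu2 E v).
Local Notation HI E f a := (hasI mu2 (fun x => E x `^ q) f a).
Implicit Types (E : Om2 -> R) (v z w : Om2 -> R[i]) (f r : Om2 -> R).

Let p0 : 0 < p. Proof. exact: lt_trans ltr01 p1. Qed.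
Let q0 : 0 < q. Proof. exact: lt_trans ltr01 q1. Qed.
Let pB : 0 < p - 1. Proof. by rewrite subr_gt0. Qed.
Let qB : 0 < q - 1. Proof. by rewrite subr_gt0. Qed.
Let C0 : 0 < C. Proof. exact: lt_le_trans ltr01 C1. Qed.
Local Notation bt := ((q - 1) / (p - 1)).

Lemma HI_D E f g a b : chart E -> HI E f a -> HI E g b -> HI E (fun x => f x + g x) (a + b).
Proof. by move=> chE; apply: hasI_D; [exact: wt_meas chE|move=> x; exact: powR_ge0]. Qed.

Lemma HI_Z E c f a : chart E -> 0 <= c -> HI E f a -> HI E (fun x => c * f x) (c * a).
Proof. by move=> chE; apply: hasI_Z; [exact: wt_meas chE|move=> x; exact: powR_ge0]. Qed.

Lemma HI_le E f g a b : chart E -> HI E f a -> HI E g b -> (forall x, f x <= g x) -> a <= b.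
Proof. by move=> chE; apply: hasI_le; [exact: wt_meas chE|move=> x; exact: powR_ge0]. Qed.

Lemma HI_dom E f g b : chart E -> measurable_fun setT f -> (forall x, 0 <= f x) -> HI E g b ->
  (forall x, f x <= g x) -> exists2 a, HI E f a & a <= b.
Proof. by move=> chE; apply: hasI_dom; [exact: wt_meas chE|move=> x; exact: powR_ge0]. Qed.

Lemma HI_cut E A f a : chart E -> measurable A -> HI E f a ->
  exists2 b, HI E (fun x => f x * \1_A x) b & b <= a.
Proof. by move=> chE; apply: hasI_cut; [exact: wt_meas chE|move=> x; exact: powR_ge0]. Qed.

Lemma HI_extend E E' v (r : R) (g : Om2 -> R) a : 0 < r -> extends E E' -> Fits E v ->
  HI E' (fun x => normc (v x) `^ r * g x) a <-> HI E (fun x => normc (v x) `^ r * g x) a.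
Proof.
move=> r0 ext [_ v0 _]; apply: hasI_extend ext _ => x Ex.
by rewrite v0// normc0 powR0 ?mul0r// lt0r_neq0.
Qed.

Lemma HI_ge0 E f a : HI E f a -> 0 <= a.
Proof. by apply: hasI_ge0; [move=> x; exact: powR_ge0]. Qed.

Lemma powR_le_inv (x y r : R) : 0 <= y -> 0 < r -> x `^ r <= y `^ r -> x <= y.
Proof.
move=> y0 r0 le; rewrite leNgt; apply/negP => /(fun h => powR_lt y0 h r0).
by move=> /lt_le_trans/(_ le); rewrite ltxx.
Qed.

Lemma nm_el_le E v z (c : R) : chart E -> Fits E v -> Fits E z -> 0 <= c ->
  (forall x, normc (z x) <= c * normc (v x)) -> nm (el E z) <= c * nm (el E v).
Proof.
move=> chE vE zE c0 zv; apply: (@powR_le_inv _ _ q) => //; first by rewrite mulr_ge0 ?nm_ge0.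
rewrite powRM ?nm_ge0//.
apply: (HI_le chE (elt_nm chE zE) (HI_Z chE (powR_ge0 c q) (elt_nm chE vE))) => x.
by rewrite -powRM ?normc_ge0// powR_le ?normc_ge0// ltW.
Qed.

(** The conclusion of almost_fixed_ineq: k and g are related as if k were
    fixed by S, up to an error e t. *)
Definition perturbed k g t e :=
  nm (k + t%:C *: g) `^ q + nm (k - t%:C *: S g) `^ q <= 2 * nm k `^ q + e * t.

(** The tangent inequality at k, along t g from below and along - t S g with
    |S g|_q <= C |j g|_p, bounds the slope of the norm at k in the direction
    g by C |j g|_p. *)
Lemma test_ineq E v z r (X t e : R) : chart E -> Fits E v -> Fits E z ->
  0 < t -> nm (el E v) <= 1 -> perturbed (el E v) (el E z) t e ->
  HI E r X -> (forall x, r x <= lin q (v x) (z x)) ->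
  X <= C * nm (j (el E z)) + e / q.
Proof.
move=> chE vE zE t0 k1; rewrite /perturbed; set k := el E v; set g := el E z => NI rX rz.
have qt : 0 <= q * t by rewrite mulr_ge0// ltW.
have tz : Fits E (fun x => t%:C * z x) := fitsZ t%:C chE zE.
have hp := elt_nm chE (fitsD (ltW q1) vE tz); rewrite eltD// eltZ// in hp.
have le1 : nm k `^ q + q * t * X <= nm (k + t%:C *: g) `^ q.
  apply: (HI_le chE (HI_D chE (elt_nm chE vE) (HI_Z chE qt rX)) hp) => x.
  apply: le_trans (tangentc _ _ q1); rewrite lerD2l linZr mulrA.
  by apply: ler_wpM2l.
have k0 : 0 <= nm k by exact: nm_ge0.
have le2 : nm k `^ q - t * q * (C * nm (j g)) <= nm (k - t%:C *: S g) `^ q.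
  apply: le_trans (tangent_powR q1 k0 (nm_ge0 _)); rewrite lerD2l.
  have h1 : - (t * (C * nm (j g))) <= nm (k - t%:C *: S g) - nm k.
    have := nmBl k (k - t%:C *: S g); rewrite opprB addrCA subrr addr0 nmZr ger0_norm ?(ltW t0)//.
    have : t * nm (S g) <= t * (C * nm (j g)) by rewrite ler_wpM2l ?SC// ltW.
    lra.
  have kq : nm k `^ (q - 1) <= 1.
    by have := powR_le k0 k1 (ltW qB); rewrite powR1.
  have h0 : 0 <= t * (C * nm (j g)) by rewrite !mulr_ge0 ?nm_ge0// ltW.
  have h2 : - (t * (C * nm (j g))) <= nm k `^ (q - 1) * (nm (k - t%:C *: S g) - nm k).
    have h3 := ler_wpM2l (powR_ge0 (nm k) (q - 1)) h1; apply: le_trans h3.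
    rewrite mulrN lerN2 -[leRHS]mul1r; exact: ler_wpM2r.
  have := ler_wpM2l (ltW q0) h2; lra.
have h : q * t * X <= q * t * (C * nm (j g) + e / q).
  have -> : q * t * (C * nm (j g) + e / q) = t * q * (C * nm (j g)) + e * t.
    by field; exact: lt0r_neq0.
  lra.
by rewrite -(@ler_pM2l _ (q * t))// mulr_gt0.
Qed.

Lemma gap_algebra (t r e e1 Cg ip N X W K P1 P2 T G : R) : 0 < t -> 0 < r ->
  0 <= e1 -> 0 <= Cg -> 0 <= ip -> W <= X -> P1 + P2 <= 2 * K + e * t ->
  t * r * N + Cg * (2 * K + t * r * X) <= t * r * e1 * (X + W) +
    Cg * (P1 + P2 + t * r * (ip * W + (1 - ip) * X) + t * r * (T + G)) ->
  N <= 2 * e1 * X + Cg * (e / r + T + G).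
Proof.
move=> t0 r0 e10 Cg0 ip0 WX NI h.
have tr : 0 < t * r by exact: mulr_gt0.
have m1 : Cg * (P1 + P2 + t * r * (ip * W + (1 - ip) * X) + t * r * (T + G)) <=
    Cg * (2 * K + e * t + t * r * X + t * r * (T + G)).
  apply: ler_wpM2l => //; rewrite lerD2r; apply: lerD => //.
  apply: ler_wpM2l; first exact: ltW.
  by rewrite mulrBl mul1r addrCA gerDl subr_le0 ler_wpM2l.
have m2 : t * r * e1 * (X + W) <= t * r * e1 * (2 * X).
  by apply: ler_wpM2l; [exact: mulr_ge0 (ltW tr) e10|lra].
rewrite -(ler_pM2l tr).
have -> : t * r * (2 * e1 * X + Cg * (e / r + T + G)) =
    t * r * e1 * (2 * X) + (Cg * (2 * K + e * t + t * r * X + t * r * (T + G)) -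
      Cg * (2 * K + t * r * X)) by field; exact: lt0r_neq0.
lra.
Qed.

(** Integration of master_ineq over the chart. The contraction property of S
    for the seminorm |j _|_p makes the integrated defect small. *)
Lemma gap_estimate E v w (A : set Om2) (t e e1 Cg tau Ct b : R) :
  let z x := trunc_dual p q (x \in A) (v x) in
  chart E -> Fits E v -> Fits E z -> Fits E w -> el E w = S (el E z) ->
  0 < t -> perturbed (el E v) (el E z) t e ->
  (forall z w : R[i], normc (z - w) `^ p <= e1 * (normc z `^ p + normc w `^ p) +
    Cg * (normc w `^ p / p + (1 - p^-1) * normc z `^ p - lin p z w)) ->
  (forall a b : R, 0 <= a -> 0 <= b -> a `^ (q - 1) * b <= Ct * a `^ q + tau * b `^ q) ->
  0 <= e1 -> 0 <= Cg -> 0 <= tau -> 0 <= Ct ->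
  HI E (fun x => normc (v x) `^ q * \1_(~` A) x) b ->
  nm (j (el E z - S (el E z))) `^ p <= 2 * e1 * nm (j (el E z)) `^ p +
    Cg * (e / q + Ct * b + tau * nm (S (el E z)) `^ q).
Proof.
move=> z chE vE zE wE wS t0 NI eC yC e10 Cg0 tau0 Ct0 vb.
have tq : 0 <= t * q by rewrite mulr_ge0// ltW.
have tC0 := ltW t0.
have pv : 0 <= 1 - p^-1 by rewrite subr_ge0 invf_le1// ltW.
have ip : 0 <= p^-1 by rewrite invr_ge0 ltW.
have tz : Fits E (fun x => t%:C * z x) := fitsZ t%:C chE zE.
have tw : Fits E (fun x => t%:C * w x) := fitsZ t%:C chE wE.
have h1 := elt_nm chE (fitsD (ltW q1) vE tz); rewrite eltD// eltZ// in h1.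
have h2 := elt_nm chE (fitsB chE vE tw); rewrite (eltB chE)// eltZ// wS in h2.
have hz := elt_np chE zE; have hw := elt_np chE wE; rewrite wS in hw.
have hv := elt_nm chE vE; have hwq := elt_nm chE wE; rewrite wS in hwq.
have hzw := elt_np chE (fitsB chE zE wE); rewrite (eltB chE)// wS in hzw.
have two : 0 <= (2 : R) by [].
have lhs := HI_D chE (HI_Z chE tq hzw) (HI_Z chE Cg0 (HI_D chE (HI_Z chE two hv) (HI_Z chE tq hz))).
have rhs := HI_D chE (HI_Z chE (mulr_ge0 tq e10) (HI_D chE hz hw))
  (HI_Z chE Cg0 (HI_D chE (HI_D chE (HI_D chE h1 h2)
     (HI_Z chE tq (HI_D chE (HI_Z chE ip hw) (HI_Z chE pv hz))))
   (HI_Z chE tq (HI_D chE (HI_Z chE Ct0 vb) (HI_Z chE tau0 hwq))))).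
have := HI_le chE lhs rhs; set N := nm (j (_ - _)) `^ p.
set X := nm (j (el E z)) `^ p; set W := nm (j (S _)) `^ p; set G := nm (S _) `^ q.
set K := nm (el E v) `^ q; set P1 := nm _ `^ q; set P2 := nm _ `^ q => h.
have WX : W <= X by apply: powR_le; [exact: nm_ge0|exact: S_p|exact: ltW].
have NI' : P1 + P2 <= 2 * K + e * t by exact: NI.
have {h lhs rhs} h : t * q * N + Cg * (2 * K + t * q * X) <=
    t * q * e1 * (X + W) + Cg * (P1 + P2 + t * q * (p^-1 * W + (1 - p^-1) * X) +
     t * q * (Ct * b + tau * G)).
  apply: h => x; have := master_ineq p1 q1 (v x) (w x) (x \in A) eC yC Cg0 tC0 tau0 Ct0.
  by rewrite -/(z x) indicE in_setC [_ / p]mulrC.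
exact: gap_algebra t0 q0 e10 Cg0 ip WX NI' h.
Qed.

Local Notation K0 := ((C + 1) `^ (p - 1)^-1).
Local Notation K1 := (C * K0).

Let K0_ge1 : 1 <= K0.
Proof.
have := @powR_le _ 1 (C + 1) (p - 1)^-1 ler01; rewrite powR1; apply.
  by rewrite lerDr ltW.
by rewrite invr_ge0 ltW.
Qed.

(** For a >= 1 the hypothesis gives a^(p-1) <= C + 1. *)
Lemma le_K0 a c : 0 <= a -> c <= 1 -> a `^ p <= C * a + c -> a <= K0.
Proof.
move=> a0 c1 le; rewrite leNgt; apply/negP => lt.
have a1 : 1 < a by exact: le_lt_trans lt.
have := powR_lt (powR_ge0 _ _) lt pB; rewrite powRVK ?lt0r_neq0//; last first.
  by rewrite addr_ge0// ltW.
move=> h; have agt : 0 < a by exact: lt_trans a1.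
have := h; rewrite -(ltr_pM2r agt) powR_mulB1//; lra.
Qed.

(** Integrability of order s, uniform over all almost fixed elements of the
    unit ball, can be expected only up to a part of q-mass e. This mass may
    be arbitrarily small, at the price of the tolerance d for being almost
    fixed. *)
Definition concentrated s I := forall e : R, 0 < e -> exists2 d : R, 0 < d &
  forall E v, chart E -> Fits E v -> nm (el E v) <= 1 -> nm (S (el E v) - el E v) <= d ->
  exists (D : set Om2) (a b : R), [/\ measurable D,
    HI E (fun x => normc (v x) `^ s * \1_D x) a, a <= I,
    HI E (fun x => normc (v x) `^ q * \1_(~` D) x) b & b <= e].

Lemma concentrated0 : concentrated q 1.
Proof.
move=> e e0; exists 1 => // E v chE vE k1 _.
have hv := elt_nm chE vE.
exists setT, (nm (el E v) `^ q), 0; split => //; last exact: ltW.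
- have -> : (fun x => normc (v x) `^ q * \1_[set: Om2] x) = (fun x => normc (v x) `^ q).
    by apply/funext => x; rewrite indicT mulr1.
  exact: hv.
- by have := powR_le (nm_ge0 _) k1 (ltW q0); rewrite powR1.
- have -> : (fun x => normc (v x) `^ q * \1_(~` [set: Om2]) x) = (fun=> 0).
    by apply/funext => x; rewrite setCT indicE in_set0 mulr0.
  exact: hasI0.
Qed.

(** The set where the dual map multiplies the modulus by at most L. *)
Definition low v (L : R) : set Om2 := [set x | normc (v x) `^ (bt - 1) <= L].

Definition cutoff v L : Om2 -> R[i] := fun x => trunc_dual p q (x \in low v L) (v x).

Lemma measurable_le (h1 h2 : Om2 -> R) : measurable_fun setT h1 -> measurable_fun setT h2 ->
  measurable [set x | h1 x <= h2 x].
Proof.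
move=> m1 m2; rewrite (_ : [set x | _] = (fun x => h2 x - h1 x) @^-1` `[0, +oo[).
  rewrite -[X in measurable X]setTI; apply: (measurable_funB m2 m1) => //.
by apply/seteqP; split => x /=; rewrite in_itv/= andbT subr_ge0.
Qed.

Lemma low_meas v L : cmeasurable v -> measurable (low v L).
Proof.
move=> mv; apply: measurable_le; last exact: measurable_cst.
exact: measurable_normcp.
Qed.

Lemma cutoff_le v L x : 0 <= L -> normc (cutoff v L x) <= L * normc (v x).
Proof.
move=> L0; rewrite /cutoff /trunc_dual; case: ifP => [/set_mem /= xA|_].
  by rewrite /dual_map normcM normc_real ger0_norm ?powR_ge0// ler_wpM2r// normc_ge0.
by rewrite normc0 mulr_ge0// normc_ge0.
Qed.

Lemma cutoff_fits E v L : chart E -> Fits E v -> 0 <= L -> Fits E (cutoff v L).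
Proof.
move=> chE vE L0; have [mv _ _] := vE.
apply: (fits_dom chE vE) (fun x => cutoff_le v x L0).
rewrite (_ : cutoff v L = fun x => (normc (v x) `^ (bt - 1) * \1_(low v L) x)%:C * v x).
  apply: cmeasurableM => //; apply: measurable_funM; first exact: measurable_normcp.
  by apply: measurable_indic; exact: low_meas.
apply/funext => x; rewrite /cutoff /trunc_dual indicE /dual_map.
by case: (x \in _); rewrite ?mulr1// mulr0 mul0r.
Qed.

(** test_ineq for g = cutoff v L: the slope is the p-th power of |j g|_p
    itself, so |j g|_p ^ p <= C |j g|_p + 1. *)
Lemma cutoff_bound E v L t e : chart E -> Fits E v -> 0 <= L -> 0 < t ->
  nm (el E v) <= 1 -> perturbed (el E v) (el E (cutoff v L)) t e -> e / q <= 1 ->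
  nm (j (el E (cutoff v L))) <= K0.
Proof.
move=> chE vE L0 t0 k1 NI e1; have zE := cutoff_fits chE vE L0.
apply: (le_K0 (nm_ge0 _) e1).
apply: (test_ineq chE vE zE t0 k1 NI (elt_np chE zE)) => x.
rewrite /cutoff /trunc_dual; case: ifP => _; first by rewrite lin_dual_mapr.
by rewrite normc0 powR0 ?lt0r_neq0// /lin /dotc /= !mulr0 addr0 mulr0.
Qed.

Lemma high_fits E v L : chart E -> Fits E v -> Fits E (fun x => (\1_(~` low v L) x)%:C * v x).
Proof.
move=> chE vE; have [mv _ _] := vE; apply: fits_cut chE vE _.
by apply: measurableC; exact: low_meas.
Qed.

Lemma normc_cut A v x (r : R) : r != 0 ->
  normc ((\1_A x)%:C * v x) `^ r = normc (v x) `^ r * \1_A x.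
Proof.
move=> r0; rewrite normcM normc_real indicE; case: (_ \in _).
  by rewrite normr1 mul1r mulr1.
by rewrite normr0 mul0r powR0// mulr0.
Qed.

(** test_ineq for the part u of v above the cut: the slope is the q-mass b
    of u, and |v|^(q-p) > L^(p-1) there makes |j u|_p small compared with b
    <= 1. *)
Lemma tail_bound E v L t e b : chart E -> Fits E v -> 0 < L -> 0 < t ->
  nm (el E v) <= 1 ->
  perturbed (el E v) (el E (fun x => (\1_(~` low v L) x)%:C * v x)) t e ->
  HI E (fun x => normc (v x) `^ q * \1_(~` low v L) x) b ->
  b <= C * (L `^ ((p - 1) / p))^-1 + e / q.
Proof.
move=> chE vE L0 t0 k1 NI vb; have uE := high_fits L chE vE.
set u := (fun x => _) in NI uE.
have b1 : b <= 1.
  apply: (@le_trans _ _ (nm (el E v) `^ q)).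
    apply: (HI_le chE vb (elt_nm chE vE)) => x; rewrite indicE.
    by case: (_ \in _); rewrite ?mulr1// mulr0 powR_ge0.
  by have := powR_le (nm_ge0 _) k1 (ltW q0); rewrite powR1.
have h1 : L `^ (p - 1) * nm (j (el E u)) `^ p <= b.
  apply: (HI_le chE (HI_Z chE (powR_ge0 L (p - 1)) (elt_np chE uE)) vb) => x.
  rewrite /u normc_cut ?lt0r_neq0// mulrA indicE; case: (boolP (x \in _)); last by rewrite !mulr0.
  move=> /set_mem /= /negP; rewrite -ltNge !mulr1 => Lx.
  have [vx|vx] := eqVneq (normc (v x)) 0.
    by rewrite vx !powR0 ?lt0r_neq0// mulr0.
  have vgt : 0 < normc (v x) by rewrite lt_neqAle normc_ge0 andbT eq_sym.
  have := powR_le (ltW L0) (ltW Lx) (ltW pB); rewrite -powRrM mulrBl mul1r divfK ?lt0r_neq0// => h.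
  have := ler_wpM2r (powR_ge0 (normc (v x)) p) h; rewrite -(powRDp _ _ vgt).
  by rewrite (_ : q - 1 - (p - 1) + p = q)//; ring.
have ygt : 0 < L `^ ((p - 1) / p) by rewrite powR_gt0.
have h2 : L `^ ((p - 1) / p) * nm (j (el E u)) <= 1.
  apply: (@powR_le_inv _ _ p) => //; rewrite powR1 powRM ?nm_ge0 ?powR_ge0//.
  rewrite -powRrM divfK ?lt0r_neq0//; exact: le_trans h1 b1.
apply: le_trans (test_ineq chE vE uE t0 k1 NI vb _) _.
  move=> x; rewrite /u linZr [leRHS]mulrC indicE; case: (_ \in _); last by rewrite !mulr0.
  rewrite !mulr1 /lin dotcc; have [vx|vx] := eqVneq (normc (v x)) 0.
    by rewrite vx powR0 ?lt0r_neq0// expr0n mulr0.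
  by rewrite powR_mulB2// lt_neqAle normc_ge0 andbT eq_sym.
rewrite lerD2r ler_wpM2l ?(ltW C0)//.
by rewrite -(ler_pM2l ygt) mulfV ?lt0r_neq0.
Qed.

(** Let z be the truncated dual of v and w a function with known
    integrability of order s on D. Where |z| <= 2 |w| inside D, the power
    |v|^(bt s) = |z|^s is controlled by |w|^s. Elsewhere z is controlled by
    z - w or by the part of w outside D, both small in L^p, and |v|^q =
    |z|^(p-1) |v| makes the q-mass of v small there. *)
Lemma concentration_set E v w L (D : set Om2) (s b a' b' tau Cy : R) :
  chart E -> Fits E v -> Fits E w -> 0 <= L -> 0 < s -> 0 <= tau -> 0 <= Cy ->
  (forall a b : R, 0 <= a -> 0 <= b -> a `^ (p - 1) * b <= Cy * a `^ p + tau * b `^ p) ->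
  nm (el E v) <= 1 -> measurable D ->
  HI E (fun x => normc (v x) `^ q * \1_(~` low v L) x) b ->
  HI E (fun x => normc (w x) `^ s * \1_D x) a' ->
  HI E (fun x => normc (w x) `^ q * \1_(~` D) x) b' ->
  exists (D1 : set Om2) (a1 b1 : R), [/\ measurable D1,
    HI E (fun x => normc (v x) `^ (bt * s) * \1_D1 x) a1, a1 <= 2 `^ s * a',
    HI E (fun x => normc (v x) `^ q * \1_(~` D1) x) b1 &
    b1 <= b + tau * C `^ p + Cy * 2 `^ p *
      (C `^ p * b' `^ (p / q) + nm (j (el E (cutoff v L) - el E w)) `^ p)].
Proof.
move=> chE vE wE L0 s0 tau0 Cy0 yC k1 mD vb wa wb.
have zE := cutoff_fits chE vE L0; set z := cutoff v L in zE *.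
have [mv _ _] := vE; have [mw _ _] := wE; have [mz _ _] := zE.
have mA := low_meas L mv.
pose P := [set x | normc (z x) <= 2 * normc (w x)].
have mP : measurable P.
  apply: measurable_le; first exact: measurable_normc.
  by apply: measurable_funM => //; exact: measurable_normc.
have mD1 : measurable (low v L `&` D `&` P) by apply: measurableI => //; exact: measurableI.
have zlow x : low v L x -> normc (z x) = normc (v x) `^ bt.
  by move=> xA; rewrite /z /cutoff /trunc_dual mem_set// normc_dual_map.
have [a1 h1 a1le] : exists2 a1, HI E (fun x => normc (v x) `^ (bt * s) *
    \1_(low v L `&` D `&` P) x) a1 & a1 <= 2 `^ s * a'.
  apply: (HI_dom chE _ _ (HI_Z chE (powR_ge0 2 s) wa)).
  - by apply: measurable_funM; [exact: measurable_normcp|exact: measurable_indic].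
  - by move=> x; rewrite mulr_ge0// powR_ge0.
  move=> x; rewrite [X in _ * X]indicE; case: (boolP (x \in _)) => [/set_mem [[xA xD] xP]|_].
    rewrite mulr1 indicE mem_set// mulr1 powRrM -zlow// -powRM ?normc_ge0//.
    by apply: powR_le => //; [exact: normc_ge0|exact: ltW].
  by rewrite mulr0 !mulr_ge0 ?powR_ge0.
have uE : Fits E (fun x => (\1_(~` D) x)%:C * w x).
  by apply: fits_cut chE wE _; exact: measurableC.
set u := (fun x => _) in uE.
have uq : nm (el E u) `^ q = b'.
  have := elt_nm chE uE; rewrite (_ : (fun x => normc (u x) `^ q) =
    (fun x => normc (w x) `^ q * \1_(~` D) x)); first by move=> h; exact: hasI_uniq h wb.
  by apply/funext => x; rewrite normc_cut// lt0r_neq0.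
have up : nm (j (el E u)) `^ p <= C `^ p * b' `^ (p / q).
  rewrite -uq -powRrM [q * _]mulrC divfK ?lt0r_neq0// -powRM ?nm_ge0 ?(ltW C0)//.
  by apply: powR_le (jC _) (ltW p0); exact: nm_ge0.
have kp : nm (j (el E v)) `^ p <= C `^ p.
  apply: powR_le (ltW p0); first exact: nm_ge0.
  by apply: le_trans (jC _) _; rewrite -[leRHS]mulr1 ler_wpM2l// ltW.
have zw := elt_np chE (fitsB chE zE wE); rewrite (eltB chE)// in zw.
have Cp2 : 0 <= Cy * 2 `^ p by rewrite mulr_ge0// powR_ge0.
have bnd := HI_D chE (HI_D chE vb (HI_Z chE tau0 (elt_np chE vE)))
  (HI_Z chE Cp2 (HI_D chE (elt_np chE uE) zw)).
have [b1 h2 b1le] : exists2 b1, HI E (fun x => normc (v x) `^ q *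
    \1_(~` (low v L `&` D `&` P)) x) b1 & b1 <= b + tau * nm (j (el E v)) `^ p +
     Cy * 2 `^ p * (nm (j (el E u)) `^ p + nm (j (el E z - el E w)) `^ p).
  apply: (HI_dom chE _ _ bnd).
  - apply: measurable_funM; first exact: measurable_normcp.
    by apply: measurable_indic; exact: measurableC.
  - by move=> x; rewrite mulr_ge0// powR_ge0.
  move=> x; rewrite [X in _ * X]indicE.
  have t1 : 0 <= normc (v x) `^ q * \1_(~` low v L) x by rewrite mulr_ge0// powR_ge0.
  have t2 : 0 <= tau * normc (v x) `^ p by rewrite mulr_ge0// powR_ge0.
  have t3 : 0 <= Cy * 2 `^ p * (normc (u x) `^ p + normc (z x - w x) `^ p).
    by rewrite mulr_ge0// addr_ge0// powR_ge0.
  case: (boolP (x \in _)) => [/set_mem nD|_]; last by rewrite mulr0 !addr_ge0.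
  rewrite mulr1; have [xA|xA] := pselect (low v L x); last first.
    by rewrite indicE mem_set// mulr1 -addrA lerDl addr_ge0.
  have zp : normc (z x) `^ p <= 2 `^ p * (normc (u x) `^ p + normc (z x - w x) `^ p).
    have [zw2|zw2] := leP (normc (z x)) (2 * normc (w x)).
      have -> : u x = w x.
        by rewrite /u indicE mem_set ?mul1r// => xD; exact: nD.
      apply: le_trans (powR_le (normc_ge0 _) zw2 (ltW p0)) _.
      rewrite powRM ?normc_ge0// ler_wpM2l ?powR_ge0//.
      by rewrite lerDl powR_ge0.
    have zd : normc (z x) <= 2 * normc (z x - w x).
      have := normcB_ge (z x) (w x); lra.
    apply: le_trans (powR_le (normc_ge0 _) zd (ltW p0)) _.
    rewrite powRM ?normc_ge0// ler_wpM2l ?powR_ge0//.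
    by rewrite lerDr powR_ge0.
  have vq : normc (v x) `^ q = normc (z x) `^ (p - 1) * normc (v x).
    by rewrite zlow// -powRrM divfK ?lt0r_neq0// powR_mulB1 ?normc_ge0.
  have zp' := ler_wpM2l Cy0 zp; rewrite mulrA in zp'.
  apply: (@le_trans _ _ (Cy * normc (z x) `^ p + tau * normc (v x) `^ p)).
    by rewrite vq; exact: yC (normc_ge0 _) (normc_ge0 _).
  by rewrite addrC; apply: lerD => //; rewrite lerDr.
exists (low v L `&` D `&` P), a1, b1; split => //.
apply: le_trans b1le _; apply: lerD; last first.
  by apply: ler_wpM2l => //; rewrite lerD2r.
by rewrite lerD2l ler_wpM2l.
Qed.

Let K1_gt0 : 0 < K1.
Proof. by rewrite mulr_gt0// (lt_le_trans ltr01). Qed.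

Lemma small_quotient (a e : R) : 0 <= a -> 0 < e -> exists2 t : R, 0 < t & a * t <= e.
Proof.
move=> a0 e0; exists (e / (a + 1)); first by rewrite divr_gt0// ltr_wpDl.
rewrite mulrCA ler_piMr ?(ltW e0)// ler_pdivrMr ?mul1r ?lerDl//.
by rewrite ltr_wpDl.
Qed.

Lemma large_power (a r : R) : 0 < a -> 0 < r -> exists2 L : R, 1 <= L & a <= L `^ r.
Proof.
move=> a0 r0; exists (Num.max 1 (a `^ r^-1)); first by rewrite le_max lexx.
have h := powR_ge0 a r^-1.
rewrite -[leLHS](@powRVK _ a r) ?lt0r_neq0 ?(ltW a0)//.
by apply: powR_le => //; [rewrite le_max lexx orbT|exact: ltW].
Qed.

Lemma budget (e1 Cg Ct tau X K0p G K1q b th m e2 nu : R) :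
  0 <= e1 -> 0 <= Cg -> 0 <= Ct -> 0 <= tau -> X <= K0p -> G <= K1q -> b <= th -> m <= e2 ->
  2 * K0p * e1 <= nu / 4 -> Cg * K1q * tau <= nu / 4 -> Cg * Ct * th <= nu / 4 ->
  Cg * e2 <= nu / 4 -> 2 * e1 * X + Cg * (m + Ct * b + tau * G) <= nu.
Proof.
move=> e10 Cg0 Ct0 tau0 XK GK bth me h1 h2 h3 h4.
have := ler_wpM2l e10 XK; have := ler_wpM2l (mulr_ge0 Cg0 tau0) GK.
have := ler_wpM2l (mulr_ge0 Cg0 Ct0) bth; have := ler_wpM2l Cg0 me.
rewrite !mulrDr; lra.
Qed.

Lemma budget' (b x y P th e : R) : b <= e / 4 -> x <= e / 4 ->
  y <= P * (th + th) -> P * th <= e / 4 -> b + x + y <= e.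
Proof. by move=> *; lra. Qed.

(** The constants are chosen in the order e1, Cg, tau, Ct, L, t, d:
    convexity first, then Young inequality, then the height L of the cut,
    and only then, since L bounds the norm of the test elements, the
    smoothness scale t and the tolerance d. *)
Lemma dual_estimate (nu tht : R) : 0 < nu -> 0 < tht -> exists L t d : R,
  [/\ 1 <= L, 0 < t, 0 < d & forall E v, chart E -> Fits E v ->
    nm (el E v) <= 1 -> nm (S (el E v) - el E v) <= d ->
    [/\ nm (j (el E (cutoff v L))) <= K0,
      exists2 b, HI E (fun x => normc (v x) `^ q * \1_(~` low v L) x) b & b <= tht &
      nm (j (el E (cutoff v L) - S (el E (cutoff v L)))) `^ p <= nu]].
Proof.
move=> nu0 tht00.
have K0p : 0 < K0 `^ p by rewrite powR_gt0// (lt_le_trans ltr01 K0_ge1).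
have nu4 : 0 < nu / 4 by rewrite divr_gt0.
have [e1 e10 e1P] := small_quotient (ltW (mulr_gt0 (@ltr0n R 2) K0p)) nu4.
have [Cg Cg0 gP] := gapc p1 e10.
have K1q : 0 <= Cg * K1 `^ q by rewrite mulr_ge0// powR_ge0.
have [tau tau0 tauP] := small_quotient K1q nu4.
have [Ct Ct0 yP] := young_small q1 tau0.
have [th th0 thP] := small_quotient (mulr_ge0 Cg0 Ct0) nu4.
pose ta := Num.min th tht; have ta0 : 0 < ta by rewrite lt_min th0.
have ta2 : 0 < ta / 2 by rewrite divr_gt0.
have [e2' e2'0 e2'P] := small_quotient Cg0 nu4.
pose m := Num.min (Num.min 1 (ta / 2)) e2'.
have m0 : 0 < m by rewrite !lt_min ltr01 ta2.
pose e2 := q * m; have e20 : 0 < e2 by rewrite mulr_gt0.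
have e2q : e2 / q = m by rewrite /e2 mulrAC divff ?mul1r// lt0r_neq0.
have [L L1 LP] : exists2 L : R, 1 <= L & C / (ta / 2) <= L `^ ((p - 1) / p).
  by apply: large_power; rewrite divr_gt0.
have L0 : 0 < L by exact: lt_le_trans L1.
have [t [d [t0 _ d0 NI]]] := almost_fixed_ineq q1 (Lp_smooth mu2 q1) S_q L1 e20.
exists L, t, d; split => // E v chE vE k1 kd.
have zE := cutoff_fits chE vE (ltW L0); have uE := high_fits L chE vE.
have kL : nm (el E v) <= L by exact: le_trans L1.
have NIz : perturbed (el E v) (el E (cutoff v L)) t e2.
  apply: NI => //; apply: le_trans (nm_el_le chE vE zE (ltW L0) _) _.
    by move=> x; exact: cutoff_le (ltW L0).
  by rewrite -[leRHS]mulr1 ler_wpM2l// ltW.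
have NIu : perturbed (el E v) (el E (fun x => (\1_(~` low v L) x)%:C * v x)) t e2.
  apply: NI => //; apply: le_trans (nm_el_le chE vE uE ler01 _) _.
    move=> x; rewrite normcM normc_real indicE; case: (_ \in _); first by rewrite normr1.
    by rewrite normr0 mul0r mul1r normc_ge0.
  by rewrite mul1r.
have m1 : m <= 1 by rewrite /m !ge_min lexx.
have m2 : m <= ta / 2 by rewrite /m !ge_min lexx orbT.
have m3 : m <= e2' by rewrite /m !ge_min lexx !orbT.
have gK0 : nm (j (el E (cutoff v L))) <= K0.
  by apply: cutoff_bound chE vE (ltW L0) t0 k1 NIz _; rewrite e2q.
have mA : measurable (~` low v L).
  by have [mv _ _] := vE; apply: measurableC; exact: low_meas.
have [b vb _] := HI_cut chE mA (elt_nm chE vE).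
have bta : b <= ta.
  apply: le_trans (tail_bound chE vE L0 t0 k1 NIu vb) _; rewrite e2q.
  have : C * (L `^ ((p - 1) / p))^-1 <= ta / 2.
    rewrite ler_pdivrMr ?powR_gt0//.
    by move: LP; rewrite ler_pdivrMr// mulrC.
  by move=> h; rewrite (splitr ta); exact: lerD.
have bta' : b <= th by rewrite (le_trans bta)// ge_min lexx.
split => //; first by exists b => //; rewrite (le_trans bta)// ge_min lexx orbT.
have [E' [w [chE' ext wE' wS]]] := chart_coord j_lat j_inj pq (S (el E (cutoff v L))) chE.
have [vE' vEq] := fits_extend (ltW q1) ext vE.
have [zE' zEq] := fits_extend (ltW q1) ext zE.
have vb' : HI E' (fun x => normc (v x) `^ q * \1_(~` low v L) x) b.
  exact/(HI_extend _ _ q0 ext vE).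
have NIz' : perturbed (el E' v) (el E' (cutoff v L)) t e2 by rewrite vEq zEq.
have wS' : el E' w = S (el E' (cutoff v L)) by rewrite zEq.
have := gap_estimate chE' vE' zE' wE' wS' t0 NIz' gP yP (ltW e10) Cg0 (ltW tau0) Ct0 vb'.
rewrite -!/(cutoff v L) zEq e2q => /le_trans -> //.
have X0 : nm (j (el E (cutoff v L))) `^ p <= K0 `^ p.
  by apply: powR_le (ltW p0); [exact: nm_ge0|exact: gK0].
have G0 : nm (S (el E (cutoff v L))) `^ q <= K1 `^ q.
  apply: powR_le (ltW q0); first exact: nm_ge0.
  by apply: le_trans (SC _) _; apply: ler_wpM2l => //; exact: ltW.
exact: budget (ltW e10) Cg0 Ct0 (ltW tau0) X0 G0 bta' m3 e1P tauP thP e2'P.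
Qed.

(** If k is almost fixed and g is its truncated dual, then S g / K1 is
    almost fixed and in the unit ball, so it is concentrated by hypothesis;
    concentration_set transfers this to k, multiplying the order by bt. *)
Lemma concentrated_step s I : 0 < s -> 0 <= I -> concentrated s I ->
  concentrated (bt * s) ((2 * K1) `^ s * I).
Proof.
move=> s0 I0 IH e e0.
have Cp : 0 < C `^ p by rewrite powR_gt0.
have e4 : 0 < e / 4 by rewrite divr_gt0.
have [tau tau0 tauP] := small_quotient (ltW Cp) e4.
have [Cy Cy0 yP] := young_small p1 tau0.
have [th th0 thP] := small_quotient (mulr_ge0 Cy0 (powR_ge0 2 p)) e4.
have K1q : 0 < K1 `^ q by rewrite powR_gt0.
pose e' := (th / C `^ p) `^ (q / p) / K1 `^ q.
have e'0 : 0 < e' by rewrite divr_gt0// powR_gt0// divr_gt0.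
have [d' d'0 IHd] := IH _ e'0.
pose nu := Num.min th ((d' * K1 / C) `^ p).
have nu0 : 0 < nu by rewrite lt_min th0 powR_gt0// divr_gt0// mulr_gt0.
have [L [t [d [L1 t0 d0 dP]]]] := dual_estimate nu0 e4.
exists d => // E v chE vE k1 kd.
have [gK0 [b vb b4] N_nu] := dP E v chE vE k1 kd.
have L0 : 0 <= L by rewrite (le_trans ler01).
have zE := cutoff_fits chE vE L0; set g := el E (cutoff v L) in gK0 N_nu.
have [E' [w [chE' ext wE' wS]]] := chart_coord j_lat j_inj pq (S g) chE.
have [vE' vEq] := fits_extend (ltW q1) ext vE.
have [zE' zEq] := fits_extend (ltW q1) ext zE.
pose w' x := (K1^-1)%:C * w x.
have w'E : Fits E' w' := fitsZ _ chE' wE'.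
have w'S : el E' w' = (K1^-1)%:C *: S g by rewrite eltZ// -wS.
have iK : 0 <= K1^-1 by rewrite invr_ge0 ltW.
have k'1 : nm (el E' w') <= 1.
  rewrite w'S nmZr ger0_norm// mulrC ler_pdivrMr// mul1r.
  by apply: le_trans (SC _) _; rewrite ler_wpM2l// ltW.
have k'd : nm (S (el E' w') - el E' w') <= d'.
  rewrite w'S linearZ -scalerBr nmZr ger0_norm// -linearB /=.
  rewrite mulrC ler_pdivrMr//; apply: le_trans (SC _) _.
  rewrite mulrC -ler_pdivlMr//; apply: (@powR_le_inv _ _ p) => //.
    by apply: divr_ge0; [apply: mulr_ge0|]; exact: ltW.
  rewrite -[S g - g]opprB linearN nmN; apply: le_trans N_nu _.
  by rewrite ge_min lexx orbT.
have [D [a' [b' [mD wa aI wb be]]]] := IHd E' w' chE' w'E k'1 k'd.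
have w'n x (r : R) : 0 < r -> normc (w x) `^ r = K1 `^ r * normc (w' x) `^ r.
  move=> r0; rewrite -powRM ?normc_ge0// ?(ltW K1_gt0)// /w' normcM normc_real.
  by rewrite ger0_norm// mulrA divff ?mul1r// lt0r_neq0.
have wa' : HI E' (fun x => normc (w x) `^ s * \1_D x) (K1 `^ s * a').
  have -> : (fun x => normc (w x) `^ s * \1_D x) =
      (fun x => K1 `^ s * (normc (w' x) `^ s * \1_D x)).
    by apply/funext => x; rewrite w'n// mulrA.
  by apply: HI_Z => //; exact: powR_ge0.
have wb' : HI E' (fun x => normc (w x) `^ q * \1_(~` D) x) (K1 `^ q * b').
  have -> : (fun x => normc (w x) `^ q * \1_(~` D) x) =
      (fun x => K1 `^ q * (normc (w' x) `^ q * \1_(~` D) x)).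
    by apply/funext => x; rewrite w'n// mulrA.
  by apply: HI_Z => //; exact: powR_ge0.
have k1' : nm (el E' v) <= 1 by rewrite vEq.
have vb' : HI E' (fun x => normc (v x) `^ q * \1_(~` low v L) x) b.
  exact/(HI_extend _ _ q0 ext vE).
have [D1 [a1 [b1 [mD1 h1 h2 h3 h4]]]] := concentration_set chE' vE' wE' L0 s0 (ltW tau0)
  Cy0 yP k1' mD vb' wa' wb'.
have bs0 : 0 < bt * s by rewrite mulr_gt0// divr_gt0.
have h1' := iffLR (HI_extend (\1_D1) a1 bs0 ext vE) h1.
have h3' := iffLR (HI_extend (\1_(~` D1)) b1 q0 ext vE) h3.
exists D1, a1, b1; split; [exact: mD1|exact: h1'| |exact: h3'|].
- apply: le_trans h2 _; rewrite mulrA -(powRM s _ (ltW K1_gt0))//.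
  by apply: ler_wpM2l => //; exact: powR_ge0.
have b'p : C `^ p * (K1 `^ q * b') `^ (p / q) <= th.
  have be' : K1 `^ q * b' <= (th / C `^ p) `^ (q / p).
    by move: be; rewrite /e' ler_pdivlMr// mulrC.
  have b'0 : 0 <= K1 `^ q * b' by apply: mulr_ge0; [exact: ltW|exact: HI_ge0 wb].
  have := powR_le b'0 be' (ltW (divr_gt0 p0 q0)).
  rewrite -powRrM mulrA divfK ?lt0r_neq0// divff ?lt0r_neq0// powRr1 ?(divr_ge0 (ltW th0) (ltW Cp))//.
  by rewrite ler_pdivlMr// mulrC.
have Nth : nm (j (el E' (cutoff v L) - el E' w)) `^ p <= th.
  by rewrite zEq -wS; apply: le_trans N_nu _; rewrite ge_min lexx.
apply: le_trans h4 _.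
have h5 : Cy * 2 `^ p * (C `^ p * (K1 `^ q * b') `^ (p / q) +
    nm (j (el E' (cutoff v L) - el E' w)) `^ p) <= Cy * 2 `^ p * (th + th).
  by apply: ler_wpM2l; [rewrite mulr_ge0// powR_ge0|exact: lerD].
rewrite [tau * _]mulrC; exact: budget' b4 tauP h5 thP.
Qed.

End concentration.

(** * Choices of signs *)

Section signs.
Context (R : realType).

Definition signed_sum (N : nat) (f : {ffun 'I_N -> bool}) (v : nat -> R[i]) : R[i] :=
  \sum_(i < N) (-1) ^+ (f i) * v i.

(** Choose the signs of the real parts or those of the imaginary parts. *)
Lemma sign_max (N : nat) (v : nat -> R[i]) :
  exists f : {ffun 'I_N -> bool}, \sum_(i < N) normc (v i) <= 2 * normc (signed_sum f v).
Proof.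
have ReD (f : {ffun 'I_N -> bool}) : complex.Re (signed_sum f v) =
    \sum_(i < N) (-1) ^+ (f i) * complex.Re (v i).
  rewrite /signed_sum; elim/big_ind2: _ => //[x1 x2 y1 y2 <- <-|i _].
    by case: x2 y2 => ? ? [].
  by case: (f i); rewrite ?expr1 ?expr0 ?mul1r ?mulN1r//; case: (v i).
have ImD (f : {ffun 'I_N -> bool}) : complex.Im (signed_sum f v) =
    \sum_(i < N) (-1) ^+ (f i) * complex.Im (v i).
  rewrite /signed_sum; elim/big_ind2: _ => //[x1 x2 y1 y2 <- <-|i _].
    by case: x2 y2 => ? ? [].
  by case: (f i); rewrite ?expr1 ?expr0 ?mul1r ?mulN1r//; case: (v i).
pose fr : {ffun 'I_N -> bool} := [ffun i : 'I_N => complex.Re (v i) < 0].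
pose fi : {ffun 'I_N -> bool} := [ffun i : 'I_N => complex.Im (v i) < 0].
have sgn (r : R) : (-1) ^+ (r < 0)%R * r = `|r|.
  by case: (ltP r 0) => h; rewrite ?expr1 ?expr0 ?mul1r ?mulN1r ?(ltr0_norm h) ?(ger0_norm h).
have hr : \sum_(i < N) `|complex.Re (v i)| <= normc (signed_sum fr v).
  apply: le_trans (Re_le_normc _); apply: le_trans (ler_norm _); rewrite ReD.
  by apply: ler_sum => i _; rewrite ffunE sgn.
have hi : \sum_(i < N) `|complex.Im (v i)| <= normc (signed_sum fi v).
  apply: le_trans (Im_le_normc _); apply: le_trans (ler_norm _); rewrite ImD.
  by apply: ler_sum => i _; rewrite ffunE sgn.
have h : \sum_(i < N) normc (v i) <= normc (signed_sum fr v) + normc (signed_sum fi v).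
  apply: le_trans (lerD hr hi); rewrite -big_split /=.
  by apply: ler_sum => i _; exact: normc_le_ReIm.
have [le|/ltW le] := leP (normc (signed_sum fr v)) (normc (signed_sum fi v)).
  by exists fi; lra.
by exists fr; lra.
Qed.

(** Flipping the i-th sign changes the sum by 2 v_i, so in each pair of sign
    choices that differ at i only, one sum has modulus at least |v_i|. *)
Lemma sign_half (N : nat) (v : nat -> R[i]) (i : 'I_N) (F : {ffun 'I_N -> bool} -> R) (a : R) :
  (forall f, 0 <= F f) -> (forall f, normc (v i) <= normc (signed_sum f v) -> a <= F f) ->
  (2 ^ N)%:R * a <= 2 * \sum_f F f.
Proof.
move=> F0 aF; pose flip (f : {ffun 'I_N -> bool}) : {ffun 'I_N -> bool} :=
  [ffun k => if k == i then ~~ f k else f k].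
have flipK : involutive flip.
  by move=> f; apply/ffunP => k; rewrite !ffunE; case: eqP => // _; rewrite negbK.
have pair f : a <= F f + F (flip f).
  have key : signed_sum f v - signed_sum (flip f) v = 2%:R * ((-1) ^+ f i * v i).
    rewrite /signed_sum -sumrB (bigD1 i)//= big1 ?addr0.
      by rewrite ffunE eqxx; case: (f i); rewrite /= ?expr1 ?expr0; ring.
    by move=> k /negbTE ki; rewrite ffunE ki subrr.
  have nkey : normc (2%:R * ((-1) ^+ f i * v i)) = 2 * normc (v i).
    have -> : (2%:R : R[i]) = (2 : R)%:C by rewrite rmorph_nat.
    rewrite normcM normc_real ger0_norm//; congr (_ * _).
    by case: (f i); rewrite ?expr1 ?expr0 ?mulN1r ?mul1r ?normcN.
  have h : 2 * normc (v i) <= normc (signed_sum f v) + normc (signed_sum (flip f) v).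
    by rewrite -nkey -key; apply: le_trans (normcD _ _) _; rewrite normcN.
  have [le|lt] := leP (normc (v i)) (normc (signed_sum f v)).
    by rewrite (le_trans (aF _ le))// lerDl.
  have le : normc (v i) <= normc (signed_sum (flip f) v) by lra.
  by rewrite (le_trans (aF _ le))// lerDr.
have -> : 2 * \sum_f F f = \sum_f (F f + F (flip f)).
  rewrite big_split /= mulrDl mul1r; congr (_ + _).
  by rewrite (reindex_inj (inv_inj flipK)).
have -> : (2 ^ N)%:R * a = \sum_(f : {ffun 'I_N -> bool}) a.
  by rewrite sumr_const card_ffun card_bool card_ord mulr_natl.
exact: ler_sum.
Qed.

End signs.

(** * Level sets of coordinates *)

Section level_sets.
Context (R : realType) (p q : R) (p1 : 1 < p) (q1 : 1 < q) (pq : p <> q).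
Context (d1 d2 : measure_display) (Om1 : measurableType d1) (Om2 : measurableType d2).
Variables (mu1 : {measure set Om1 -> \bar R}) (mu2 : {measure set Om2 -> \bar R}).
Variable j : {linear cLspace mu2 (ltW q1) -> cLspace mu1 (ltW p1)}.
Local Notation Y := (cLspace mu2 (ltW q1)).
Variable (C : R).
Hypotheses (C1 : 1 <= C) (jC : forall u, nm (j u) <= C * nm u).
Local Notation chart := (chart j).
Local Notation Fits E v := (fits q mu2 E v).
Local Notation el E v := (elt (ltW q1) mu2 E v).
Local Notation HI E f a := (hasI mu2 (fun x => E x `^ q) f a).
Implicit Types (E : Om2 -> R) (v z w : Om2 -> R[i]) (f r : Om2 -> R).

Let p0 : 0 < p. Proof. exact: lt_trans ltr01 p1. Qed.
Let q0 : 0 < q. Proof. exact: lt_trans ltr01 q1. Qed.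
Let C0 : 0 < C. Proof. exact: lt_le_trans ltr01 C1. Qed.

Definition level v (l : R) : set Om2 := [set x | l <= normc (v x)].

Lemma level_meas v l : cmeasurable v -> measurable (level v l).
Proof. by move=> mv; apply: measurable_le; [exact: measurable_cst|exact: measurable_normc]. Qed.

(** The indicator of a level set is itself a coordinate function with the
    same integral for both exponents; so boundedness of j reads a <= C^p
    a^(p/q) for its mass a. *)
Lemma level_mass E v l : chart E -> Fits E v -> 0 < l ->
  exists a, [/\ HI E (\1_(level v l)) a, a <= C `^ p * a `^ (p / q) &
    l `^ q * a <= nm (el E v) `^ q].
Proof.
move=> chE vE l0; have [mv v0 _] := vE; have mA := level_meas l mv.
pose u x : R[i] := (\1_(level v l) x)%:C.
have uE : Fits E u.
  apply: (fits_dom (c := l^-1) chE vE); first by apply: cmeasurable_real; exact: measurable_indic.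
  move=> x; rewrite /u normc_real indicE; case: (boolP (x \in _)) => [/set_mem h|_].
    by rewrite normr1 ler_pdivlMl// mulr1.
  by rewrite normr0 mulr_ge0 ?normc_ge0// invr_ge0 ltW.
have un (r : R) : 0 < r -> (fun x => normc (u x) `^ r) = \1_(level v l).
  move=> r0; apply/funext => x; rewrite /u normc_real indicE.
  by case: (_ \in _); rewrite ?normr1 ?powR1// normr0 powR0// lt0r_neq0.
have hq := elt_nm chE uE; have hp := elt_np chE uE.
rewrite un// in hq; rewrite un// in hp; have e := hasI_uniq hq hp.
exists (nm (el E u) `^ q); split; first exact: hq.
  rewrite {1}e -powRrM [q * _]mulrC divfK ?lt0r_neq0// -powRM ?nm_ge0 ?(ltW C0)//.
  by apply: powR_le (jC _) (ltW p0); exact: nm_ge0.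
have lq : 0 <= l `^ q by exact: powR_ge0.
apply: (HI_le chE (HI_Z chE lq hq) (elt_nm chE vE)) => x.
rewrite indicE; case: (boolP (x \in _)) => [/set_mem h|_]; last by rewrite mulr0 powR_ge0.
by rewrite mulr1 powR_le ?(ltW l0) ?(ltW q0).
Qed.

(** For p < q, a <= C^p a^(p/q) bounds a, uniformly in the level; let the
    level tend to 0. *)
Lemma support_mass : p < q -> exists2 M : R, 0 <= M & forall E v, chart E -> Fits E v ->
  exists2 m : R, HI E (\1_[set x | normc (v x) != 0]) m & m <= M.
Proof.
move=> lt_pq; have r0 : 0 < 1 - p / q by rewrite subr_gt0 ltr_pdivrMr ?mul1r.
have rn0 := lt0r_neq0 r0; have Cp : 0 < C `^ p by rewrite powR_gt0.
pose M := (C `^ p) `^ (1 - p / q)^-1.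
exists M; first exact: powR_ge0.
move=> E v chE vE; have [mv v0 _] := vE; have [mE E0 _] := chE.
have inv_gt0 n : 0 < (n.+1%:R^-1 : R) by rewrite invr_gt0.
have bound n a : HI E (\1_(level v n.+1%:R^-1)) a -> a <= M.
  move=> h; have [a' [h' le _]] := level_mass chE vE (inv_gt0 n).
  rewrite (hasI_uniq h h'); have a0 := HI_ge0 h'.
  have [->|an0] := eqVneq a' 0; first exact: powR_ge0.
  have agt : 0 < a' by rewrite lt_neqAle eq_sym an0.
  apply: (@powR_le_inv _ _ _ (1 - p / q)) => //; first exact: powR_ge0.
  rewrite powRVK// ?(ltW Cp)// powRB ?an0 ?implybT// powRr1//.
  by rewrite ler_pdivrMr ?powR_gt0.
pose F n x : \bar R := (\1_(level v n.+1%:R^-1) x * E x `^ q)%:E.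
have wm := wt_meas chE.
have mA := measurable_ne0 (measurable_normc mv).
have Fle n : (\int[mu2]_x F n x <= M%:E)%E.
  have [a [h _ _]] := level_mass chE vE (inv_gt0 n).
  have [_ _ ->] := h; rewrite lee_fin; exact: bound h.
have Fcvg : (\int[mu2]_x F n x)%E @[n --> \oo] -->
    (\int[mu2]_x limn (F ^~ x))%E.
  apply: cvg_monotone_convergence => //.
  - move=> n; apply/measurable_EFinP; apply: measurable_funM => //.
    by apply: measurable_indic; exact: level_meas.
  - by move=> n x _; rewrite lee_fin mulr_ge0// powR_ge0.
  - move=> x _ a b ab; rewrite lee_fin ler_wpM2r ?powR_ge0// !indicE.
    case: (boolP (x \in level v a.+1%:R^-1)) => [/set_mem h|_]; last by [].
    rewrite mem_set// /level /=; apply: le_trans h.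
    by rewrite lef_pV2 ?posrE// ler_nat.
have limF x : limn (F ^~ x) = (\1_[set x | normc (v x) != 0] x * E x `^ q)%:E.
  apply/cvg_lim => //; rewrite indicE; case: (boolP (x \in _)) => [/set_mem /= h|h].
    have vgt : 0 < normc (v x) by rewrite lt_neqAle normc_ge0 andbT eq_sym.
    apply: cvg_near_cst; exists (Num.bound (normc (v x))^-1) => // n /= nb.
    rewrite /F indicE mem_set// /level /= invf_ple ?posrE//.
    have /archi_boundP/ltW hb : 0 <= (normc (v x))^-1 by rewrite invr_ge0 ltW.
    by rewrite (le_trans hb)// ler_nat (leq_trans nb).
  apply: cvg_near_cst; apply: nearW => n; rewrite /F indicE memNset// /level /= => le.
  move/negP: h; apply; apply/mem_set => /=; rewrite gt_eqF//.
  by apply: lt_le_trans le; rewrite invr_gt0.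
have le : (\int[mu2]_x (\1_[set x | normc (v x) != 0] x * E x `^ q)%:E <= M%:E)%E.
  under eq_integral do rewrite -limF.
  rewrite -(cvg_lim _ Fcvg)//; apply: lime_le; first by apply/cvg_ex; eexists; exact: Fcvg.
  exact: nearW.
have ge : (0 <= \int[mu2]_x (\1_[set x | normc (v x) != 0] x * E x `^ q)%:E)%E.
  by apply: integral_ge0 => x _; rewrite lee_fin mulr_ge0// powR_ge0.
have fin : (\int[mu2]_x (\1_[set x | normc (v x) != 0] x * E x `^ q)%:E)%E \is a fin_num.
  by rewrite ge0_fin_numE// (le_lt_trans le)// ltry.
exists (fine (\int[mu2]_x (\1_[set x | normc (v x) != 0] x * E x `^ q)%:E)%E).
  by split; [exact: measurable_indic| |rewrite fineK].
by rewrite -lee_fin fineK.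
Qed.

Lemma hasI0_ae E f : chart E -> HI E f 0 -> {ae mu2, forall x, f x * E x `^ q = 0}.
Proof.
move=> chE [mf f0 int0]; have wm := wt_meas chE.
have mfe : measurable_fun setT (fun x => (f x * E x `^ q)%:E).
  by apply/measurable_EFinP; exact: measurable_funM.
have := iffLR (@ae_eq_integral_abs _ _ _ mu2 setT measurableT _ mfe).
have -> : (\int[mu2]_(x in setT) `|(f x * E x `^ q)%:E|)%E = 0%E.
  by apply: etrans int0; apply: eq_integral => x _; rewrite abse_EFin ger0_norm// mulr_ge0// powR_ge0.
by move=> /(_ erefl); apply: filterS => x /= /(_ I) -[].
Qed.

(** For q < p, a <= C^p a^(p/q) bounds from below every nonzero mass a,
    while high levels have small mass by Chebyshev inequality; so high level
    sets are null. *)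
Lemma sup_bound : q < p -> exists2 K : R, 0 < K & forall E v, chart E -> Fits E v ->
  {ae mu2, forall x, normc (v x) <= K * nm (el E v)}.
Proof.
move=> lt_qp; have r0 : 0 < p / q - 1 by rewrite subr_gt0 ltr_pdivlMr ?mul1r.
have rn0 := lt0r_neq0 r0; have Cp : 0 < C `^ p by rewrite powR_gt0.
pose m := ((C `^ p)^-1) `^ (p / q - 1)^-1.
have m0 : 0 < m by rewrite powR_gt0// invr_gt0.
have mi0 : 0 < (2 * m^-1) `^ q^-1 by rewrite powR_gt0// mulr_gt0// invr_gt0.
exists ((2 * m^-1) `^ q^-1) => // E v chE vE.
have [mv v0 _] := vE; have [mE E0 _] := chE.
have E_0 x : E x `^ q = 0 -> v x = 0 by move=> /powR_eq0_eq0; exact: v0.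
have [nm0|nmn0] := eqVneq (nm (el E v)) 0.
  have h := elt_nm chE vE; rewrite nm0 powR0 ?lt0r_neq0// in h.
  apply: filterS (hasI0_ae chE h) => x /eqP; rewrite mulf_eq0 => /orP[|] /eqP.
    by move=> /powR_eq0_eq0 ->; rewrite nm0 mulr0.
  by move=> /E_0 ->; rewrite normc0 nm0 mulr0.
have nmgt : 0 < nm (el E v) by rewrite lt_neqAle nm_ge0 andbT eq_sym.
set l := (2 * m^-1) `^ q^-1 * nm (el E v).
have l0 : 0 < l by rewrite mulr_gt0.
have [a [h le1 le2]] := level_mass chE vE l0.
have a0 := HI_ge0 h.
have [az|an0] := eqVneq a 0.
  rewrite az in h; apply: filterS (hasI0_ae chE h) => x.
  rewrite indicE; case: (boolP (x \in _)) => [_|/negP nl _].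
    by rewrite mul1r => /E_0 ->; rewrite normc0 ltW.
  by apply: ltW; rewrite ltNge; apply/negP => le; apply: nl; exact/mem_set.
have agt : 0 < a by rewrite lt_neqAle eq_sym an0.
exfalso.
have lq : l `^ q = 2 * m^-1 * nm (el E v) `^ q.
  by rewrite powRM ?nm_ge0 ?(ltW mi0)// powRVK ?lt0r_neq0// mulr_ge0// invr_ge0 ltW.
have am : a < m.
  move: le2; rewrite lq mulrAC -[leRHS]mul1r ler_pM2r ?powR_gt0// mulrAC ler_pdivrMr// mul1r.
  by move=> h2; apply: lt_le_trans h2; rewrite ltr_pMl// ltr1n.
have := powR_lt a0 am r0; rewrite powRVK ?invr_ge0 ?(ltW Cp)//.
rewrite powRB ?an0 ?implybT// powRr1// -ltr_pdivlMr ?invr_gt0 ?powR_gt0//.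
rewrite invrK => h2; have : a `^ (p / q) * C `^ p < a; last by rewrite mulrC ltNge le1.
by move: h2; rewrite ltr_pdivlMl// mulrC.
Qed.

End level_sets.

(** * Separated sequences of almost fixed elements *)

Section final.
Context (R : realType) (p q : R) (p1 : 1 < p) (q1 : 1 < q) (pq : p <> q).
Context (d1 d2 : measure_display) (Om1 : measurableType d1) (Om2 : measurableType d2).
Variables (mu1 : {measure set Om1 -> \bar R}) (mu2 : {measure set Om2 -> \bar R}).
Variable j : {linear cLspace mu2 (ltW q1) -> cLspace mu1 (ltW p1)}.
Hypotheses (j_lat : lattice_homomorphism j) (j_inj : injective j).
Local Notation Y := (cLspace mu2 (ltW q1)).
Variables (S : {linear Y -> Y}) (C : R).
Hypotheses (C1 : 1 <= C) (S_q : forall u, nm (S u) <= nm u)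
  (S_p : forall u, nm (j (S u)) <= nm (j u))
  (jC : forall u, nm (j u) <= C * nm u) (SC : forall u, nm (S u) <= C * nm (j u)).
Local Notation chart := (chart j).
Local Notation Fits E v := (fits q mu2 E v).
Local Notation el E v := (elt (ltW q1) mu2 E v).
Local Notation HI E f a := (hasI mu2 (fun x => E x `^ q) f a).
Local Notation conc s I := (concentrated j S s I).
Implicit Types (E : Om2 -> R) (v z w : Om2 -> R[i]) (s r I J : R).

Let p0 : 0 < p. Proof. exact: lt_trans ltr01 p1. Qed.
Let q0 : 0 < q. Proof. exact: lt_trans ltr01 q1. Qed.
Let pB : 0 < p - 1. Proof. by rewrite subr_gt0. Qed.
Let qB : 0 < q - 1. Proof. by rewrite subr_gt0. Qed.
Let C0 : 0 < C. Proof. exact: lt_le_trans ltr01 C1. Qed.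
Local Notation bt := ((q - 1) / (p - 1)).
Local Notation K := (2 * (C * ((C + 1) `^ (p - 1)^-1))).

Let bt0 : 0 < bt. Proof. by rewrite divr_gt0. Qed.

Let K_ge1 : 1 <= K.
Proof.
have h : 1 <= (C + 1) `^ (p - 1)^-1.
  have := @powR_le _ 1 (C + 1) (p - 1)^-1 ler01; rewrite powR1; apply.
    by rewrite lerDr ltW.
  by rewrite invr_ge0 ltW.
have : 1 * 1 <= C * (C + 1) `^ (p - 1)^-1 by apply: ler_pM.
lra.
Qed.

Let step s I : 0 < s -> 0 <= I -> conc s I -> conc (bt * s) (K `^ s * I).
Proof. exact: (concentrated_step pq j_lat j_inj C1 S_q S_p jC SC). Qed.

Lemma concentrated_le s (I J : R) : I <= J -> conc s I -> conc s J.
Proof.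
move=> IJ h e e0; have [d d0 dP] := h e e0; exists d => // E v chE vE k1 kd.
have [D [a [b [mD ha aI hb be]]]] := dP E v chE vE k1 kd.
by exists D, a, b; split; [exact: mD|exact: ha|exact: le_trans IJ|exact: hb|exact: be].
Qed.

(** The bound F s is obtained by solving the recursion F (bt s) = K^s F s
    with F q = 1. *)
Let iterate (F : R -> R) : F q = 1 -> (forall s : R, 0 < s -> 0 <= F s) ->
  (forall s : R, 0 < s -> K `^ s * F s = F (bt * s)) ->
  forall n : nat, conc (bt ^+ n * q) (F (bt ^+ n * q)).
Proof.
move=> Fq F0 FS; elim=> [|n ih].
  by rewrite expr0 mul1r Fq; exact: concentrated0.
have s0 : 0 < bt ^+ n * q by rewrite mulr_gt0// exprn_gt0.
rewrite exprS -mulrA -FS//; apply: step => //; exact: F0.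
Qed.

(** Here bt > 1, so the orders bt^n q tend to +oo, and K^s = L^(bt s - s)
    telescopes to a bound L^s that is homogeneous in s: v behaves like a
    function bounded by L. *)
Lemma concentrated_high : p < q -> exists2 L : R, 0 < L & forall r, exists s,
  [/\ r <= s, 1 <= s & conc s (L `^ s)].
Proof.
move=> lt_pq; have bt1 : 1 < bt by rewrite ltr_pdivlMr// mul1r; lra.
have btB : 0 < bt - 1 by rewrite subr_gt0.
have Kgt : 0 < K by exact: lt_le_trans ltr01 K_ge1.
pose L := K `^ (bt - 1)^-1; have L0 : 0 < L by rewrite powR_gt0.
have L1 : 1 <= L.
  have := powR_le ler01 K_ge1 (_ : 0 <= (bt - 1)^-1); rewrite powR1; apply.
  by rewrite invr_ge0 ltW.
exists L => // r.
have h := @iterate (fun s => L `^ (s - q)).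
have {}h n : conc (bt ^+ n * q) (L `^ (bt ^+ n * q)).
  apply: concentrated_le (h _ _ _ n).
  - by apply: ler_powR => //; rewrite gerBl ltW.
  - by rewrite subrr powRr0.
  - by move=> s s0; exact: powR_ge0.
  - move=> s s0; have -> : K `^ s = L `^ (bt * s - s).
      by rewrite -[X in bt * s - X]mul1r -mulrBl /L -powRrM mulKf// lt0r_neq0.
    by rewrite -powRDp//; congr (_ `^ _); ring.
pose n := Num.bound (`|r| / (bt - 1)).
have rn : `|r| / (bt - 1) < n%:R by apply: archi_boundP; rewrite divr_ge0// ltW.
have bn : 1 + n%:R * (bt - 1) <= bt ^+ n.
  elim: (n) => [|m ih]; first by rewrite mul0r addr0.
  have m0 : 0 <= (m%:R * (bt - 1)) * (bt - 1) by rewrite !mulr_ge0// ltW.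
  rewrite exprS -natr1; have := ler_wpM2l (ltW bt0) ih.
  by apply: le_trans; lra.
exists (bt ^+ n * q); split => //; last first.
  have b1 : 1 <= bt ^+ n by rewrite exprn_ege1// ltW.
  by rewrite -[leLHS]mulr1; apply: ler_pM => //; exact: ltW.
apply: le_trans (ler_norm _) _.
have h2 : `|r| <= bt ^+ n.
  by apply: le_trans bn; move: rn; rewrite ltr_pdivrMr// => /ltW; lra.
by apply: le_trans h2 _; rewrite ler_peMr ?exprn_ge0 ?(ltW bt0)// ltW.
Qed.

(** Here bt < 1, so the orders bt^n q tend to 0, while the bounds L^(q - s)
    stay below L^q. *)
Lemma concentrated_low : q < p -> exists2 I : R, 0 < I & forall r, 0 < r -> exists s,
  [/\ 0 < s, s <= r & conc s I].
Proof.
move=> lt_qp; have bt1 : bt < 1 by rewrite ltr_pdivrMr// mul1r; lra.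
have btB : 0 < 1 - bt by rewrite subr_gt0.
have Kgt : 0 < K by exact: lt_le_trans ltr01 K_ge1.
pose L := K `^ (1 - bt)^-1; have L0 : 0 < L by rewrite powR_gt0.
have L1 : 1 <= L.
  have := powR_le ler01 K_ge1 (_ : 0 <= (1 - bt)^-1); rewrite powR1; apply.
  by rewrite invr_ge0 ltW.
exists (L `^ q); first by rewrite powR_gt0.
move=> r r0.
have h := @iterate (fun s => L `^ (q - s)).
have {}h n : conc (bt ^+ n * q) (L `^ q).
  apply: concentrated_le (h _ _ _ n).
  - by apply: ler_powR => //; rewrite gerBl mulr_ge0 ?exprn_ge0// ltW.
  - by rewrite subrr powRr0.
  - by move=> s s0; exact: powR_ge0.
  - move=> s s0; have -> : K `^ s = L `^ (s - bt * s).
      by rewrite -[X in X - bt * s]mul1r -mulrBl /L -powRrM mulKf// lt0r_neq0.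
    by rewrite -powRDp//; congr (_ `^ _); ring.
have : (fun n => bt ^+ n : R) @ \oo --> (0 : R).
  by apply: cvg_expr; rewrite ger0_norm// ltW.
move=> /cvgrPdist_lt/(_ _ (divr_gt0 r0 q0)) [n _ /(_ n (leqnn n))] /=.
rewrite sub0r normrN ger0_norm ?exprn_ge0 ?(ltW bt0)// ltr_pdivlMr// => /ltW le.
by exists (bt ^+ n * q); split => //; rewrite mulr_gt0// exprn_gt0.
Qed.

(** signed_sums provides differences y_i whose signed sums have norm at most
    B = 2 N / k. As N is fixed before s and e, the indices can be taken so
    large that the rescaled signed sums are as fixed as concentration of
    order s requires. The image under S keeps the y_i away from 0 for the
    seminorm |j _|_p. *)
Lemma signed_concentration (x : nat -> Y) (dl : R) (k : nat) :
  (0 < k)%N -> 0 < dl -> (forall n, nm (x n) <= 1) ->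
  (forall m n, (m < n)%N -> dl <= nm (x m - x n)) ->
  (forall e : R, 0 < e -> exists n0, forall n, (n0 <= n)%N -> nm (S (x n) - x n) <= e) ->
  exists2 N : nat, (0 < N)%N & forall s I e : R, 0 < s -> conc s I -> 0 < e ->
  exists E (v : nat -> Om2 -> R[i]), [/\ chart E,
    forall i, (i < N)%N -> [/\ Fits E (v i), nm (el E (v i)) <= 2 &
      dl / (2 * C) <= nm (j (el E (v i)))] &
    forall f : {ffun 'I_N -> bool}, [/\ Fits E (fun t => signed_sum f (v ^~ t)),
      nm (el E (fun t => signed_sum f (v ^~ t))) <= 2 * N%:R / k%:R &
      exists (D : set Om2) (a b : R), [/\ measurable D,
        HI E (fun t => normc (signed_sum f (v ^~ t)) `^ s * \1_D t) a,
        a <= (2 * N%:R / k%:R) `^ s * I,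
        HI E (fun t => normc (signed_sum f (v ^~ t)) `^ q * \1_(~` D) t) b & b <= e]]].
Proof.
move=> k0 dl0 x1 xd xS; have kR : 0 < k%:R :> R by rewrite ltr0n.
have [N N0 NP] := signed_sums q1 (Lp_smooth mu2 q1) k0 x1.
exists N => // s I e s0 cI e0; have NR : 0 < N%:R :> R by rewrite ltr0n.
pose B : R := 2 * N%:R / k%:R; have B0 : 0 < B by rewrite divr_gt0// mulr_gt0.
have Bq : 0 < B `^ q by rewrite powR_gt0.
have [d d0 dP] := cI _ (divr_gt0 e0 Bq).
(* Each y_i is fixed up to 2 e1; a signed sum divided by B is then fixed up
   to 2 N e1 / B <= d. *)
pose e1 := Num.min (dl / 4) (d * B / (2 * N%:R)).
have e10 : 0 < e1 by rewrite lt_min (divr_gt0 dl0)// divr_gt0// mulr_gt0.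
have [n0 n0P] := xS _ e10.
have [a [b [ab abP]]] := NP n0.
pose y i := x (a i) - x (b i).
have [E [v [chE vE]]] := chart_seq j_lat j_inj pq y N.
have ySe i : nm (S (y i) - y i) <= 2 * e1.
  have [na ltab] := ab i; have nb : (n0 <= b i)%N by exact: leq_trans na (ltnW ltab).
  have -> : S (y i) - y i = (S (x (a i)) - x (a i)) - (S (x (b i)) - x (b i)).
    by rewrite /y linearB /= !opprD addrACA.
  apply: le_trans (nmB _ _) _; have := n0P _ na; have := n0P _ nb; lra.
exists E, v; split => //.
  move=> i iN; have [vi yi] := vE i iN; have [na ltab] := ab i.
  split => //; rewrite -yi.
    by apply: le_trans (nmB _ _) _; have := x1 (a i); have := x1 (b i); lra.
  rewrite ler_pdivrMr ?mulr_gt0//.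
  have h1 : dl <= nm (y i) by exact: xd.
  have h2 : nm (y i) <= nm (S (y i)) + 2 * e1.
    have := nmBl (y i) (S (y i)); rewrite nmBC; have := ySe i; lra.
  have h3 : e1 <= dl / 4 by rewrite ge_min lexx.
  have h4 := SC (y i); rewrite mulrC -mulrA; lra.
move=> f; pose h t := signed_sum f (v ^~ t).
have tE (i : 'I_N) : Fits E (fun t => (-1) ^+ f i * v i t).
  by apply: fitsZ chE _; have [] := vE i (ltn_ord i).
have [hE hel] := fits_sum (index_enum 'I_N) chE tE.
have {}hel : el E h = \sum_(i < N) (-1) ^+ f i *: y i.
  rewrite [LHS]hel; apply: eq_bigr => i _; have [vi yi] := vE i (ltn_ord i).
  by rewrite eltZ// -yi.
have hnm : nm (el E h) <= B by rewrite hel; exact: abP.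
have hS : nm (S (el E h) - el E h) <= N%:R * (2 * e1).
  rewrite hel linear_sum -sumrB; apply: le_trans (nm_sum _) _.
  rewrite mulrC -[in leRHS](card_ord N) mulr_natr -sumr_const; apply: ler_sum => i _.
  rewrite linearZ -scalerBr /=; apply: le_trans (ySe i).
  by case: (f i); rewrite ?expr1 ?expr0 ?scale1r ?scaleN1r ?nmN.
pose h' t := (B^-1)%:C * h t.
have h'E : Fits E h' := fitsZ _ chE hE.
have h'el : el E h' = (B^-1)%:C *: el E h by rewrite eltZ.
have iB : 0 <= B^-1 by rewrite invr_ge0 ltW.
have h'1 : nm (el E h') <= 1.
  by rewrite h'el nmZr ger0_norm// ler_pdivrMl// mulr1.
have h'd : nm (S (el E h') - el E h') <= d.
  rewrite h'el linearZ -scalerBr nmZr ger0_norm//= ler_pdivrMl//.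
  apply: le_trans hS _; have : e1 <= d * B / (2 * N%:R) by rewrite ge_min lexx orbT.
  rewrite ler_pdivlMr ?mulr_gt0//; rewrite [B * d]mulrC; apply: le_trans.
  by rewrite le_eqVlt; apply/orP; left; apply/eqP; ring.
have [D [a1 [b1 [mD ha aI hb be]]]] := dP E h' chE h'E h'1 h'd.
have hn t (r : R) : normc (h t) `^ r = B `^ r * normc (h' t) `^ r.
  rewrite -powRM ?normc_ge0// ?(ltW B0)// /h' normcM normc_real.
  by rewrite ger0_norm// mulrA divff ?mul1r// lt0r_neq0.
split => //; exists D, (B `^ s * a1), (B `^ q * b1); split.
- exact: mD.
- have -> : (fun t => normc (signed_sum f (v ^~ t)) `^ s * \1_D t) =
      (fun t => B `^ s * (normc (h' t) `^ s * \1_D t)).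
    by apply/funext => t; rewrite mulrA -hn.
  by apply: HI_Z chE _ ha; exact: powR_ge0.
- by apply: ler_wpM2l => //; exact: powR_ge0.
- have -> : (fun t => normc (signed_sum f (v ^~ t)) `^ q * \1_(~` D) t) =
      (fun t => B `^ q * (normc (h' t) `^ q * \1_(~` D) t)).
    by apply/funext => t; rewrite mulrA -hn.
  by apply: HI_Z chE _ hb; exact: powR_ge0.
- by move: be; rewrite ler_pdivlMr// mulrC.
Qed.

Definition separated_fixed (x : nat -> Y) (dl : R) := [/\ 0 < dl, forall n, nm (x n) <= 1,
  forall m n, (m < n)%N -> dl <= nm (x m - x n) &
  forall e : R, 0 < e -> exists n0, forall n, (n0 <= n)%N -> nm (S (x n) - x n) <= e].

(** F f is the excess of the signed sum over the level l; sign_max needs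
    only one of them. *)
Lemma high_pointwise (N : nat) (v : nat -> R[i]) (F : {ffun 'I_N -> bool} -> R) (l : R) :
  0 <= l -> (forall f, 0 <= F f) -> (forall f, normc (signed_sum f v) <= l + F f) ->
  \sum_(i < N) normc (v i) <= 2 * (l + \sum_f F f).
Proof.
move=> l0 F0 HF; have [f fP] := sign_max N v; apply: le_trans fP _.
rewrite ler_wpM2l//; apply: le_trans (HF f) _; rewrite lerD2l.
by rewrite (bigD1 f)//= lerDl sumr_ge0.
Qed.

Lemma half_budget (x y z w : R) : x <= y -> y <= w + z -> w <= x / 2 -> x / 2 <= z.
Proof. by move=> *; lra. Qed.

(** Each signed sum is at most la, twice the level L B of concentrated_high,
    plus an excess whose integral carries a factor 2^-r. As r >= N, this
    factor pays for the 2^N choices of signs. Integration over the support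
    of the coordinates, of mass at most M, bounds the sum of the
    L^1(m)-norms z i by a multiple of N / k; interp_small bounds them below
    by a multiple of N. *)
Lemma not_separated_high x dl : p < q -> separated_fixed x dl -> False.
Proof.
move=> lt_pq [dl0 x1 xd xS].
have [L L0 LP] := concentrated_high lt_pq.
have [M M0 MP] := support_mass C1 jC lt_pq.
pose c := dl / (2 * C); have c0 : 0 < c by rewrite divr_gt0// mulr_gt0.
have cp : 0 < c `^ p by rewrite powR_gt0.
have tau0 : 0 < c `^ p / (2 * 2 `^ q) by rewrite divr_gt0// mulr_gt0// powR_gt0.
have [Ct Ct0 CtP] := interp_small p1 lt_pq tau0.
(* The final comparison is between N c^p / 2 and 8 Ct L (M + 3) N / k. *)
pose k := (Num.bound (16 * Ct * L * (M + 3) / c `^ p)).+1.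
have kP : 16 * Ct * L * (M + 3) < k%:R * c `^ p.
  rewrite -ltr_pdivrMr//; have /archi_boundP h : 0 <= 16 * Ct * L * (M + 3) / c `^ p.
    by rewrite divr_ge0 ?(ltW cp)// !mulr_ge0 ?(ltW L0)// addr_ge0.
  by apply: lt_le_trans h _; rewrite ler_nat.
have [N N0 NP] := signed_concentration (isT : (0 < k)%N) dl0 x1 xd xS.
have NR : 0 < N%:R :> R by rewrite ltr0n.
have kR : 0 < k%:R :> R by rewrite ltr0n.
have [r [rN r1 cI]] := LP N%:R.
pose B : R := 2 * N%:R / k%:R; have B0 : 0 < B by rewrite divr_gt0// mulr_gt0.
pose la := 2 * (L * B); have la0 : 0 < la by rewrite mulr_gt0// mulr_gt0.
pose P : R := (2 ^ N)%:R; have P0 : 0 < P by rewrite ltr0n expn_gt0.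
have [sg sg0 sgP] := small_quotient (mulr_ge0 (ltW P0) M0) la0.
have [e e0 eP] := small_quotient (mulr_ge0 (ltW P0) (powR_ge0 sg (1 - q))) la0.
have r0 : 0 < r by exact: lt_le_trans ltr01 r1.
have [E [v [chE vE HE]]] := NP r _ e r0 cI e0.
have HE3 f := let: And3 _ _ h := HE f in h.
have [D DP] := choice HE3; have [a aP] := choice DP; have [b bP] := choice aP.
have w0 (t : Om2) : 0 <= E t `^ q by exact: powR_ge0.
have nE (i : 'I_N) : Fits E (fun t => (normc (v i t))%:C).
  have [vi _ _] := vE i (ltn_ord i); have [mv _ _] := vi.
  apply: (fits_dom (c := 1) chE vi); first by apply: cmeasurable_real; exact: measurable_normc.
  by move=> t; rewrite mul1r normc_real ger0_norm// normc_ge0.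
have [VE _] := fits_sum (index_enum 'I_N) chE nE.
set V := (fun t => _) in VE.
have Vn t : normc (V t) = \sum_(i < N) normc (v i t).
  rewrite /V -rmorph_sum normc_real ger0_norm// sumr_ge0// => i _; exact: normc_ge0.
have [m hm mM] := MP E V chE VE; set ch := (\1_ _ : Om2 -> R) in hm.
have chi t : V t <> 0 -> ch t = 1.
  by move=> Vt; rewrite /ch indicE mem_set//=; apply/eqP => /eq0_normc.
have ch0 t : 0 <= ch t by rewrite /ch indicE.
have V0 t : V t = 0 -> forall i : 'I_N, normc (v i t) = 0.
  move=> Vt i; have := Vn t; rewrite Vt normc0 => /esym/eqP.
  rewrite psumr_eq0; last by move=> *; exact: normc_ge0.
  by move=> /allP /(_ i (mem_index_enum _)) /eqP.
have zex (i : 'I_N) : exists z : R, HI E (fun t => normc (v i t)) z.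
  have [vi _ _] := vE i (ltn_ord i); have [mv _ _] := vi.
  have [] := HI_dom chE (measurable_normc mv) (fun t => normc_ge0 _)
    (HI_D chE hm (elt_nm chE vi)).
    move=> t; have [Vt|/eqP Vt] := eqVneq (V t) 0.
      by rewrite V0// addr_ge0// powR_ge0.
    rewrite chi//; have := linear_le_powR ltr01 (ltW q1) (normc_ge0 (v i t)).
    by rewrite powR1 mul1r.
  by move=> z hz _; exists z.
have [z zP] := choice zex.
have hz := hasI_sum (wt_meas chE) w0 (index_enum 'I_N) zP.
pose F f t := la `^ (1 - r) * (normc (signed_sum f (v ^~ t)) `^ r * \1_(D f) t) +
  (sg * ch t + sg `^ (1 - q) * (normc (signed_sum f (v ^~ t)) `^ q * \1_(~` D f) t)).
have hF f : HI E (F f) (la `^ (1 - r) * a f + (sg * m + sg `^ (1 - q) * b f)).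
  have [_ ha _ hb _] := bP f.
  exact: HI_D chE (HI_Z chE (powR_ge0 _ _) ha) (HI_D chE (HI_Z chE (ltW sg0) hm)
    (HI_Z chE (powR_ge0 _ _) hb)).
have F0 f t : 0 <= F f t.
  by rewrite /F !addr_ge0// !mulr_ge0// ?powR_ge0// ltW.
have hub := HI_Z chE (ler0n _ 2) (HI_D chE (HI_Z chE (ltW la0) hm)
  (hasI_sum (wt_meas chE) w0 (index_enum {ffun 'I_N -> bool}) hF)).
have ub : \sum_(i < N) z i <= 2 * (la * m + \sum_f (la `^ (1 - r) * a f + (sg * m + sg `^ (1 - q) * b f))).
  apply: (HI_le chE hz hub) => t.
  have [Vt|/eqP Vt] := eqVneq (V t) 0.
    rewrite big1 => [|i _]; last by rewrite V0.
    by rewrite mulr_ge0// addr_ge0 ?sumr_ge0// mulr_ge0// ltW.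
  have := @high_pointwise N (v ^~ t) (F ^~ t) (la * ch t); apply => //.
    by rewrite mulr_ge0// ltW.
  move=> f; rewrite /F chi// !mulr1; set H := normc _.
  have H0 : 0 <= H by exact: normc_ge0.
  have [tD|tD] := pselect (D f t).
    rewrite indicE mem_set// mulr1 indicE memNset; last by move=> nD; exact: nD.
    rewrite !mulr0 addr0 addrA; apply: le_trans (linear_le_powR la0 r1 H0) _.
    by rewrite lerDl ltW.
  rewrite indicE memNset// indicE mem_set// !mulr0 mulr1 add0r addrA.
  apply: le_trans (linear_le_powR sg0 (ltW q1) H0) _.
  by rewrite -addrA lerDr ltW.
have lb (i : 'I_N) : c `^ p / 2 <= Ct * z i.
  have [vi v2 vj] := vE i (ltn_ord i).
  have h1 : c `^ p <= nm (j (el E (v i))) `^ p by apply: powR_le vj (ltW p0); exact: ltW.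
  have h2 := HI_le chE (elt_np chE vi) (HI_D chE (HI_Z chE (ltW tau0) (elt_nm chE vi))
    (HI_Z chE Ct0 (zP i))) (fun t => CtP _ (normc_ge0 _)).
  have h3 : nm (el E (v i)) `^ q <= 2 `^ q by apply: powR_le v2 (ltW q0); exact: nm_ge0.
  have h4 := ler_wpM2l (ltW tau0) h3.
  have h5 : c `^ p / (2 * 2 `^ q) * 2 `^ q = c `^ p / 2.
    by field; rewrite lt0r_neq0// powR_gt0.
  by rewrite h5 in h4; exact: half_budget h1 h2 h4.
have lbN : N%:R * (c `^ p / 2) <= Ct * \sum_(i < N) z i.
  by rewrite mulr_sumr mulr_natl -[X in _ *+ X](card_ord N) -sumr_const ler_sum.
(* The three parts of the excess F f: inside D f, where |.| <= la + la^(1-r)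
   |.|^r and the integral of |.|^r is at most (la / 2)^r; the constant sg on
   the support; and the q-mass outside D f. *)
have term f : la `^ (1 - r) * a f + (sg * m + sg `^ (1 - q) * b f) <= 3 * la / P.
  have [_ _ af _ bf] := bP f.
  have h1 : la `^ (1 - r) * a f <= la / P.
    apply: le_trans (ler_wpM2l (powR_ge0 _ _) af) _.
    rewrite -/B -powRM ?(ltW B0) ?(ltW L0)//.
    have -> : B * L = la * 2^-1 by rewrite /la; field.
    rewrite powRM ?(ltW la0)// mulrA -powRDp// subrK powRr1 ?(ltW la0)//.
    rewrite ler_wpM2l ?(ltW la0)// -powR_inv1// -powRrM mulN1r powRN.
    rewrite lef_pV2 ?posrE ?powR_gt0// /P natrX -powR_mulrn//.
    by apply: ler_powR => //; rewrite ler1n.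
  have h2 : sg * m <= la / P.
    apply: le_trans (ler_wpM2l (ltW sg0) mM) _.
    by rewrite ler_pdivlMr// (_ : sg * M * P = P * M * sg)//; ring.
  have h3 : sg `^ (1 - q) * b f <= la / P.
    apply: le_trans (ler_wpM2l (powR_ge0 _ _) bf) _.
    by rewrite ler_pdivlMr// (_ : _ * e * P = P * sg `^ (1 - q) * e)//; ring.
  by have -> : 3 * la / P = la / P + (la / P + la / P) by [field; exact: lt0r_neq0]; rewrite !lerD.
have tot : \sum_f (la `^ (1 - r) * a f + (sg * m + sg `^ (1 - q) * b f)) <= 3 * la.
  apply: (@le_trans _ _ (\sum_(f : {ffun 'I_N -> bool}) 3 * la / P)).
    by apply: ler_sum => f _; exact: term.
  by rewrite sumr_const card_ffun card_bool card_ord -(mulr_natr (3 * la / P)) -/P divfK// lt0r_neq0.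
have zub : \sum_(i < N) z i <= 2 * (la * M + 3 * la).
  apply: le_trans ub _; apply: ler_wpM2l => //; apply: lerD => //.
  by apply: ler_wpM2l => //; exact: ltW.
have := le_trans lbN (ler_wpM2l Ct0 zub).
rewrite leNgt => /negP; apply.
have -> : Ct * (2 * (la * M + 3 * la)) = N%:R / 2 * (16 * Ct * L * (M + 3) / k%:R).
  by rewrite /la /B; field; exact: lt0r_neq0.
have -> : N%:R * (c `^ p / 2) = N%:R / 2 * c `^ p by ring.
by rewrite ltr_pM2l ?divr_gt0// ltr_pdivrMr// mulrC [X in _ < X]mulrC mulrC.
Qed.

(** The terms with small q-th power are put aside. For the mean Z of the
    others, Z <= z and Z^s <= G give Z <= z^(1-s) G. *)
Lemma low_pointwise (N : nat) (v : nat -> R[i]) (A z s Bq G : R) : (0 < N)%N ->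
  q < p -> 0 < s -> s < 1 -> 0 <= A -> 0 <= z -> 0 <= Bq -> 0 <= G ->
  (forall i, (i < N)%N -> normc (v i) <= A) -> \sum_(i < N) normc (v i) <= N%:R * z ->
  (forall i, (i < N)%N -> normc (v i) `^ q <= Bq \/ normc (v i) `^ s <= G) ->
  \sum_(i < N) normc (v i) `^ p <= N%:R * (A `^ (p - q) * Bq + A `^ (p - 1) * (z `^ (1 - s) * G)).
Proof.
move=> N0 lt_qp s0 s1 A0 z0 Bq0 G0 vA vz vBG; have NR : 0 < N%:R :> R by rewrite ltr0n.
pose g (i : nat) := if normc (v i) `^ q <= Bq then 0 else normc (v i).
have g0 i : 0 <= g i by rewrite /g; case: ifP => // _; exact: normc_ge0.
have gv i : g i <= normc (v i) by rewrite /g; case: ifP => // _; exact: normc_ge0.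
have pq0 : 0 <= p - q by rewrite subr_ge0 ltW.
have h1 i : (i < N)%N -> normc (v i) `^ p <= A `^ (p - q) * Bq + A `^ (p - 1) * g i.
  move=> iN; have n0 := normc_ge0 (v i); rewrite /g; case: ifP => [le|_].
    have -> : normc (v i) `^ p = normc (v i) `^ (p - q) * normc (v i) `^ q.
      by rewrite -powRD ?subrK// (gt_eqF p0).
    rewrite mulr0 addr0; apply: ler_pM => //; rewrite ?powR_ge0//.
    by apply: powR_le => //; exact: vA.
  apply: (@le_trans _ _ (A `^ (p - 1) * normc (v i))); last first.
    by rewrite lerDr mulr_ge0// powR_ge0.
  rewrite -(powR_mulB1 n0 p0) ler_wpM2r//; apply: powR_le => //; last exact: ltW.
  exact: vA.
pose Z := (\sum_(i < N) g i) / N%:R.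
have Z0 : 0 <= Z by rewrite divr_ge0 ?sumr_ge0// ltW.
have ZN : \sum_(i < N) g i = N%:R * Z by rewrite mulrC divfK// lt0r_neq0.
have Zz : Z <= z.
  rewrite ler_pdivrMr// mulrC; apply: le_trans vz; apply: ler_sum => i _; exact: gv.
have ZG : Z `^ s <= G.
  have h : Z <= G `^ s^-1.
    rewrite ler_pdivrMr// mulr_natr -[X in _ *+ X](card_ord N) -sumr_const.
    apply: ler_sum => i _; rewrite /g; case: ifP => [_|nB]; first exact: powR_ge0.
    apply: (@powR_le_inv _ _ _ s) => //; first exact: powR_ge0.
    rewrite powRVK ?lt0r_neq0//; case: (vBG i (ltn_ord i)) => //.
    by rewrite nB.
  by have := powR_le Z0 h (ltW s0); rewrite powRVK// lt0r_neq0.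
have ZzG : Z <= z `^ (1 - s) * G.
  have [->|Zn] := eqVneq Z 0; first by rewrite mulr_ge0 ?powR_ge0.
  rewrite -[leLHS]powRr1// -[X in _ `^ X](subrK s) powRD ?Zn ?implybT//.
  apply: ler_pM; rewrite ?powR_ge0//; apply: powR_le => //.
  by rewrite subr_ge0 ltW.
apply: (@le_trans _ _ (\sum_(i < N) (A `^ (p - q) * Bq + A `^ (p - 1) * g i))).
  by apply: ler_sum => i _; exact: h1.
rewrite big_split /= sumr_const card_ord -(mulr_natl (A `^ (p - q) * Bq)) -mulr_sumr ZN.
rewrite [leRHS]mulrDr lerD2l.
by rewrite mulrCA ler_wpM2l ?(ltW NR)// ler_wpM2l ?powR_ge0.
Qed.

(** The alternative of low_pointwise: either one of the signed sums outside
    its concentration set X f is at least |v_i|, or half of all the signed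
    sums are so inside X f, by sign_half. *)
Lemma low_at (N : nat) (v : nat -> R[i]) (A z s : R) (X : {ffun 'I_N -> bool} -> bool) :
  (0 < N)%N -> q < p -> 0 < s -> s < 1 -> 0 <= A -> 0 <= z ->
  (forall i : 'I_N, normc (v i) <= A) -> \sum_(i < N) normc (v i) <= N%:R * z ->
  \sum_(i < N) normc (v i) `^ p <=
    N%:R * (A `^ (p - q) * (\sum_f normc (signed_sum f v) `^ q * (~~ X f)%:R) +
      A `^ (p - 1) * (z `^ (1 - s) *
        (2 * (((2 ^ N)%:R)^-1 * \sum_f normc (signed_sum f v) `^ s * (X f)%:R)))).
Proof.
move=> N0 lt_qp s0 s1 A0 z0 vA vz.
have F0 (r : R) f (Z : bool) : 0 <= normc (signed_sum f v) `^ r * Z%:R :> R.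
  by rewrite mulr_ge0// powR_ge0.
apply: low_pointwise => //.
- by apply: sumr_ge0 => f _; exact: F0.
- by rewrite mulr_ge0// mulr_ge0 ?invr_ge0// sumr_ge0// => f _; exact: F0.
- by move=> i iN; exact: (vA (Ordinal iN)).
move=> i iN; have [|lt] := leP (normc (v i) `^ q) _; [by left|right].
have P0 : 0 < (2 ^ N)%:R :> R by rewrite ltr0n expn_gt0.
rewrite mulrCA ler_pdivlMl//.
apply: (@sign_half _ N v (Ordinal iN) (fun f => normc (signed_sum f v) `^ s * (X f)%:R)) => //.
move=> f /= le; case: (boolP (X f)) => [Xf|nXf].
  by rewrite mulr1; apply: powR_le => //; [exact: normc_ge0|exact: ltW].
move: lt; rewrite ltNge => /negP; case.
apply: le_trans (powR_le (normc_ge0 _) le (ltW q0)) _.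
rewrite (bigD1 f)//= nXf mulr1 lerDl sumr_ge0// => g _; exact: F0.
Qed.

Lemma power_le2 (N : nat) (B s : R) : 0 <= B -> B <= 2 * N%:R -> 0 < s ->
  s * (2 * N%:R) <= 1 -> B `^ s <= 2.
Proof.
move=> B0 BN s0 sN; apply: (@le_trans _ _ ((2 ^+ (2 * N)) `^ s)).
  apply: powR_le (ltW s0) => //; apply: le_trans BN _.
  by rewrite -natrM -natrX ler_nat ltnW// ltn_expl.
rewrite -powR_mulrn// -powRrM natrM mulrC -[leRHS]powRr1//.
by apply: ler_powR => //; rewrite ler1n.
Qed.

(** By sup_bound the coordinates v i are at most A = 2 K almost everywhere,
    and sign_max bounds their mean by z, a multiple of 1 / k. low_at bounds
    the sum of |v i|^p by N times z^(1-s) times an average of the s-th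
    powers of the signed sums, whose integral is at most a constant because
    s is so small that B^s <= 2. *)
Lemma not_separated_low x dl : q < p -> separated_fixed x dl -> False.
Proof.
move=> lt_qp [dl0 x1 xd xS].
have [I I0 IP] := concentrated_low lt_qp.
have [K' K'0 KP] := sup_bound C1 jC lt_qp.
pose c := dl / (2 * C); have c0 : 0 < c by rewrite divr_gt0// mulr_gt0.
have cp4 : 0 < c `^ p / 4 by rewrite divr_gt0// powR_gt0.
pose A := 2 * K'; have A0 : 0 < A by rewrite mulr_gt0.
pose W := A `^ (p - 1) * (4 * I).
have W0 : 0 <= W by rewrite mulr_ge0 ?powR_ge0// mulr_ge0// ltW.
have [rh' rh'0 rhP] := small_quotient W0 cp4.
(* z <= rh^2 gives z^(1-s) <= rh for every s <= 1/2, uniformly in s. *)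
pose rh := Num.min 1 rh'; have rh0 : 0 < rh by rewrite lt_min ltr01.
have rh1 : rh <= 1 by rewrite ge_min lexx.
have rhle : rh <= rh' by rewrite ge_min lexx orbT.
pose k := (Num.bound (4 * K' / rh ^+ 2)).+1.
have kR : 0 < k%:R :> R by rewrite ltr0n.
pose z : R := 4 * K' / k%:R; have z0 : 0 < z by rewrite divr_gt0// mulr_gt0.
have zrh : z <= rh ^+ 2.
  rewrite ler_pdivrMr// [leRHS]mulrC -ler_pdivrMr ?exprn_gt0//.
  have /archi_boundP/ltW h : 0 <= 4 * K' / rh ^+ 2.
    by rewrite divr_ge0 ?mulr_ge0 ?sqr_ge0// ltW.
  by rewrite (le_trans h)// ler_nat.
have [N N0 NP] := signed_concentration (isT : (0 < k)%N) dl0 x1 xd xS.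
have NR : 0 < N%:R :> R by rewrite ltr0n.
have N2 : 0 < 2 * N%:R :> R by rewrite mulr_gt0.
have [s [s0 sle cI]] : exists s, [/\ 0 < s, s <= Num.min 2^-1 (2 * N%:R)^-1 & conc s I].
  by apply: IP; rewrite lt_min !invr_gt0 N2 andbT.
have s2 : s <= 2^-1 by move: sle; rewrite le_min => /andP[].
have sN : s * (2 * N%:R) <= 1.
  by move: sle; rewrite le_min => /andP[_]; rewrite -[leRHS]mul1r ler_pdivlMr.
have s1 : s < 1 by apply: le_lt_trans s2 _; rewrite invf_lt1// ltr1n.
have zs : z `^ (1 - s) <= rh.
  have h1s : 0 <= 1 - s by rewrite subr_ge0 ltW.
  apply: le_trans (powR_le (ltW z0) zrh h1s) _.
  rewrite -powR_mulrn ?(ltW rh0)// -powRrM -[leRHS]powRr1 ?(ltW rh0)//.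
  apply: ger_powR; first by rewrite rh0.
  have : 2 * s <= 1 by rewrite -ler_pdivlMl// mulr1.
  by move=> h; rewrite mulrBr mulr1 lerBrDr -lerBrDl; apply: le_trans h _; lra.
pose B : R := 2 * N%:R / k%:R; have B0 : 0 < B by rewrite divr_gt0.
have B2 : B `^ s <= 2.
  apply: (@power_le2 N) => //; first exact: ltW.
  by rewrite ler_pdivrMr// ler_peMr ?(ltW N2)// ler1n.
pose P : R := (2 ^ N)%:R; have P0 : 0 < P by rewrite ltr0n expn_gt0.
have [e e0 eP] := small_quotient (mulr_ge0 (powR_ge0 A (p - q)) (ltW P0)) cp4.
have [E [v [chE vE HE]]] := NP s _ e s0 cI e0.
have HE3 f := let: And3 _ _ h := HE f in h.
have [D DP] := choice HE3; have [a aP] := choice DP; have [b bP] := choice aP.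
have w0 (t : Om2) : 0 <= E t `^ q by exact: powR_ge0.
have hv (i : 'I_N) : HI E (fun t => normc (v i t) `^ p) (nm (j (el E (v i))) `^ p).
  by have [vi _ _] := vE i (ltn_ord i); exact: elt_np chE vi.
have lhs := hasI_sum (wt_meas chE) w0 (index_enum 'I_N) hv.
have hb f : HI E (fun t => normc (signed_sum f (v ^~ t)) `^ q * \1_(~` D f) t) (b f).
  by have [] := bP f.
have ha f : HI E (fun t => normc (signed_sum f (v ^~ t)) `^ s * \1_(D f) t) (a f).
  by have [] := bP f.
have hB := hasI_sum (wt_meas chE) w0 (index_enum {ffun 'I_N -> bool}) hb.
have hG := hasI_sum (wt_meas chE) w0 (index_enum {ffun 'I_N -> bool}) ha.
have iP : 0 <= P^-1 by rewrite invr_ge0 ltW.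
have rhs := HI_Z chE (ltW NR) (HI_D chE (HI_Z chE (powR_ge0 A (p - q)) hB)
  (HI_Z chE (powR_ge0 A (p - 1)) (HI_Z chE (powR_ge0 z (1 - s))
    (HI_Z chE (ler0n _ 2) (HI_Z chE iP hG))))).
have vA : {ae mu2, forall t, forall i : 'I_N, normc (v i t) <= A}.
  apply: filter_forall => i; have [vi v2 _] := vE i (ltn_ord i).
  apply: filterS (KP E _ chE vi) => t le; apply: le_trans le _.
  by rewrite /A mulrC ler_wpM2r// ltW.
have HA : {ae mu2, forall t, forall f : {ffun 'I_N -> bool},
    normc (signed_sum f (v ^~ t)) <= K' * B}.
  apply: filter_forall => f; have [fE fn _] := HE f.
  apply: filterS (KP E _ chE fE) => t le; apply: le_trans le _.
  by rewrite ler_wpM2l// ltW.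
have main := hasI_le_ae (wt_meas chE) w0 lhs rhs.
have {}main : \sum_(i < N) nm (j (el E (v i))) `^ p <= N%:R * (A `^ (p - q) * \sum_f b f +
    A `^ (p - 1) * (z `^ (1 - s) * (2 * (P^-1 * \sum_f a f)))).
  apply: main; apply: filterS2 vA HA => t vAt HAt.
  have vz : \sum_(i < N) normc (v i t) <= N%:R * z.
    have [f fP] := sign_max N (v ^~ t); apply: le_trans fP _.
    have -> : N%:R * z = 2 * (K' * B) by rewrite /z /B; field; exact: lt0r_neq0.
    by rewrite ler_wpM2l.
  have := @low_at N (v ^~ t) A z s (fun f => t \in D f) N0 lt_qp s0 s1 (ltW A0) (ltW z0) vAt vz.
  rewrite (eq_bigr (fun f => normc (signed_sum f (v ^~ t)) `^ q * \1_(~` D f) t)); last first.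
    by move=> f _; rewrite indicE in_setC.
  have -> // : \sum_f normc (signed_sum f (v ^~ t)) `^ s * \1_(D f) t =
      \sum_f normc (signed_sum f (v ^~ t)) `^ s * (t \in D f)%:R.
  by apply: eq_bigr => f _; rewrite indicE.
have lb : N%:R * c `^ p <= \sum_(i < N) nm (j (el E (v i))) `^ p.
  rewrite mulr_natl -[X in _ *+ X](card_ord N) -sumr_const ler_sum// => i _.
  by have [_ _ vj] := vE i (ltn_ord i); apply: powR_le vj (ltW p0); exact: ltW.
have Pcard (u : R) : \sum_(f : {ffun 'I_N -> bool}) u = P * u.
  by rewrite sumr_const card_ffun card_bool card_ord mulr_natl.
have ub1 : A `^ (p - q) * \sum_f b f <= c `^ p / 4.
  apply: le_trans eP; rewrite -mulrA ler_wpM2l ?powR_ge0// -Pcard.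
  by apply: ler_sum => f _; have [] := bP f.
have ub2 : 2 * (P^-1 * \sum_f a f) <= 4 * I.
  have h : \sum_f a f <= P * (2 * I).
    rewrite -Pcard; apply: ler_sum => f _; have [_ _ af _ _] := bP f.
    by apply: le_trans af _; apply: ler_wpM2r => //; exact: ltW.
  have -> : 4 * I = 2 * (P^-1 * (P * (2 * I))) by field; exact: lt0r_neq0.
  by rewrite ler_wpM2l// ler_wpM2l.
have ub3 : A `^ (p - 1) * (z `^ (1 - s) * (2 * (P^-1 * \sum_f a f))) <= c `^ p / 4.
  apply: le_trans rhP; rewrite /W -mulrA ler_wpM2l ?powR_ge0// mulrC.
  have a0 : 0 <= 2 * (P^-1 * \sum_f a f).
    rewrite mulr_ge0// mulr_ge0// sumr_ge0// => f _.
    exact: HI_ge0 (ha f).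
  by apply: ler_pM => //; [exact: powR_ge0|exact: le_trans rhle].
have := le_trans lb (le_trans main (ler_wpM2l (ltW NR) (lerD ub1 ub3))).
by rewrite ler_pM2l// => h; move: cp4; lra.
Qed.

End final.

(** * Almost eigenvectors *)

Section reduction.
Context (R : realType) (p q : R) (p1 : 1 < p) (q1 : 1 < q) (pq : p <> q).
Context (d1 d2 : measure_display) (Om1 : measurableType d1) (Om2 : measurableType d2).
Variables (mu1 : {measure set Om1 -> \bar R}) (mu2 : {measure set Om2 -> \bar R}).
Local Notation X := (cLspace mu1 (ltW p1)).
Local Notation Y := (cLspace mu2 (ltW q1)).
Variables (j : {linear Y -> X}) (j_inj : injective j) (j_lat : lattice_homomorphism j).
Variable T : {linear X -> X}.
Hypotheses (T1 : forall x, nm (T x) <= nm x) (T_range : range T `<=` range j).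
Hypothesis jTj1 : (opnorm (induced_operator j T) <= 1)%E.

Lemma factorization : exists S : {linear X -> Y},
  (forall x, j (S x) = T x) /\ (forall u, S (j u) = induced_operator j T u).
Proof.
pose S x := 'pinv_(fun=> 0) [set: Y] j (T x).
have jS x : j (S x) = T x by apply: pinvK; apply/mem_set/T_range; exists x.
have Slin a x y : S (a *: x + y) = a *: S x + S y.
  by apply: j_inj; rewrite jS !linearP !jS.
by have [S' S'E] := linear_pack Slin; exists S'; split => [x|u]; rewrite S'E.
Qed.

(** Closed graph: if x_n --> l and S x_n --> y, then j y is the limit of T
    x_n. *)
Lemma factorization_bounded (S : {linear X -> Y}) : (forall x, j (S x) = T x) ->
  exists2 C : R, 0 <= C & forall x, nm (S x) <= C * nm x.
Proof.
move=> jS; apply: closed_graph; [exact: cLspace_complete|exact: cLspace_complete|].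
move=> x l y xl Sy; apply: j_inj; rewrite jS.
have [C C0 jC] := j_bounded j_lat.
apply/eqP; rewrite -subr_eq0; apply/eqP; apply: nm_small => e e0.
have [N1 N1P] := xl (e / 2) (divr_gt0 e0 (@ltr0n R 2)).
have [N2 N2P] := Sy (e / 2 / C) (divr_gt0 (divr_gt0 e0 (@ltr0n R 2)) C0).
pose n := maxn N1 N2.
apply: le_trans (nm_tri _ (T (x n)) _) _.
have h1 : nm (T l - T (x n)) <= e / 2.
  rewrite -linearB; apply: le_trans (T1 _) _; rewrite nmBC.
  by apply: N1P; exact: leq_maxl.
have h2 : nm (T (x n) - j y) <= e / 2.
  rewrite -jS -linearB; apply: le_trans (jC _) _.
  by rewrite mulrC -ler_pdivlMr//; apply: N2P; exact: leq_maxr.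
by rewrite (splitr e) lerD.
Qed.

(** Without a cluster point there is a separated subsequence x_n of almost
    eigenvectors. Then y_n = S x_n, rescaled by be into the unit ball, is
    almost fixed by P = l0^-1 S j, and stays separated because |x_m - x_n|
    is almost |j (S (x_m - x_n))| <= C |S (x_m - x_n)|. *)
Lemma unimodular_clusters (l0 : R[i]) : normc l0 = 1 -> almost_eigen_clusters T l0.
Proof.
move=> l1; have [S [jS SjT]] := factorization.
have [C1 C10 SC1] := factorization_bounded jS.
have [C2 C20 jC2] := j_bounded j_lat.
have Sj_q u : nm (S (j u)) <= nm u.
  have Slin a x y : (S \o j) (a *: x + y) = a *: (S \o j) x + (S \o j) y.
    by rewrite /= !linearP.
  have [S' S'E] := linear_pack Slin.
  have := @opnorm_le1 _ _ _ S' _ u; rewrite S'E; apply.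
  rewrite (_ : (S' : Y -> Y) = induced_operator j T)//.
  by apply/funext => x; rewrite S'E /= SjT.
move=> x B xB xT; apply: cluster_exists; first exact: cLspace_complete.
move=> phi phi_mono d d0; apply: contrapT => no_close.
have far m n : (m < n)%N -> d <= nm (x (phi m) - x (phi n)).
  by move=> mn; rewrite leNgt; apply/negP => lt; apply: no_close; exists m, n.
have phi_ge n : (n <= phi n)%N.
  elim: n => // n ih; exact: leq_ltn_trans ih (phi_mono n n.+1 (ltnSn n)).
pose C := 1 + C1 + C2; have Cge1 : 1 <= C by rewrite /C; lra.
have Cgt : 0 < C by exact: lt_le_trans ltr01 Cge1.
have SC u : nm (S u) <= C * nm u.
  by apply: le_trans (SC1 u) _; apply: ler_wpM2r; [exact: nm_ge0|rewrite /C; lra].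
have jC u : nm (j u) <= C * nm u.
  by apply: le_trans (jC2 u) _; apply: ler_wpM2r; [exact: nm_ge0|rewrite /C; lra].
have B0 : 0 <= B by exact: le_trans (nm_ge0 _) (xB 0%N).
(* The scaling that brings the S x_n into the unit ball. *)
pose be := (C * (B + 1))^-1.
have CB : 0 < C * (B + 1) by rewrite mulr_gt0// ltr_wpDl.
have be0 : 0 < be by rewrite invr_gt0.
have l0n : l0 != 0 by apply/eqP => l00; move: l1; rewrite l00 normc0 => /eqP; rewrite eq_sym oner_eq0.
have il1 : normc (l0^-1) = 1.
  have := normcM l0 l0^-1; rewrite mulfV// l1 mul1r => <-.
  by have := @normc_real R 1; rewrite normr1.
have Plin a u v : l0^-1 *: S (j (a *: u + v)) = a *: (l0^-1 *: S (j u)) + l0^-1 *: S (j v).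
  by rewrite (linearP j) (linearP S) scalerDr !scalerA mulrC.
have [P PE] := linear_pack (f := fun u : Y => l0^-1 *: S (j u)) Plin.
have nmP u : nm (P u) = nm (S (j u)) by rewrite PE nmZ il1 mul1r.
have P_q u : nm (P u) <= nm u by rewrite nmP.
have P_p u : nm (j (P u)) <= nm (j u) by rewrite PE linearZ /= nmZ il1 mul1r jS.
have P_C u : nm (P u) <= C * nm (j u) by rewrite nmP.
have d4 : 0 < d / 4 by rewrite divr_gt0.
have [n1 n1P] := xT _ d4.
pose y n := be%:C *: S (x (phi (n1 + n)%N)).
have ySep : separated_fixed P y (be * (d / (2 * C))).
  split.
  - by rewrite mulr_gt0// divr_gt0// mulr_gt0.
  - move=> n; rewrite nmZr ger0_norm ?(ltW be0)// /be ler_pdivrMl//.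
    rewrite mulr1; apply: le_trans (SC _) _; rewrite ler_wpM2l ?(ltW Cgt)//.
    by apply: le_trans (xB _) _; rewrite lerDl.
  - move=> m n mn; rewrite /y -scalerBr nmZr ger0_norm ?(ltW be0)// ler_wpM2l ?(ltW be0)//.
    have fmn := @far (n1 + m)%N (n1 + n)%N ltac:(by rewrite ltn_add2l).
    set xm := x _ in fmn *; set xn := x (phi (n1 + n)%N) in fmn *.
    have hm : nm (l0 *: xm - T xm) <= d / 4.
      by apply: n1P; apply: leq_trans (leq_addr _ _) (phi_ge _).
    have hn : nm (l0 *: xn - T xn) <= d / 4.
      by apply: n1P; apply: leq_trans (leq_addr _ _) (phi_ge _).
    have h1 : nm (l0 *: (xm - xn)) <= nm (T (xm - xn)) + d / 2.
      have -> : l0 *: (xm - xn) = T (xm - xn) + ((l0 *: xm - T xm) - (l0 *: xn - T xn)).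
        have -> : (l0 *: xm - T xm) - (l0 *: xn - T xn) = l0 *: (xm - xn) - T (xm - xn).
          by rewrite scalerBr [T (_ - _)]linearB /= !opprD addrACA.
        by rewrite [RHS]addrC subrK.
      apply: le_trans (nmD _ _) _; rewrite lerD2l; apply: le_trans (nmB _ _) _.
      by apply: le_trans (lerD hm hn) _; rewrite -mulr2n -mulr_natr; lra.
    rewrite nmZ l1 mul1r -jS in h1.
    rewrite ler_pdivrMr ?mulr_gt0// -linearB.
    have := jC (S (xm - xn)); lra.
  - move=> e e0; have [n0 n0P] := xT (e / (be * C)) (divr_gt0 e0 (mulr_gt0 be0 Cgt)).
    exists n0 => n nn; rewrite PE /y linearZ /= jS.
    set xn := x _; have -> : l0^-1 *: S (be%:C *: T xn) - be%:C *: S xn =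
        - (be%:C *: (l0^-1 *: S (l0 *: xn - T xn))).
      rewrite [S (be%:C *: _)]linearZ [S (_ - _)]linearB [S (l0 *: _)]linearZ /=.
      rewrite [l0^-1 *: (_ - _)]scalerBr [l0^-1 *: (l0 *: _)]scalerA mulVf// scale1r.
      rewrite [be%:C *: (_ - _)]scalerBr opprB.
      by rewrite !scalerA [l0^-1 * _]mulrC.
    rewrite nmN nmZr nmZ il1 mul1r ger0_norm ?(ltW be0)//.
    apply: le_trans (ler_wpM2l (ltW be0) (SC _)) _.
    rewrite mulrA mulrC -ler_pdivlMr ?mulr_gt0//; apply: n0P.
    apply: leq_trans nn _; apply: leq_trans (phi_ge n) _.
    have [->|n1p] := posnP n1; first by rewrite add0n.
    by apply: ltnW; apply: phi_mono; rewrite -[ltnLHS]add0n ltn_add2r.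
have [lt|lt|eq] := ltgtP p q; last exact: pq.
- exact: (not_separated_high pq j_lat j_inj Cge1 P_q P_p jC P_C lt ySep).
- exact: (not_separated_low pq j_lat j_inj Cge1 P_q P_p jC P_C lt ySep).
Qed.

End reduction.

Theorem theorem4p5 (R : realType) (p q : R) (p1 : 1 < p) (q1 : 1 < q)
  (pq : p <> q)
  (d1 d2 : measure_display)
  (Omega1 : measurableType d1) (Omega2 : measurableType d2)
  (mu1 : {measure set Omega1 -> \bar R}) (mu2 : {measure set Omega2 -> \bar R})
  (j : {linear cLspace mu2 (ltW q1) -> cLspace mu1 (ltW p1)})
  (j_inj : injective j) (j_lattice : lattice_homomorphism j)
  (T : {linear cLspace mu1 (ltW p1) -> cLspace mu1 (ltW p1)})
  (T_le1 : (opnorm T <= 1)%E)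
  (T_range : range T `<=` range j)
  (jTj_le1 : (opnorm (induced_operator j T) <= 1)%E) :
  (ess_spectral_radius T < 1)%E.
Proof.
have T1 := opnorm_le1 T_le1.
apply: ess_spectral_radius_lt1 => //; first exact: cLspace_complete.
by move=> l0 l1; exact: (unimodular_clusters pq j_inj j_lattice T1 T_range jTj_le1 l1).
Qed.
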